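(* Let $M$ be a compact strictly pseudoconvex CR manifold of CR dimension $n$ and $\theta$ a contact form on $M$ with $G_\theta$ positive definite, such that $\rho(X,X)+2A(X,JX)\ge k\,G_\theta(X,X)$ for some $k>0$ and any $X\in H(M)$. Assume that $\lambda\equiv-2nk/(2n-1)\in\mathrm{Spec}(\Delta_b)$ and $\mathcal{H}\equiv\mathrm{Eigen}(\Delta_b;\lambda)\cap\mathrm{Ker}(T)\neq(0)$. Let $f\in\mathcal{H}$, put $c=k/(2n-1)$, and let $x_0\in M$ be a point such that $f(x_0)=\sup_{x\in M}f(x)\equiv\alpha$. (1) One has $$f(\gamma(s))=\alpha\cos(s\sqrt c),\qquad s\in\mathbb{R},$$ along each lengthy geodesic $\gamma:\mathbb{R}\to M$ of the Tanaka-Webster connection $\nabla$ such that $|\dot\gamma(s)|=1$ and $\gamma(0)=x_0$. (2) Assume additionally that $(M,\theta)$ is Sasakian ($\tau=0$). (2a) If any two points of $M$ can be joined by a lengthy geodesic of $\nabla$ which is minimizing for the Carnot-Carathéodory distance $d_{CC}$, then $f(x)=\alpha\cos(r(x)\sqrt c)$ for all $x\in M$, where $r(x)=d_{CC}(x_0,x)$ is the Carnot-Carathéodory distance from $x_0$. (2b) If $y_0\in M$ is a point such that $f(y_0)=\inf_{x\in M}f(x)$ then $f(y_0)=-\alpha$. (2c) Consequently $M_{\pi/\sqrt c}$ consists solely of critical points of $f$, and each $x\in M_{\pi/\sqrt c}$ is degenerate. Here, for $s\in\mathbb{R}$, $M_s$ is the set of all $x\in M$ such that there is a lengthy geodesic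 $\gamma:\mathbb{R}\to M$ of $\nabla$, parametrized by arc length, with $\gamma(0)=x_0$ and $\gamma(s)=x$.
   Context: A CR manifold $(M,T_{1,0}(M))$ of CR dimension $n$ is an oriented smooth $(2n+1)$-dimensional manifold with a complex rank $n$ involutive subbundle $T_{1,0}(M)\subset T(M)\otimes\mathbb{C}$ with $T_{1,0}(M)\cap T_{0,1}(M)=(0)$, $T_{0,1}(M)=\overline{T_{1,0}(M)}$. $H(M)=\mathrm{Re}\{T_{1,0}(M)\oplus T_{0,1}(M)\}$, with complex structure $J(Z+\overline Z)=i(Z-\overline Z)$, $Z\in T_{1,0}(M)$. A pseudohermitian structure is a real $1$-form $\theta$ with $\mathrm{Ker}(\theta)=H(M)$; the Levi form is $G_\theta(X,Y)=(d\theta)(X,JY)$, $X,Y\in H(M)$ (exterior derivative normalized by $2\,d\theta(X,Y)=X(\theta(Y))-Y(\theta(X))-\theta([X,Y])$). $M$ is strictly pseudoconvex if $G_\theta$ is positive definite for some choice of $\theta$; $\theta$ is chosen so that $G_\theta$ is positive definite, and $\theta$ is then a contact form. $T$ (the characteristic direction of $d\theta$) is the vector field with $\theta(T)=1$, $T\rfloor d\theta=0$; $J$ is extended by $JT=0$. The Webster metric is the Riemannian metric $g_\theta$ with $g_\theta=G_\theta$ on $H(M)$, $g_\theta(X,T)=0$ for $X\in H(M)$, $g_\theta(T,T)=1$. $\pi_H:T(M)\to H(M)$ is the projection relative to $T(M)=H(M)\oplus\mathbb{R}T$. The Tanaka-Webster connection $\nabla$ is the unique linear connection on $M$ such that $H(M)$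 is $\nabla$-parallel, $\nabla g_\theta=0$, $\nabla J=0$, and its torsion $T_\nabla$ satisfies $T_\nabla(Z,W)=0$, $T_\nabla(Z,\overline W)=2iG_\theta(Z,\overline W)T$ for $Z,W\in T_{1,0}(M)$ ($G_\theta$ extended $\mathbb{C}$-bilinearly), and $\tau\circ J+J\circ\tau=0$, where $\tau(X)=T_\nabla(T,X)$. The sublaplacian is $\Delta_b f=\mathrm{div}(\nabla^H f)$, where $\nabla^H f=\pi_H\nabla f$, $g_\theta(\nabla f,X)=X(f)$, and the divergence is with respect to $g_\theta$. $\mathrm{Eigen}(\Delta_b;\lambda)=\{f\in C^\infty(M):\Delta_bf=\lambda f\}$ (real-valued functions), $\mathrm{Spec}(\Delta_b)$ is the set of eigenvalues, and $\mathrm{Ker}(T)$ is the set of smooth functions $f$ with $T(f)=0$. $\rho(X,Y)=\mathrm{trace}\{Z\mapsto R(Z,Y)X\}$ with $R$ the curvature tensor of $\nabla$, $R(X,Y)=\nabla_X\nabla_Y-\nabla_Y\nabla_X-\nabla_{[X,Y]}$, and $A(X,Y)=g_\theta(\tau X,Y)$ is the pseudohermitian torsion. A piecewise $C^1$ curve $\gamma$ is lengthy if $\dot\gamma(t)\in H(M)_{\gamma(t)}$ wherever $\dot\gamma(t)$ is defined; its length is $\int G_\theta(\dot\gamma,\dot\gamma)^{1/2}dt$. A lengthy geodesic of $\nabla$ is a lengthy curve with $\nabla_{\dot\gamma}\dot\gamma=0$. The Carnot-Carathéodory distance $d_{CC}(x,y)$ is the infimum of the lengths of all lengthy curves joining $x$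 and $y$. A critical point of $f$ is degenerate if the (ordinary) Hessian bilinear form of $f$ at that point is degenerate. *)

(* Defs.v *)
From HB Require Import structures.
From mathcomp Require Import all_boot all_order all_algebra.
From mathcomp Require Import all_classical all_reals all_analysis.
From mathcomp Require Import complex.

Set Implicit Arguments.
Unset Strict Implicit.
Unset Printing Implicit Defensive.

Import Order.TTheory GRing.Theory Num.Theory.
Import numFieldNormedType.Exports.

Local Open Scope classical_set_scope.
Local Open Scope ring_scope.
Local Open Scope complex_scope.

Section SmoothMaps.
Variables (R : realType) (V W : normedModType R).

Fixpoint iterated_derive (vs : seq V) (f : V -> W) : V -> W :=
  if vs is v :: vs' then (fun x => 'D_v (iterated_derive vs' f) x) else f.

(* C^oo on A; meant for open A, the values of f off A being irrelevant. *)
Definition smooth_on (A : set V) (f : V -> W) : Prop :=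
  forall (vs : seq V) (x : V), A x -> differentiable (iterated_derive vs f) x.

End SmoothMaps.

Record chart (R : realType) (M : topologicalType) (m : nat) := Chart {
  chart_dom : set M;
  chart_fun : M -> 'rV[R]_m;
  chart_inv : 'rV[R]_m -> M }.

Section Charts.
Variables (R : realType) (M : topologicalType) (m : nat).
Implicit Types c : chart R M m.

Definition chart_img c : set 'rV[R]_m := chart_fun c @` chart_dom c.

Definition is_chart c : Prop :=
  [/\ open (chart_dom c), open (chart_img c),
      (forall x, chart_dom c x -> chart_inv c (chart_fun c x) = x),
      {within chart_dom c, continuous (chart_fun c)} &
      {within chart_img c, continuous (chart_inv c)}].

Definition transition c c' : 'rV[R]_m -> 'rV[R]_m :=
  chart_fun c' \o chart_inv c.

Definition oriented_compatible c c' : Prop :=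
  smooth_on (chart_fun c @` (chart_dom c `&` chart_dom c')) (transition c c') /\
  forall x, chart_dom c x -> chart_dom c' x ->
    0 < \det ('J (transition c c') (chart_fun c x)).

End Charts.

(* Oriented smooth manifold without boundary, pure of dimension m. *)
Record oriented_manifold (R : realType) (m : nat) := OrientedManifold {
  mfd_sort :> topologicalType;
  mfd_atlas : set (chart R mfd_sort m);
  mfd_hausdorff : hausdorff_space mfd_sort;
  mfd_countable : @second_countable mfd_sort;
  mfd_chart : forall c, mfd_atlas c -> is_chart c;
  mfd_cover : forall x : mfd_sort, exists2 c, mfd_atlas c & chart_dom c x;
  mfd_compat : forall c c', mfd_atlas c -> mfd_atlas c' ->
    oriented_compatible c c' }.

Section Manifolds.
Variables (R : realType) (m : nat) (M : oriented_manifold R m).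
Local Notation tvec := ((M -> R) -> R).
Local Notation vfield := (M -> tvec).

Definition smooth (f : M -> R) : Prop :=
  forall c, mfd_atlas c -> smooth_on (chart_img c) (f \o chart_inv c).

(* T_x(M) as the derivations of C^oo(M) at x. A derivation is extended by 0 to
   the non-smooth functions, so that equality of tangent vectors is Leibniz
   equality in the function space (M -> R) -> R. *)
Definition tangent (x : M) (v : tvec) : Prop :=
  [/\ forall f, ~ smooth f -> v f = 0,
      forall f h, smooth f -> smooth h -> v (fun y => f y + h y) = v f + v h,
      forall (a : R) f, smooth f -> v (fun y => a * f y) = a * v f &
      forall f h, smooth f -> smooth h ->
        v (fun y => f y * h y) = v f * h x + f x * v h].

Definition is_vfield (X : vfield) : Prop :=
  (forall x, tangent x (X x)) /\
  (forall f, smooth f -> smooth (fun x => X x f)).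

Definition bracket (X Y : vfield) : vfield :=
  fun x f => X x (fun y => Y y f) - Y x (fun y => X y f).

(* Pointwise values of expressions in vector fields that are tensorial: the
   argument vectors are extended to arbitrary global vector fields. *)
Definition ext2 (A : nmodType) (B : vfield -> vfield -> A) (x : M)
    (u v : tvec) : A :=
  xget 0 [set r | exists X Y, [/\ is_vfield X, is_vfield Y, X x = u, Y x = v &
    r = B X Y]].
Definition ext3 (A : nmodType) (B : vfield -> vfield -> vfield -> A) (x : M)
    (u v w : tvec) : A :=
  xget 0 [set r | exists X Y Z, [/\ is_vfield X, is_vfield Y & is_vfield Z] /\
    [/\ X x = u, Y x = v, Z x = w & r = B X Y Z]].

Definition is_basis (x : M) (e : 'I_m -> tvec) : Prop :=
  [/\ forall i, tangent x (e i),
      forall v, tangent x v -> exists a : 'I_m -> R, v = \sum_i a i *: e i &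
      forall a : 'I_m -> R, \sum_i a i *: e i = 0 -> forall i, a i = 0].

Definition trace_at (x : M) (L : tvec -> tvec) : R :=
  xget 0 [set r | exists (e : 'I_m -> tvec) (A : 'M[R]_m),
    [/\ is_basis x e, forall j, L (e j) = \sum_i A i j *: e i & r = \tr A]].

Definition is_one_form (theta : M -> tvec -> R) : Prop :=
  (forall x (a : R) u v, tangent x u -> tangent x v ->
     theta x (a *: u + v) = a * theta x u + theta x v) /\
  (forall X, is_vfield X -> smooth (fun x => theta x (X x))).

(* Normalized by 2 dtheta(X,Y) = X(theta Y) - Y(theta X) - theta [X,Y]. *)
Definition ext_deriv (theta : M -> tvec -> R) (x : M) : tvec -> tvec -> R :=
  ext2 (fun X Y => 2^-1 * (X x (fun y => theta y (Y y))
    - Y x (fun y => theta y (X y)) - theta x (bracket X Y x))) x.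

(* D x v Y is the covariant derivative at x of the field Y along v. *)
Definition connection := M -> tvec -> vfield -> tvec.

Definition is_connection (D : connection) : Prop :=
  [/\ forall X Y, is_vfield X -> is_vfield Y -> is_vfield (fun x => D x (X x) Y),
      forall x (a : R) u v Y, tangent x u -> tangent x v -> is_vfield Y ->
        D x (a *: u + v) Y = a *: D x u Y + D x v Y,
      forall x u Y Z, tangent x u -> is_vfield Y -> is_vfield Z ->
        D x u (fun y => Y y + Z y) = D x u Y + D x u Z &
      forall x u h Y, tangent x u -> smooth h -> is_vfield Y ->
        D x u (fun y => h y *: Y y) = u h *: Y x + h x *: D x u Y].

Definition cov (D : connection) (X Y : vfield) : vfield := fun x => D x (X x) Y.

Definition torsion (D : connection) (x : M) : tvec -> tvec -> tvec :=
  ext2 (fun X Y => cov D X Y x - cov D Y X x - bracket X Y x) x.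

Definition curvature (D : connection) (x : M) : tvec -> tvec -> tvec -> tvec :=
  ext3 (fun X Y Z => cov D X (cov D Y Z) x - cov D Y (cov D X Z) x
    - cov D (bracket X Y) Z x) x.

Definition ricci (D : connection) (x : M) (u v : tvec) : R :=
  trace_at x (fun w => curvature D x w v u).

Definition metric_connection (g : M -> tvec -> tvec -> R) (D : connection) :=
  forall x u Y Z, tangent x u -> is_vfield Y -> is_vfield Z ->
    u (fun y => g y (Y y) (Z y)) = g x (D x u Y) (Z x) + g x (Y x) (D x u Z).

Definition is_levi_civita (g : M -> tvec -> tvec -> R) (D : connection) :=
  [/\ is_connection D, metric_connection g D &
      forall x u v, tangent x u -> tangent x v -> torsion D x u v = 0].

Definition gradient (g : M -> tvec -> tvec -> R) (f : M -> R) : vfield :=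
  fun x => xget 0 [set v | tangent x v /\
    forall w, tangent x w -> g x v w = w f].

(* Divergence relative to a Riemannian metric with Levi-Civita connection D. *)
Definition divergence (D : connection) (X : vfield) (x : M) : R :=
  trace_at x (fun v => D x v X).

Definition critical (f : M -> R) (x : M) : Prop :=
  forall v, tangent x v -> v f = 0.

(* Well defined at critical points of f. *)
Definition hessian (f : M -> R) (x : M) : tvec -> tvec -> R :=
  ext2 (fun X Y => X x (fun y => Y y f)) x.

Definition degenerate (f : M -> R) (x : M) : Prop :=
  exists u, [/\ tangent x u, u <> 0 &
    forall v, tangent x v -> hessian f x u v = 0].

Definition velocity (gamma : R -> M) (t : R) : tvec :=
  fun f => if `[< smooth f >] then derive1 (f \o gamma) t else 0.

Definition smooth_curve (I : set R) (gamma : R -> M) : Prop :=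
  (forall t, I t -> {for t, continuous gamma}) /\
  forall c, mfd_atlas c ->
    smooth_on (I `&` gamma @^-1` chart_dom c) (chart_fun c \o gamma).

Definition C1_curve (gamma : R -> M) : Prop :=
  continuous gamma /\
  forall c t, mfd_atlas c -> chart_dom c (gamma t) ->
    derivable (chart_fun c \o gamma) t 1 /\
    {for t, continuous (fun s => derive1 (chart_fun c \o gamma) s : 'rV[R]_m)}.

(* On each closed subinterval of a subdivision the curve coincides with a
   curve of class C^1 defined on R. *)
Definition piecewise_C1 (a b : R) (gamma : R -> M) : Prop :=
  exists (N : nat) (t : nat -> R),
    [/\ t 0%N = a, t N = b, forall i, (i < N)%N -> t i < t i.+1 &
      forall i, (i < N)%N -> exists sigma, C1_curve sigma /\
        forall s, t i <= s <= t i.+1 -> gamma s = sigma s].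

Definition field_along (I : set R) (gamma : R -> M) (V : R -> tvec) : Prop :=
  (forall t, I t -> tangent (gamma t) (V t)) /\
  (forall f, smooth f -> smooth_on I (fun t => V t f)).

(* K is the covariant differentiation D/dt along gamma induced by D. *)
Definition is_cov_along (D : connection) (I : set R) (gamma : R -> M)
    (K : (R -> tvec) -> R -> tvec) : Prop :=
  [/\ forall V, field_along I gamma V -> field_along I gamma (K V),
      forall V W, field_along I gamma V -> field_along I gamma W ->
        forall t, I t -> K (fun s => V s + W s) t = K V t + K W t,
      forall (h : R -> R) V, smooth_on I h -> field_along I gamma V ->
        forall t, I t -> K (fun s => h s *: V s) t = derive1 h t *: V t + h t *: K V t &
      forall Y, is_vfield Y -> forall t, I t ->
        K (fun s => Y (gamma s)) t = D (gamma t) (velocity gamma t) Y].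

Definition geodesic_on (D : connection) (I : set R) (gamma : R -> M) : Prop :=
  smooth_curve I gamma /\
  exists K, is_cov_along D I gamma K /\
    forall t, I t -> K (velocity gamma) t = 0.

End Manifolds.

Section ComplexVectors.
Variables (R : realType) (m : nat) (M : oriented_manifold R m).
Local Notation tvec := ((M -> R) -> R).
(* Elements of T(M) (x) C, as complex valued derivations of C^oo(M). *)
Local Notation ctvec := ((M -> R) -> R[i]).

Definition re_part (Z : ctvec) : tvec := fun f => complex.Re (Z f).
Definition im_part (Z : ctvec) : tvec := fun f => complex.Im (Z f).
Definition cconj (Z : ctvec) : ctvec := fun f => conjc (Z f).
Definition complexify (v : tvec) : ctvec := fun f => (v f)%:C.

Definition ctangent (x : M) (Z : ctvec) : Prop :=
  tangent x (re_part Z) /\ tangent x (im_part Z).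

Definition is_cvfield (Z : M -> ctvec) : Prop :=
  is_vfield (fun x => re_part (Z x)) /\ is_vfield (fun x => im_part (Z x)).

Definition capply (Z : ctvec) (h : M -> R[i]) : R[i] :=
  Z (fun y => complex.Re (h y)) + (0 +i* 1) * Z (fun y => complex.Im (h y)).

Definition cbracket (Z W : M -> ctvec) : M -> ctvec :=
  fun x f => capply (Z x) (fun y => W y f) - capply (W x) (fun y => Z y f).

Definition is_cframe (n : nat) (S : set ctvec) (Z : 'I_n -> ctvec) : Prop :=
  (forall W : ctvec, S W <->
     exists a : 'I_n -> R[i], W = (fun f => \sum_i a i * Z i f)) /\
  (forall a : 'I_n -> R[i],
     (forall f, \sum_i a i * Z i f = 0) -> forall i, a i = 0).

(* C-bilinear extensions. *)
Definition cform (B : tvec -> tvec -> R) (Z W : ctvec) : R[i] :=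
  (B (re_part Z) (re_part W) - B (im_part Z) (im_part W)) +i*
  (B (re_part Z) (im_part W) + B (im_part Z) (re_part W)).
Definition cbilin (B : tvec -> tvec -> tvec) (Z W : ctvec) : ctvec :=
  fun f => cform (fun u v => B u v f) Z W.

End ComplexVectors.

(* A complex subbundle of rank n is given by its fibres, spanned near each
   point by n independent smooth fields; those fields may be taken global. *)
Record cr_manifold (R : realType) (n : nat) := CRManifold {
  cr_mfd :> oriented_manifold R n.*2.+1;
  T10 : forall x : cr_mfd, set ((cr_mfd -> R) -> R[i]);
  T10_tangent : forall x Z, T10 x Z -> ctangent x Z;
  T10_bundle : forall x0 : cr_mfd, exists Z : 'I_n -> cr_mfd -> _,
    (forall i, is_cvfield (Z i)) /\
    \forall x \near x0, is_cframe (T10 x) (fun i => Z i x);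
  T10_conj : forall x Z, T10 x Z -> T10 x (cconj Z) -> Z = (fun=> 0);
  T10_involutive : forall Z W, is_cvfield Z -> is_cvfield W ->
    (forall x, T10 x (Z x)) -> (forall x, T10 x (W x)) ->
    forall x, T10 x (cbracket Z W x) }.

Section Pseudohermitian.
Variables (R : realType) (n : nat) (M : cr_manifold R n).
Local Notation tvec := ((M -> R) -> R).
Local Notation vfield := (M -> tvec).

Definition levi_distr (x : M) (v : tvec) : Prop :=
  exists2 Z, T10 x Z & complexify v = (fun f => Z f + cconj Z f).

Definition cr_J (x : M) (v : tvec) : tvec :=
  xget 0 [set w | exists Z, [/\ T10 x Z,
    complexify v = (fun f => Z f + cconj Z f) &
    complexify w = (fun f => (0 +i* 1) * (Z f - cconj Z f))]].

Definition is_pseudohermitian (theta : M -> tvec -> R) : Prop :=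
  is_one_form theta /\
  forall x v, tangent x v -> (theta x v = 0 <-> levi_distr x v).

Variable theta : M -> tvec -> R.

Definition levi_form (x : M) (u v : tvec) : R :=
  ext_deriv theta x u (cr_J x v).

Definition levi_positive : Prop :=
  forall x v, levi_distr x v -> v <> 0 -> 0 < levi_form x v v.

Definition is_characteristic (T : vfield) : Prop :=
  [/\ is_vfield T, forall x, theta x (T x) = 1 &
      forall x v, tangent x v -> ext_deriv theta x (T x) v = 0].

Variable T : vfield.

Definition proj_H (x : M) (v : tvec) : tvec := v - theta x v *: T x.

Definition J (x : M) (v : tvec) : tvec := cr_J x (proj_H x v).

Definition webster (x : M) (u v : tvec) : R :=
  levi_form x (proj_H x u) (proj_H x v) + theta x u * theta x v.

Definition is_tanaka_webster (D : connection M) : Prop :=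
  [/\ is_connection D,
      (forall x u Y, tangent x u -> is_vfield Y ->
         (forall y, levi_distr y (Y y)) -> levi_distr x (D x u Y)),
      metric_connection webster D,
      (forall x u Y, tangent x u -> is_vfield Y ->
         D x u (fun y => J y (Y y)) = J x (D x u Y)) &
      [/\ forall x Z W, T10 x Z -> T10 x W ->
            cbilin (torsion D x) Z W = (fun=> 0),
          forall x Z W, T10 x Z -> T10 x W ->
            cbilin (torsion D x) Z (cconj W) =
              (fun f => 2 * (0 +i* 1) * cform (levi_form x) Z (cconj W)
                        * complexify (T x) f) &
          forall x v, tangent x v ->
            torsion D x (T x) (J x v) + J x (torsion D x (T x) v) = 0]].

Definition tau (D : connection M) (x : M) (v : tvec) : tvec :=
  torsion D x (T x) v.

Definition ph_torsion (D : connection M) (x : M) (u v : tvec) : R :=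
  webster x (tau D x u) v.

Definition sasakian (D : connection M) : Prop :=
  forall x v, tangent x v -> tau D x v = 0.

(* LC is the Levi-Civita connection of the Webster metric. *)
Definition sublaplacian (LC : connection M) (f : M -> R) : M -> R :=
  divergence LC (fun x => proj_H x (gradient webster f x)).

Definition Eigen (LC : connection M) (lambda : R) : set (M -> R) :=
  [set f | smooth f /\ forall x, sublaplacian LC f x = lambda * f x].

Definition Spec (LC : connection M) : set R :=
  [set lambda | exists2 f, Eigen LC lambda f & exists x, f x <> 0].

Definition Ker_T : set (M -> R) :=
  [set f | smooth f /\ forall x, T x f = 0].

Definition lengthy_on (I : set R) (gamma : R -> M) : Prop :=
  forall t, I t -> (forall f, smooth f -> derivable (f \o gamma) t 1) ->
    levi_distr (gamma t) (velocity gamma t).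

Definition speed (gamma : R -> M) (t : R) : R :=
  Num.sqrt (levi_form (gamma t) (velocity gamma t) (velocity gamma t)).

Definition curve_length (a b : R) (gamma : R -> M) : \bar R :=
  (\int[lebesgue_measure]_(t in `[a, b]) (speed gamma t)%:E)%E.

(* Equal to +oo when no lengthy curve joins x to y. *)
Definition d_CC (x y : M) : \bar R :=
  ereal_inf [set l | exists a b gamma, [/\ a < b, piecewise_C1 a b gamma,
    lengthy_on `]a, b[ gamma, gamma a = x /\ gamma b = y &
    l = curve_length a b gamma]].

Definition lengthy_geodesic_on (D : connection M) (I : set R)
    (gamma : R -> M) : Prop :=
  geodesic_on D I gamma /\ lengthy_on I gamma.

Definition lengthy_geodesic (D : connection M) : (R -> M) -> Prop :=
  lengthy_geodesic_on D [set: R].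

Definition unit_speed (gamma : R -> M) : Prop := forall s, speed gamma s = 1.

(* A geodesic arc on [a, b] is one defined on a larger open interval. *)
Definition joined_by_minimizing_geodesic (D : connection M) (x y : M) : Prop :=
  exists p a b q gamma, [/\ p < a, a < b & b < q] /\
    [/\ lengthy_geodesic_on D `]p, q[ gamma, gamma a = x, gamma b = y &
      curve_length a b gamma = d_CC x y].

Definition geodesic_sphere (D : connection M) (x0 : M) (s : R) : set M :=
  [set x | exists gamma, [/\ lengthy_geodesic D gamma, unit_speed gamma,
    gamma 0 = x0 & gamma s = x]].

End Pseudohermitian.

(* Main.v *)
(* Let Z be the horizontal gradient of f. Since T f = 0, the Bochner formula for the energy
   psi = (|Z|^2 + c f^2) / 2 reads
     Lap psi = |B|^2 + rho(Z, Z) - 2 A(Z, J Z) - k |Z|^2,  B = nabla Z + c f on H(M).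
   The traced Bianchi identity gives rho(J X, J X) = rho(X, X) - 4 (n - 1) A(X, J X), so that
   averaging the hypothesis over Z and J Z yields rho(Z, Z) - 2 A(Z, J Z) >= k |Z|^2 and psi is
   subharmonic. By the strong maximum principle for the sublaplacian (Hopf's barrier shows that
   the set of maxima is tangent to H(M), hence to [H(M), H(M)]), psi is constant on each
   component of M, and B = 0: nabla_u Z = - c f u for u in H(M). Along a lengthy geodesic this
   gives (f o gamma)'' = - c |gamma'|^2 f o gamma. At a critical point psi = c f^2 / 2, hence
   max f = - min f on each component (M need not be connected), and
   Hess f (T, Y) = T (Y f) = Y (T f) + [T, Y] f = 0. *)
Require Import Defs.
From HB Require Import structures.
From mathcomp Require Import all_boot all_order all_algebra.
From mathcomp Require Import all_classical all_reals all_analysis.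
From mathcomp Require Import complex ring lra.
Import Order.TTheory GRing.Theory Num.Theory.
Import numFieldNormedType.Exports.
Local Open Scope classical_set_scope.
Local Open Scope ring_scope.
Set Implicit Arguments.
Unset Strict Implicit.
Unset Printing Implicit Defensive.

(** * Smooth functions on normed spaces *)

(** Tangent vectors are derivations of the global smooth functions, and [ext_deriv], [torsion],
    [curvature], [trace_at] pick a value among all extensions or all bases. Every formula thus rests
    on two local facts: bump functions make derivations local, and Hadamard's lemma shows that a
    derivation is determined by its values on coordinates. Tensoriality and independence of the
    basis then identify the picked values. The Bochner formula is used pointwise, so no integral
    over M appears. No flow of a vector field is constructed either: the passage from H(M) to its
    brackets works with the second order Taylor polynomial of the flow, whose O(s^3) errors are
    negligible against the s^2 of a bracket. The constants come from the square of [B]: its cross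
    terms are absorbed exactly when lambda = - 2 n c, and |Z|^2 is then left with the coefficient
    lambda + c, which is - k for c = k / (2 n - 1). The sublaplacian is defined by the Levi-Civita
    connection, the computations use the Tanaka-Webster one; the two divergences of a horizontal
    gradient agree because torsion is vertical on horizontal pairs and tau is horizontal. *)

Section Differentiability.
Variables (R : realType) (V W : normedModType R).
Implicit Types (A : set V) (f g : V -> W).

(** Smoothness graded by order, so that closure properties can be proved by induction; [Cn 0] is
    already differentiability. Derivatives are added on the inside here, on the outside in
    [iterated_derive]; [iterated_derive_rcons] reconciles the two. *)
Fixpoint Cn (k : nat) A f : Prop :=
  (forall x, A x -> differentiable f x) /\
  (if k is k'.+1 then forall v, Cn k' A (fun x => 'D_v f x) else True).

Lemma CnS k A f : Cn k.+1 A f =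
  ((forall x, A x -> differentiable f x) /\ forall v, Cn k A (fun x => 'D_v f x)).
Proof. by []. Qed.

Lemma Cn_diff k A f x : Cn k A f -> A x -> differentiable f x.
Proof. by case: k => [|k] [h _]; apply: h. Qed.

Lemma Cn_continuous k A f x : Cn k A f -> A x -> {for x, continuous f}.
Proof. by move=> fC Ax; exact: (differentiable_continuous (Cn_diff fC Ax)). Qed.

Lemma iterated_derive_rcons (vs : seq V) v f :
  iterated_derive (rcons vs v) f = iterated_derive vs (fun x => 'D_v f x).
Proof. by elim: vs => //= u vs ->. Qed.

Lemma smooth_on_Cn A f : smooth_on A f <-> forall k, Cn k A f.
Proof.
split.
- move=> h k; elim: k f h => [|k IH] f h /=.
    by split=> // x Ax; exact: (h [::]).
  split=> [x Ax|v]; first exact: (h [::]).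
  by apply: IH => vs x Ax; rewrite -iterated_derive_rcons; exact: h.
- move=> h vs; elim/last_ind: vs f h => [|vs v IH] f h x Ax.
    exact: (Cn_diff (h 0%N)).
  rewrite iterated_derive_rcons; apply: IH => // k.
  by have := h k.+1; rewrite CnS => -[_]; exact.
Qed.

(** The little-o condition in epsilon form, so that a candidate differential can be verified by an
    estimate. *)
Lemma differentiable_epsP f x (df : {linear V -> W}) : continuous df ->
  (forall e : R, 0 < e ->
     \forall h \near 0, `|f (h + x) - f x - df h| <= e * `|h|) ->
  differentiable f x /\ 'd f x = df :> (V -> W).
Proof.
move=> dfc dfe.
have dxf : f \o shift x = cst (f x) + df +o_ 0 id.
  apply/eqaddoP => e e0; near=> h.
  by rewrite !fctE /= opprD addrA; near: h; exact: (dfe e e0).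
split; last exact: diff_unique.
apply/diff_locallyP; rewrite (_ : 'd f x = df :> (V -> W)) //.
exact: diff_unique.
Unshelve. all: by end_near. Qed.

Lemma differentiable_eps f x : differentiable f x ->
  forall e : R, 0 < e ->
     \forall h \near 0, `|f (h + x) - f x - 'd f x h| <= e * `|h|.
Proof.
move=> /diff_locally /eqaddoP dxf e e0; near=> h.
suff : `|(f \o shift x - (cst (f x) + 'd f x)) h| <= e * `|h|.
  by rewrite !fctE /= opprD addrA.
by near: h; exact: (dxf e e0).
Unshelve. all: by end_near. Qed.

Lemma near_eq_differentiable f g x :
  {near x, f =1 g} -> differentiable f x -> differentiable g x.
Proof.
move=> fg df; apply: (proj1 (differentiable_epsP (df := 'd f x) _ _)).
  exact: diff_continuous.
have fgs : \forall h \near 0, f (h + x) = g (h + x).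
  have : (h + x) @[h --> 0] --> x.
    rewrite -[X in _ --> X]add0r; apply: cvgD; [exact: cvg_id|exact: cvg_cst].
  by move=> /(_ _ fg).
move=> e e0; near=> h.
have <- : f x = g x := nbhs_singleton fg.
have <- : f (h + x) = g (h + x) by near: h.
by near: h; exact: differentiable_eps.
Unshelve. all: by end_near. Qed.

Lemma open_near A (P : V -> Prop) x : open A -> A x ->
  (forall y, A y -> P y) -> \forall y \near x, P y.
Proof. by move=> oA Ax AP; apply: filterS AP _; exact: open_nbhs_nbhs. Qed.

Lemma Cn_eq k A f g : open A -> (forall x, A x -> f x = g x) ->
  Cn k A f -> Cn k A g.
Proof.
move=> oA; elim: k f g => [|k IH] f g fg.
  move=> [df _]; split=> // x Ax; apply: near_eq_differentiable (df x Ax).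
  exact: (open_near oA Ax).
rewrite !CnS => -[df Df]; split=> [x Ax|v].
  apply: near_eq_differentiable (df x Ax).
  exact: (open_near oA Ax).
apply: IH (Df v) => x Ax; apply: near_eq_derive.
exact: (open_near oA Ax).
Qed.

Lemma Cn_sub k A B f : B `<=` A -> Cn k A f -> Cn k B f.
Proof.
move=> BA; elim: k f => [|k IH] f; first by move=> [df _]; split=> // x /BA /df.
by rewrite !CnS => -[df Df]; split=> [x /BA /df//|v]; exact: IH.
Qed.

Lemma Cn_pred k A f : Cn k.+1 A f -> Cn k A f.
Proof.
elim: k f => [|k IH] f; first by move=> [df _].
by rewrite CnS => -[df Df]; rewrite CnS; split=> // v; apply: IH.
Qed.

Lemma Cn_cst k A (a : W) : Cn k A (fun=> a).
Proof.
elim: k a => [|k IH] a; first by split=> // x _; exact: differentiable_cst.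
rewrite CnS; split=> [x _|v]; first exact: differentiable_cst.
by rewrite (_ : (fun x => 'D_v _ x) = fun=> 0) //; apply/funext => x; rewrite derive_cst.
Qed.

Lemma CnD k A f g : open A -> Cn k A f -> Cn k A g -> Cn k A (fun x => f x + g x).
Proof.
move=> oA; elim: k f g => [|k IH] f g.
  by move=> [df _] [dg _]; split=> // x Ax; apply: differentiableD; auto.
rewrite !CnS => -[df Df] [dg Dg]; split=> [x Ax|v].
  by apply: differentiableD; auto.
apply: Cn_eq (IH _ _ (Df v) (Dg v)) => // x Ax.
by rewrite [RHS]deriveD //; apply: diff_derivable; auto.
Qed.

Lemma CnZ k A f (a : R) : open A -> Cn k A f -> Cn k A (fun x => a *: f x).
Proof.
move=> oA; elim: k f => [|k IH] f.
  by move=> [df _]; split=> // x Ax; apply: differentiableZ; auto.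
rewrite !CnS => -[df Df]; split=> [x Ax|v].
  by apply: differentiableZ; auto.
apply: Cn_eq (IH _ (Df v)) => // x Ax.
by rewrite [RHS]deriveZ //; apply: diff_derivable; auto.
Qed.

End Differentiability.

Section DifferentiabilityScalar.
Variables (R : realType) (V : normedModType R).
Implicit Types (A : set V) (f g : V -> R).

Lemma Cn_sum k A I (r : seq I) (P : pred I) (F : I -> V -> R) : open A ->
  (forall i, P i -> Cn k A (F i)) -> Cn k A (fun x => \sum_(i <- r | P i) F i x).
Proof.
move=> oA FC; elim: r => [|i r IH].
  by apply: Cn_eq (Cn_cst _ _ 0) => // x _; rewrite big_nil.
case: (boolP (P i)) => Pi.
  by apply: Cn_eq (CnD oA (FC i Pi) IH) => // x _; rewrite big_cons Pi.
by apply: Cn_eq IH => // x _; rewrite big_cons (negbTE Pi).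
Qed.

Lemma CnM k A f g : open A -> Cn k A f -> Cn k A g -> Cn k A (fun x => f x * g x).
Proof.
move=> oA; elim: k f g => [|k IH] f g.
  by move=> [df _] [dg _]; split=> // x Ax; apply: differentiableM; auto.
rewrite !CnS => -[df Df] [dg Dg]; split=> [x Ax|v].
  by apply: differentiableM; auto.
have fk : Cn k A f by apply: Cn_pred; rewrite CnS.
have gk : Cn k A g by apply: Cn_pred; rewrite CnS.
apply: Cn_eq (CnD oA (IH _ _ fk (Dg v)) (IH _ _ gk (Df v))) => // x Ax.
by rewrite [RHS]deriveM //; apply: diff_derivable; auto.
Qed.

(** The derivative of 1 / f is - f^-2 times that of f, so only the previous order of 1 / f is
    needed. *)
Lemma CnV k A f : open A -> (forall x, A x -> f x != 0) ->
  Cn k A f -> Cn k A (fun x => (f x)^-1).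
Proof.
move=> oA f0; elim: k => [|k IH].
  by move=> [df _]; split=> // x Ax; apply: differentiableV; auto.
move=> fk1; have fk := Cn_pred fk1.
move: fk1; rewrite !CnS => -[df Df]; split=> [x Ax|v].
  by apply: differentiableV; auto.
apply: Cn_eq (CnZ (-1) oA (CnM oA (CnM oA (IH fk) (IH fk)) (Df v))) => // x Ax.
rewrite [RHS]deriveV; [|exact: f0|exact/diff_derivable/df].
by rewrite scaleN1r /GRing.scale /= expr2 invfM mulNr.
Qed.

Lemma Cn_coord k m A (g : V -> 'rV[R]_m) j : open A ->
  Cn k A g -> Cn k A (fun x => g x 0 j).
Proof.
move=> oA; elim: k g => [|k IH] g.
  move=> [dg _]; split=> // x Ax.
  by apply: (@differentiable_comp _ _ _ _ g (fun N => N 0 j)); [exact: dg|exact: differentiable_coord].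
rewrite !CnS => -[dg Dg]; split=> [x Ax|v].
  by apply: (@differentiable_comp _ _ _ _ g (fun N => N 0 j)); [exact: dg|exact: differentiable_coord].
apply: Cn_eq (IH _ (Dg v)) => // x Ax.
by rewrite derive_mx ?mxE //; apply: diff_derivable; exact: dg.
Qed.

(** The chain rule in coordinates makes a derivative of the composite a finite sum of products
    already controlled at order k. *)
Lemma Cn_comp k m A (B : set 'rV[R]_m) (g : V -> 'rV[R]_m) (f : 'rV[R]_m -> R) :
  open A -> open B -> (forall x, A x -> B (g x)) ->
  Cn k A g -> Cn k B f -> Cn k A (fun x => f (g x)).
Proof.
move=> oA oB AB; elim: k f => [|k IH] f.
  move=> [dg _] [df _]; split=> // x Ax.
  by apply: (@differentiable_comp _ _ _ _ g f); [exact: dg|exact/df/AB].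
move=> gk1; have gk := Cn_pred gk1; move: gk1.
rewrite !CnS => -[dg Dg] [df Df]; split=> [x Ax|v].
  by apply: (@differentiable_comp _ _ _ _ g f); [exact: dg|exact/df/AB].
have h : Cn k A (fun x => \sum_(j < m) 'D_v g x 0 j * 'D_(delta_mx 0 j) f (g x)).
  apply: Cn_sum => // j _; apply: CnM => //; last exact: (IH (fun y => 'D_(delta_mx 0 j) f y) gk (Df _)).
  exact: (Cn_coord j oA (Dg v)).
apply: Cn_eq h => // x Ax.
have dgx := dg x Ax; have dfx := df _ (AB x Ax).
rewrite (_ : (fun x => f (g x)) = f \o g) // [RHS]deriveE; last first.
  exact: differentiable_comp.
rewrite diff_comp //= -(deriveE v dgx) [in RHS](row_sum_delta ('D_v g x)).
rewrite linear_sum; apply: eq_bigr => j _.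
by rewrite linearZ /= -deriveE.
Qed.

End DifferentiabilityScalar.

(** * Flat functions built from exp(-1/t) *)

Section Flat.
Variable R : realType.

(** The polynomial parameter makes the family stable under differentiation: the derivative replaces
    p by X^2 (p - p'). *)
Definition flat (p : {poly R}) (t : R) : R :=
  if 0 < t then p.[t^-1] * expR (- t^-1) else 0.

(** The extra power of x is there for the induction on p: passing from p to p X + c raises n by
    one. *)
Lemma expR_dominates (p : {poly R}) n :
  exists2 C : R, 0 <= C & forall x, 0 <= x -> `|p.[x]| * x ^+ n * expR (- x) <= C.
Proof.
elim/poly_ind: p n => [|p c IH] n.
  by exists 0 => // x _; rewrite horner0 normr0 !mul0r.
have [C C0 pC] := IH n.+1.
exists (C + `|c| * n`!%:R) => [|x x0].
  by rewrite addr_ge0 // mulr_ge0.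
have hx : x ^+ n * expR (- x) <= n`!%:R.
  rewrite expRN ler_pdivrMr ?expR_gt0 //.
  case: n {pC} => [|n]; first by rewrite expr0 fact0 mul1r (le_trans _ (expR_ge1Dx x)) // lerDl.
  have := expR_ge1Dxn n x0; have f0 : 0 < (n.+1)`!%:R :> R by rewrite ltr0n fact_gt0.
  rewrite -ler_pdivrMl // mulrC => h; apply: le_trans h.
  by rewrite lerDr.
rewrite hornerMXaddC -mulrA.
apply: (@le_trans _ _ ((`|p.[x]| * x + `|c|) * (x ^+ n * expR (- x)))).
  rewrite ler_wpM2r ?mulr_ge0 ?exprn_ge0 ?expR_ge0 //.
  by rewrite (le_trans (ler_normD _ _)) // normrM (ger0_norm x0).
rewrite mulrDl lerD //; last by rewrite ler_wpM2l.
by have := pC x x0; rewrite exprS !mulrA.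
Qed.

Lemma flat_is_derive p t :
  is_derive t (1 : R) (flat p) (flat ('X^2 * (p - p^`())) t).
Proof.
have [t0|t0|t0] := ltgtP t 0.
- rewrite [X in is_derive _ _ _ X]/flat ltNge (ltW t0) /=.
  apply: (@near_eq_is_derive _ _ _ (cst 0)).
  have : \forall s \near t, s < 0 by exact: lt_nbhsl.
  by apply: filterS => s s0; rewrite /flat ltNge (ltW s0).
- rewrite [X in is_derive _ _ _ X]/flat t0.
  have tn0 : t != 0 by rewrite gt_eqF.
  have di : is_derive t (1 : R) (fun s : R => s^-1) (- t ^- 2).
    apply: DeriveDef; first exact: derivableV.
    by rewrite deriveV // derive_id /GRing.scale /= mulr1.
  have dp : is_derive t (1 : R) ((horner p) \o (fun s : R => s^-1))
      (p^`().[t^-1] * (- t ^- 2)).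
    exact: is_derive1_comp (is_derive_poly p t^-1) di.
  have de : is_derive t (1 : R) (expR \o (fun s : R => - s^-1))
      (expR (- t^-1) * - - t ^- 2).
    exact: is_derive1_comp (is_derive_expR _) (is_deriveN di).
  have := is_deriveM dp de => dpe.
  have -> : ('X^2 * (p - p^`())).[t^-1] * expR (- t^-1) =
    p.[t^-1] *: (expR (- t^-1) * - - t ^- 2) +
    expR (- t^-1) *: (p^`().[t^-1] * - t ^- 2).
    rewrite /GRing.scale /= hornerM hornerXn hornerD hornerN exprVn opprK.
    by move: (p.[_]) (p^`().[_]) (expR _) (t ^- 2) => *; ring.
  apply: near_eq_is_derive dpe.
  have : \forall s \near t, 0 < s by exact: lt_nbhsr.
  by apply: filterS => s s0; rewrite /flat s0.
- rewrite t0 [X in is_derive _ _ _ X]/flat ltxx.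
  (* At 0, the power 2 bounds [flat p h] by C h^2, so the difference quotient is at most C h. *)
  have [C C0 pC] := expR_dominates p 2.
  suff h : h^-1 *: (flat p (h *: (1 : R) + 0) - flat p 0) @[h --> 0^'] --> (0 : R).
    by apply: DeriveDef; [apply/cvg_ex; exists 0|apply: cvg_lim].
  apply/cvgr0Pnorm_le => e e0; near=> h.
  rewrite /flat ltxx subr0 addr0 [h *: _]mulr1.
  case: ifPn => h0; last by rewrite scaler0 normr0 ltW.
  have hC : `|p.[h^-1]| * expR (- h^-1) <= C * h ^+ 2.
    have := pC h^-1; rewrite invr_ge0 ltW // => /(_ isT).
    rewrite mulrAC exprVn -ler_pdivlMr ?invr_gt0 ?exprn_gt0 //.
    by rewrite invrK.
  rewrite normrZ normrM (ger0_norm (expR_ge0 _)) normfV (gtr0_norm h0).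
  rewrite mulrC ler_pdivrMr //; apply: le_trans hC _.
  rewrite expr2 mulrA ler_wpM2r ?(ltW h0) //.
  have : `|h| <= e / (C + 1) by near: h; apply: dnbhs0_le; rewrite divr_gt0 // ltr_wpDl.
  rewrite (gtr0_norm h0) ler_pdivlMr ?ltr_wpDl // => hh.
  apply: le_trans hh; rewrite mulrC ler_wpM2l ?(ltW h0) // lerDl //.
Unshelve. all: by end_near. Qed.

Lemma Cn_flat k p (A : set R) : Cn k A (flat p).
Proof.
have dif q x : differentiable (flat q) x.
  by apply/derivable1_diffP; have [] := flat_is_derive q x.
elim: k p => [|k IH] p; first by split=> // x _; exact: dif.
rewrite CnS; split=> [x _|v]; first exact: dif.
have -> : (fun x => 'D_v (flat p) x) = flat (v *: ('X^2 * (p - p^`()))).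
  apply/funext => x; rewrite deriveE // -[v in LHS]mulr1 [v * 1]/(v *: 1) linearZ /=.
  rewrite -deriveE // (@derive_val _ _ _ _ _ _ _ (flat_is_derive p x)) /flat.
  by case: ifP => _; rewrite ?scaler0 // hornerZ -mulrA.
exact: IH.
Qed.

End Flat.

(** * Integrals over the unit interval *)

Section UnitIntegral.
Variable R : realType.
Implicit Types u v : R -> R.

Definition cont01 u := forall t, t \in `[(0:R), 1] -> {for t, continuous u}.

Definition int01 u : R := \int[lebesgue_measure]_(t in `[(0:R), 1]) u t.

Lemma cont01_within u : cont01 u -> {within `[(0:R), 1], continuous u}.
Proof.
by move=> cu; apply: continuous_in_subspaceT => t; rewrite inE /= => ht; apply: cu.
Qed.

Lemma integrable01 u : cont01 u ->
  (@lebesgue_measure R).-integrable `[(0:R), 1] (EFin \o u).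
Proof.
move=> cu; apply: continuous_compact_integrable; first exact: segment_compact.
exact: cont01_within.
Qed.

Lemma int01D u v : cont01 u -> cont01 v ->
  int01 (fun t => u t + v t) = int01 u + int01 v.
Proof. by move=> cu cv; apply: RintegralD => //; exact: integrable01. Qed.

Lemma int01Z (a : R) u : cont01 u -> int01 (fun t => a * u t) = a * int01 u.
Proof. by move=> cu; apply: RintegralZl => //; exact: integrable01. Qed.

Lemma cont01D u v : cont01 u -> cont01 v -> cont01 (fun t => u t + v t).
Proof. by move=> cu cv t ht; apply: cvgD; [exact: cu|exact: cv]. Qed.

Lemma cont01M u v : cont01 u -> cont01 v -> cont01 (fun t => u t * v t).
Proof. by move=> cu cv t ht; apply: cvgM; [exact: cu|exact: cv]. Qed.

Lemma cont01_cst (a : R) : cont01 (fun=> a).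
Proof. by move=> t _; exact: cvg_cst. Qed.

Lemma cont01X k : cont01 (fun t => t ^+ k).
Proof. by move=> t _; exact: exprn_continuous. Qed.

Lemma int01_sum m (u : 'I_m -> R -> R) : (forall j, cont01 (u j)) ->
  cont01 (fun t => \sum_j u j t) /\
  int01 (fun t => \sum_j u j t) = \sum_j int01 (u j).
Proof.
elim: m u => [|m IH] u cu.
  split.
    rewrite (_ : (fun t => _) = fun=> 0); first exact: cont01_cst.
    by apply/funext => t; rewrite big_ord0.
  rewrite big_ord0 (_ : (fun t => _) = fun=> 0 * 0).
    by rewrite int01Z ?mul0r //; exact: cont01_cst.
  by apply/funext => t; rewrite big_ord0 mul0r.
have -> : (fun t => \sum_j u j t) =
    fun t => u ord0 t + \sum_j u (lift ord0 j) t.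
  by apply/funext => t; rewrite big_ord_recl.
have [c e] := IH (fun j => u (lift ord0 j)) (fun j => cu _).
by split; [exact: cont01D|rewrite big_ord_recl int01D // e].
Qed.

Lemma lebesgue_measure01 : fine (@lebesgue_measure R `[(0:R), 1]%classic) = 1.
Proof. by rewrite lebesgue_measure_itv /= lte_fin ltr01 -EFinB /= subr0. Qed.

Lemma int01_le u (C : R) : cont01 u -> (forall t, t \in `[(0:R), 1] -> `|u t| <= C) ->
  `|int01 u| <= C.
Proof.
move=> cu uC.
apply: le_trans (le_normr_Rintegral _ (integrable01 cu)) _ => //.
have cn : cont01 (fun t => `|u t|) by move=> t ht; apply: cvg_norm; exact: cu.
have cc : cont01 (fun=> C) by exact: cont01_cst.
apply: le_trans (le_Rintegral _ (integrable01 cn) (integrable01 cc) _) _ => //.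
by rewrite Rintegral_cst // lebesgue_measure01 mulr1.
Qed.

Lemma int01_derive u v : cont01 v ->
  (forall t, t \in `[(0:R), 1] -> is_derive t (1 : R) u (v t)) ->
  int01 v = u 1 - u 0.
Proof.
move=> cv du.
have cu t : t \in `[(0:R), 1] -> {for t, continuous u}.
  move=> /du [dut _]; apply: differentiable_continuous; exact/derivable1_diffP.
rewrite /int01 /Rintegral (@continuous_FTC2 _ v u) ?ltr01 //=; first exact: cont01_within.
- split.
  + move=> t t01; have h : t \in `[(0:R), 1] by exact: subset_itv_oo_cc t01.
    by have [] := du t h.
  + by apply: cvg_at_right_filter; apply: cu; rewrite in_itv /= lexx ler01.
  + by apply: cvg_at_left_filter; apply: cu; rewrite in_itv /= lexx ler01.
- move=> t t01; have h : t \in `[(0:R), 1] by exact: subset_itv_oo_cc t01.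
  by rewrite derive1E; have [] := du t h.
Qed.

End UnitIntegral.

(** * Segments issuing from the centre of a ball *)

Section Ray.
Variables (R : realType) (V : normedModType R) (p : V) (r : R).
Local Notation B := (ball p r).
Implicit Types (h u : V -> R) (y w : V).

Definition ray y (t : R) : V := p + t *: (y - p).

Lemma ray_ball y t : B y -> t \in `[(0:R), 1] -> B (ray y t).
Proof.
rewrite -ball_normE /= in_itv /= => yB /andP[t0 t1].
rewrite /ray opprD addNKr normrN normrZ ger0_norm // -normrN opprB.
by apply: le_lt_trans yB; rewrite ler_piMl.
Qed.

Lemma ray_continuous y : continuous (ray y).
Proof.
move=> t; apply: cvgD; first exact: cvg_cst.
by apply: cvgZr_tmp; exact: cvg_id.
Qed.

Lemma derive_line h z w (s : R) : differentiable h (z + s *: w) ->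
  is_derive s (1 : R) (fun s : R => h (z + s *: w)) ('D_w h (z + s *: w)).
Proof.
move=> dh; have dv := @diff_derivable _ _ _ h _ w dh.
have E : (fun e : R => e^-1 *: (h (z + (e *: (1:R) + s) *: w) - h (z + s *: w))) =
         (fun e : R => e^-1 *: (h (e *: w + (z + s *: w)) - h (z + s *: w))).
  apply/funext => e; congr (_ *: (h _ - _)).
  by rewrite [e *: 1]mulr1 scalerDl addrCA.
by apply: DeriveDef; rewrite /derivable /derive /= E.
Qed.

(** Compactness of [0, 1] makes the neighbourhood uniform in t, as differentiation under the
    integral requires. *)
Lemma near_ray_unif u y (e : R) : (forall z, B z -> {for z, continuous u}) ->
  B y -> 0 < e -> \forall w \near (0 : V),
  forall t, t \in `[(0:R), 1] -> `|u (ray y t + w) - u (ray y t)| <= e.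
Proof.
move=> cu yB e0.
have /compact_near_coveringP H := @segment_compact R 0 1.
have := H _ (nbhs (0 : V)) (fun w t => `|u (ray y t + w) - u (ray y t)| <= e) _.
apply => t t01.
have e2 : 0 < e / 2 by rewrite divr_gt0.
have c1 : {for ray y t, continuous u} by apply: cu; exact: ray_ball.
have n1 : \forall z \near ray y t, `|u (ray y t) - u z| < e / 2.
  by move/cvgrPdist_lt : c1; apply.
have l1 : (fun tw : R * V => ray y tw.1 + tw.2) @ (nbhs t, nbhs (0 : V))
    --> ray y t.
  rewrite -[X in _ --> X]addr0; apply: cvgD; last exact: cvg_snd.
  by apply: cvg_comp (@cvg_fst _ _ _ _ _) _; exact: ray_continuous.
have l2 : (fun tw : R * V => ray y tw.1) @ (nbhs t, nbhs (0 : V))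
    --> ray y t.
  by apply: cvg_comp (@cvg_fst _ _ _ _ _) _; exact: ray_continuous.
have := l1 _ n1; have := l2 _ n1; rewrite /nbhs /=.
apply: filterS2 => -[t' w] /= a b.
rewrite -(subrKA (u (ray y t))) (splitr e) (le_trans (ler_normD _ _)) // lerD //.
  by rewrite distrC ltW.
by rewrite ltW.
Qed.

Lemma near_addl_ball y : B y -> \forall w \near (0 : V), B (y + w).
Proof.
move=> yB; have : (y + w) @[w --> (0 : V)] --> y.
  rewrite -[X in _ --> X]addr0; apply: cvgD; [exact: cvg_cst|exact: cvg_id].
have nB : \forall z \near y, B z by apply: open_nbhs_nbhs; split => //; exact: ball_open.
by move=> /(_ _ nB).
Qed.

Lemma near0_normP (P : V -> Prop) : (\forall w \near (0 : V), P w) <->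
  exists2 d : R, 0 < d & forall w, `|w| < d -> P w.
Proof.
split=> [/nbhs_ballP[d /= d0 dP]|[d d0 dP]].
  by exists d => // w wd; apply: dP; rewrite -ball_normE /= sub0r normrN.
by apply/nbhs_ballP; exists d => //= w; rewrite -ball_normE /= sub0r normrN => /dP.
Qed.

End Ray.

(** * Hadamard's lemma *)

Section Hadamard.
Variables (R : realType) (m : nat) (p : 'rV[R]_m) (r : R).
Local Notation B := (ball p r).
Implicit Types (h u : 'rV[R]_m -> R) (y w : 'rV[R]_m).

Lemma coord_le_norm w j : `|w 0 j| <= `|w|.
Proof.
rewrite [leRHS]/Num.Def.normr/= mx_normrE.
exact: (le_bigmax _ (fun ij : 'I_1 * 'I_m => `|w ij.1 ij.2|) (ord0, j)).
Qed.

Lemma derive_rV h z w : differentiable h z ->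
  'D_w h z = \sum_j w 0 j * 'D_(delta_mx 0 j) h z.
Proof.
move=> dh; rewrite deriveE // [w in LHS](row_sum_delta w) linear_sum.
by apply: eq_bigr => j _; rewrite linearZ /= -deriveE.
Qed.

(** First order expansion of h with a remainder uniform along the ray. The factor t appears because
    moving y by w moves the point of parameter t by t w. *)
Lemma near_ray_remainder h y (e : R) : Cn 1 B h -> B y -> 0 < e ->
  \forall w \near (0 : 'rV[R]_m), forall t, t \in `[(0:R), 1] ->
  `|h (ray p (y + w) t) - h (ray p y t)
    - t * \sum_j w 0 j * 'D_(delta_mx 0 j) h (ray p y t)| <= e * `|w|.
Proof.
move=> [dh Dh] yB e0.
(* Each of the m coordinates contributes at most e / (m + 1) times the norm of w; the shift by one
   covers m = 0. *)
have e'0 : 0 < e / m.+1%:R by rewrite divr_gt0 // ltr0n.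
have n1 : \forall w \near (0 : 'rV[R]_m), forall j t, t \in `[(0:R), 1] ->
    `|'D_(delta_mx 0 j) h (ray p y t + w) - 'D_(delta_mx 0 j) h (ray p y t)| <= e / m.+1%:R.
  apply: (@filter_forall _ _ _ (nbhs (0 : 'rV[R]_m)) _) => j.
  apply: (@near_ray_unif _ _ p r (fun z => 'D_(delta_mx 0 j) h z)) => // z zB.
  exact: (Cn_continuous (k := 0) (Dh _) zB).
have n2 : \forall w \near (0 : 'rV[R]_m), B (y + w).
  exact: (@near_addl_ball R 'rV[R]_m p r y yB).
have [d d0 dB] := (near0_normP _).1 (filterI n1 n2).
apply/near0_normP; exists d => // w wd t t01.
have t01' : 0 <= t <= 1 by rewrite in_itv in t01.
have small s : s \in `[(0:R), 1] -> `|s *: w| < d.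
  rewrite in_itv normrZ => /andP[s0 s1].
  by rewrite ger0_norm //; apply: le_lt_trans wd; rewrite ler_piMl.
have rayE s : ray p (y + s *: w) t = ray p y t + s *: (t *: w).
  by rewrite /ray -(addrA p) (addrAC y) scalerDr !scalerA (mulrC s).
have dline s : s \in `[(0:R), 1] -> differentiable h (ray p y t + s *: (t *: w)).
  move=> s01; rewrite -rayE; apply: dh; apply: ray_ball => //.
  by have [] := dB _ (small s s01).
(* The mean value theorem in s turns the remainder into differences of partial derivatives, which
   [n1] bounds. *)
have [s s01] := @MVT_segment R (fun s : R => h (ray p y t + s *: (t *: w)))
  (fun s => 'D_(t *: w) h (ray p y t + s *: (t *: w))) 0 1 ler01
  (fun s hs => derive_line (dline s (subset_itv_oo_cc hs)))
  (cont01_within (fun s hs => differentiable_continuous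
    ((derivable1_diffP _ _).1 (@ex_derive _ _ _ _ _ _ _ (derive_line (dline s hs)))))).
rewrite scale1r scale0r addr0 subr0 mulr1.
rewrite -[in ray p (y + w) t](scale1r w) rayE scale1r => ->.
rewrite derive_rV; last exact: dline.
rewrite mulr_sumr -sumrB.
apply: le_trans (ler_norm_sum _ _ _) _.
apply: (@le_trans _ _ (\sum_(j < m) (e / m.+1%:R * `|w|))).
  apply: ler_sum => j _; rewrite mxE.
  set d1 := 'D_ _ _ _; set d2 := 'D_ _ _ _.
  have -> : t * w 0 j * d1 - t * (w 0 j * d2) = t * (w 0 j * (d1 - d2)) by ring.
  rewrite !normrM.
  have /andP[t0 t1] := t01'; rewrite (ger0_norm t0).
  have sm : `|s *: (t *: w)| < d.
    rewrite scalerA; apply: small; move: s01; rewrite !in_itv /= => /andP[s0 s1].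
    by rewrite mulr_ge0 //= mulr_ile1.
  have [h1 _] := dB _ sm; have h2 := h1 j t t01; have h3 := coord_le_norm w j.
  rewrite mulrA mulrC; apply: ler_pM => //; first by rewrite mulr_ge0.
  by apply: le_trans h3; rewrite ler_piMl.
rewrite sumr_const card_ord -[X in X <= _]mulr_natr.
rewrite (_ : _ * m%:R = (e * `|w|) * (m%:R / m.+1%:R)); last by ring.
rewrite ler_piMr ?mulr_ge0 // ?(ltW e0) //.
by rewrite ler_pdivrMr ?ltr0n // mul1r ler_nat.
Qed.

(** The weight t^k makes the class stable: differentiating under the integral in y replaces h by its
    derivative and raises k by one. *)
Let rayint k h y := int01 (fun t => t ^+ k * h (ray p y t)).

Lemma cont_rayint k h y : (forall z, B z -> {for z, continuous h}) -> B y ->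
  cont01 (fun t => t ^+ k * h (ray p y t)).
Proof.
move=> ch yB; apply: cont01M; first exact: cont01X.
move=> t t01; apply: (@cvg_comp _ _ _ (ray p y) h); first exact: ray_continuous.
by apply: ch; exact: ray_ball.
Qed.

Lemma rayint_diff k h y : Cn 1 B h -> B y ->
  differentiable (rayint k h) y /\
  forall w, 'D_w (rayint k h) y = rayint k.+1 (fun z => 'D_w h z) y.
Proof.
move=> hC yB.
have ch z : B z -> {for z, continuous h}.
  by move=> zB; exact: (Cn_continuous hC zB).
pose D j := rayint k.+1 (fun z => 'D_(delta_mx 0 j) h z) y.
have cD j z : B z -> {for z, continuous (fun z => 'D_(delta_mx 0 j) h z)}.
  by move=> zB; case: hC => _ Dh; exact: (Cn_continuous (k := 0) (Dh _) zB).
pose l w := \sum_j w 0 j * D j.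
have lin : linear l.
  move=> a u v; rewrite /l scaler_sumr -big_split /=; apply: eq_bigr => j _.
  by rewrite !mxE mulrDl /GRing.scale /= mulrA.
pose lM := GRing.isLinear.Build _ _ _ _ _ lin.
pose L : {linear 'rV[R]_m -> R} := HB.pack l lM.
have lint w : l w = int01 (fun t => t ^+ k.+1 * \sum_j w 0 j * 'D_(delta_mx 0 j) h (ray p y t)).
  rewrite /l /D /rayint.
  have -> : (fun t => t ^+ k.+1 * \sum_j w 0 j * 'D_(delta_mx 0 j) h (ray p y t)) =
      fun t => \sum_j w 0 j * (t ^+ k.+1 * 'D_(delta_mx 0 j) h (ray p y t)).
    by apply/funext => t; rewrite mulr_sumr; apply: eq_bigr => j _; rewrite mulrCA.
  have cc j := cont_rayint (k := k.+1) (cD j) yB.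
  rewrite (int01_sum (fun j => cont01M (@cont01_cst R (w 0 j)) (cc j))).2.
  by apply: eq_bigr => j _; rewrite int01Z.
have Lc : continuous L.
  move=> w; apply: differentiable_continuous.
  have : Cn 0 setT l.
    apply: Cn_sum => [|j _]; first exact: openT.
    apply: CnM; [exact: openT| |exact: Cn_cst].
    by split=> // z _; exact: differentiable_coord.
  by move=> [/(_ w I)].
have key e : 0 < e -> \forall w \near (0 : 'rV[R]_m),
    `|rayint k h (w + y) - rayint k h y - L w| <= e * `|w|.
  move=> e0.
  have n1 := near_ray_remainder hC yB e0.
  have n2 : \forall w \near (0 : 'rV[R]_m), B (y + w).
    exact: (@near_addl_ball R 'rV[R]_m p r y yB).
  apply: filterS2 n1 n2 => w rw ywB.
  rewrite -[L w]/(l w) lint addrC [w + y]addrC /rayint.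
  pose F t := h (ray p (y + w) t) - h (ray p y t)
    - t * \sum_j w 0 j * 'D_(delta_mx 0 j) h (ray p y t).
  have c0 := cont_rayint (k := k) ch ywB; have c1 := cont_rayint (k := k) ch yB.
  have c2 : cont01 (fun t => t ^+ k.+1 * \sum_j w 0 j * 'D_(delta_mx 0 j) h (ray p y t)).
    apply: cont01M; first exact: cont01X.
    have cc j : cont01 (fun t => w 0 j * 'D_(delta_mx 0 j) h (ray p y t)).
      apply: cont01M; first exact: cont01_cst.
      by have := cont_rayint (k := 0) (cD j) yB; under eq_fun do rewrite expr0 mul1r.
    by have [] := int01_sum cc.
  have -> : - int01 (fun t => t ^+ k.+1 * \sum_j w 0 j * 'D_(delta_mx 0 j) h (ray p y t))
      + (int01 (fun t => t ^+ k * h (ray p (y + w) t)) - int01 (fun t => t ^+ k * h (ray p y t)))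
      = int01 (fun t => t ^+ k * F t).
    rewrite addrC -[- int01 _ in X in X + _ = _]mulN1r -[in RHS]/(int01 _).
    have -> : (fun t => t ^+ k * F t) = fun t => (t ^+ k * h (ray p (y + w) t)
       + (-1) * (t ^+ k * h (ray p y t)))
       + (-1) * (t ^+ k.+1 * \sum_j w 0 j * 'D_(delta_mx 0 j) h (ray p y t)).
      by apply/funext => t; rewrite /F !mulrBr exprSr !mulN1r !mulrA.
    have c1' := cont01M (@cont01_cst R (-1)) c1; have c2' := cont01M (@cont01_cst R (-1)) c2.
    rewrite int01D //; last exact: cont01D.
    by rewrite int01D // !int01Z // !mulN1r.
  apply: int01_le.
    have -> : (fun t => t ^+ k * F t) = fun t => (t ^+ k * h (ray p (y + w) t)
       + (-1) * (t ^+ k * h (ray p y t)))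
       + (-1) * (t ^+ k.+1 * \sum_j w 0 j * 'D_(delta_mx 0 j) h (ray p y t)).
      by apply/funext => t; rewrite /F !mulrBr exprSr !mulN1r !mulrA.
    by do 2?[apply: cont01D => //]; apply: cont01M => //; exact: cont01_cst.
  move=> t t01; rewrite normrM; apply: le_trans (rw t t01).
  have /andP[t0 t1] : 0 <= t <= 1 by rewrite in_itv in t01.
  by rewrite ler_piMl // ger0_norm ?exprn_ge0 // exprn_ile1.
have [dI dE] := differentiable_epsP Lc key; split=> // w.
rewrite deriveE // dE -[LHS]/(l w) lint; apply: eq_Rintegral => t.
rewrite inE => t01; rewrite derive_rV //.
by apply: (Cn_diff hC); exact: ray_ball.
Qed.

Lemma Cn_rayint j k h : (forall i, Cn i B h) -> Cn j B (rayint k h).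
Proof.
elim: j k h => [|j IH] k h hC.
  by split=> // y yB; have [] := rayint_diff k (hC 1%N) yB.
rewrite CnS; split=> [y yB|w]; first by have [] := rayint_diff k (hC 1%N) yB.
apply: (@Cn_eq _ _ _ _ _ (rayint k.+1 (fun z => 'D_w h z))); first exact: ball_open.
  by move=> y yB; have [_ ->] := rayint_diff k (hC 1%N) yB.
by apply: IH => i; have := hC i.+1; rewrite CnS => -[].
Qed.

(** The fundamental theorem of calculus along the ray from p to y; the quotients are integrals of
    partial derivatives, smooth by [Cn_rayint]. *)
Lemma hadamard h : (forall i, Cn i B h) ->
  exists q : 'I_m -> 'rV[R]_m -> R, (forall j i, Cn i B (q j)) /\
    forall y, B y -> h y = h p + \sum_j (y 0 j - p 0 j) * q j y.
Proof.
move=> hC; exists (fun j => rayint 0 (fun z => 'D_(delta_mx 0 j) h z)); split.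
  by move=> j i; apply: Cn_rayint => k; have := hC k.+1; rewrite CnS => -[].
move=> y yB.
have cD j z : B z -> {for z, continuous (fun z => 'D_(delta_mx 0 j) h z)}.
  by move=> zB; have := hC 1%N; rewrite CnS => -[_ Dh]; exact: (Cn_continuous (k := 0) (Dh _) zB).
have cc j := cont_rayint (k := 0) (cD j) yB.
have ccw j := cont01M (@cont01_cst R (y 0 j - p 0 j)) (cc j).
have [cs es] := int01_sum ccw.
have dv t : t \in `[(0:R), 1] -> is_derive t (1 : R) (fun t => h (ray p y t))
    (\sum_j (y 0 j - p 0 j) * (t ^+ 0 * 'D_(delta_mx 0 j) h (ray p y t))).
  move=> t01; have dh : differentiable h (p + t *: (y - p)).
    by apply: (Cn_diff (hC 0%N)); exact: ray_ball.
  have := derive_line dh; rewrite derive_rV //.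
  congr is_derive; apply: eq_bigr => j _; by rewrite !mxE expr0 mul1r.
have := int01_derive cs dv; rewrite es /ray scale1r scale0r addr0 [p + (_ - _)]addrC subrK => e.
apply/eqP; rewrite addrC -subr_eq -e; apply/eqP/eq_bigr => j _.
by rewrite int01Z.
Qed.

End Hadamard.

(** * Bump functions on the model space *)

Section BumpRV.
Variables (R : realType) (m : nat).

Lemma Cn_local (V W : normedModType R) k (A : set V) (f : V -> W) :
  (forall x, A x -> exists U, [/\ open U, U x & Cn k U f]) -> Cn k A f.
Proof.
elim: k f => [|k IH] f loc.
  by split=> // x /loc[U [oU Ux [df _]]]; exact: df.
rewrite CnS; split=> [x /loc[U [oU Ux [df _]]]|v]; first exact: df.
apply: IH => x /loc[U [oU Ux]]; rewrite CnS => -[_ Df]; exists U; split=> //.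
Qed.

Lemma Cn_flat_comp (V : normedModType R) k p (A : set V) (g : V -> R) :
  open A -> Cn k A g -> Cn k A (fun x => flat p (g x)).
Proof.
move=> oA; elim: k p => [|k IH] p.
  move=> [dg _]; split=> // x Ax; apply: (@differentiable_comp _ _ _ _ g (flat p)).
    exact: dg.
  exact: (Cn_diff (Cn_flat 0 p setT)).
move=> gk1; have gk := Cn_pred gk1; move: gk1; rewrite !CnS => -[dg Dg].
have df x : differentiable (flat p) (g x) by exact: (Cn_diff (Cn_flat 0 p setT)).
split=> [x Ax|v]; first by apply: (@differentiable_comp _ _ _ _ g (flat p)); [exact: dg|].
apply: Cn_eq (CnM oA (IH ('X^2 * (p - p^`())) gk) (Dg v)) => // x Ax; have dgx := dg x Ax.
rewrite (_ : (fun x => flat p (g x)) = flat p \o g) // [RHS]deriveE; last first.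
  exact: differentiable_comp.
rewrite diff_comp //= -(deriveE v dgx).
rewrite -[X in 'd _ _ X]mulr1 [X in 'd _ _ X]/(_ *: _) linearZ /= -deriveE //.
by rewrite (@derive_val _ _ _ _ _ _ _ (flat_is_derive p (g x))) /GRing.scale /= mulrC.
Qed.

(** The norm of ['rV] is the maximum norm; a smooth cutoff needs the Euclidean square, which
    dominates its square. *)
Definition sqdist (p y : 'rV[R]_m) : R := \sum_j (y 0 j - p 0 j) ^+ 2.

Lemma Cn_id k (A : set 'rV[R]_m) : Cn k A id.
Proof.
case: k => [|k]; first by split=> // x _; apply: ex_diff.
rewrite CnS; split=> [x _|v]; first exact: ex_diff.
rewrite (_ : (fun x => _) = fun=> v); first exact: Cn_cst.
by apply/funext => x; rewrite derive_id.
Qed.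

Lemma Cn_sqdist k p (A : set 'rV[R]_m) : open A -> Cn k A (sqdist p).
Proof.
move=> oA; apply: Cn_sum => // j _.
have c : Cn k A (fun y : 'rV[R]_m => y 0 j - p 0 j).
  by apply: CnD => //; [exact: (Cn_coord j oA (Cn_id k A))|exact: Cn_cst].
by apply: Cn_eq (CnM oA c c) => // y _; rewrite expr2.
Qed.

Lemma sqdist_ge (p y : 'rV[R]_m) (r : R) : 0 < r -> r <= `|y - p| -> r ^+ 2 <= sqdist p y.
Proof.
move=> r0; apply: contraTT; rewrite -!ltNge => h.
rewrite [ltLHS]/Num.Def.normr/= mx_normrE; apply: bigmax_lt => //= -[i j] _ /=.
rewrite !mxE (ord1 i); rewrite ltNge; apply/negP => hr.
move: h; apply/negP; rewrite -leNgt /sqdist (bigD1 j) //=.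
rewrite -[X in X <= _]addr0 lerD //; last by apply: sumr_ge0 => l _; rewrite sqr_ge0.
by rewrite -(real_normK (num_real (_ - _))) lerXn2r ?nnegrE // ltW.
Qed.

Lemma bump_rV (p : 'rV[R]_m) (r : R) : 0 < r -> exists b : 'rV[R]_m -> R,
  [/\ forall k, Cn k setT b, forall y, 0 <= b y <= 1,
      \forall y \near p, b y = 1 & forall y, r <= `|y - p| -> b y = 0].
Proof.
move=> r0.
have r20 : 0 < r ^+ 2 by rewrite exprn_gt0.
have f0 t : 0 <= flat (1 : {poly R}) t.
  by rewrite /flat; case: ifP => // _; rewrite hornerC mul1r expR_ge0.
have f1 t : 0 < t -> 0 < flat (1 : {poly R}) t.
  by move=> t0; rewrite /flat t0 hornerC mul1r expR_gt0.
have f2 t : t <= 0 -> flat (1 : {poly R}) t = 0.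
  by move=> t0; rewrite /flat ltNge t0.
(* [a] is positive inside the Euclidean radius r and [c] outside r / 2, so the denominator below
   never vanishes. *)
pose a y := r ^+ 2 - sqdist p y; pose c y := sqdist p y - r ^+ 2 / 4.
have ac y : 0 < flat 1 (a y) + flat 1 (c y).
  have [h|h] := ltP 0 (a y); first by rewrite ltr_pwDl // f1.
  rewrite ltr_wpDl // f1 //; rewrite /a in h; rewrite /c.
  by move: h r20; set s := sqdist _ _; set q := r ^+ 2; lra.
exists (fun y => flat 1 (a y) * (flat 1 (a y) + flat 1 (c y))^-1); split.
- move=> k; have oT : open [set: 'rV[R]_m] by exact: openT.
  have s := Cn_sqdist k p oT.
  have ca : Cn k setT (fun y => flat 1 (a y)).
    apply: Cn_flat_comp => //; apply: CnD => //; first exact: Cn_cst.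
    by apply: Cn_eq (CnZ (-1) oT s) => // y _; rewrite scaleN1r.
  have cc : Cn k setT (fun y => flat 1 (c y)).
    by apply: Cn_flat_comp => //; apply: CnD => //; exact: Cn_cst.
  apply: CnM => //; apply: CnV => //; last exact: CnD.
  by move=> y _; rewrite gt_eqF.
- move=> y; rewrite mulr_ge0 ?invr_ge0 ?f0 ?(ltW (ac y)) //=.
  by rewrite ler_pdivrMr // mul1r lerDl.
- have h : {for p, continuous (sqdist p)}.
    exact: (Cn_continuous (Cn_sqdist 0 p openT)).
  have h0 : sqdist p p = 0.
    by rewrite /sqdist big1 // => j _; rewrite subrr expr0n.
  have r40 : 0 < r ^+ 2 / 4 by rewrite divr_gt0.
  move/cvgrPdist_lt : h => /(_ _ r40); rewrite h0; apply: filterS => y.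
  rewrite sub0r normrN => /(le_lt_trans (ler_norm _)) hy.
  rewrite (f2 (c y)); last by rewrite /c subr_le0 ltW.
  rewrite addr0 divff // gt_eqF // f1 // /a subr_gt0 (lt_trans hy) //.
  by rewrite ltr_pdivrMr // ltr_pMr // ltr1n.
- move=> y hy; rewrite f2 ?mul0r //; rewrite /a subr_le0.
  exact: sqdist_ge.
Qed.

End BumpRV.

Lemma near_ball_sub (R : realType) (V : normedModType R) (p : V) (P : V -> Prop) :
  (\forall z \near p, P z) -> exists2 r : R, 0 < r & forall z, ball p r z -> P z.
Proof. by move=> /nbhs_ballP[r /= r0 rP]; exists r. Qed.

(** * Smooth functions on a manifold *)

Section SmoothFunctions.
Variables (R : realType) (m : nat) (M : oriented_manifold R m).
Implicit Types (f h w : M -> R) (c : chart R M m) (x y : M).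

Lemma smoothP f : smooth f <->
  forall c, mfd_atlas c -> forall k, Cn k (chart_img c) (f \o chart_inv c).
Proof. by split=> sf c ac; apply/smooth_on_Cn; exact: sf. Qed.

Section Chart.
Variable c : chart R M m.
Hypothesis ac : mfd_atlas c.

Lemma chart_dom_open : open (chart_dom c).
Proof. by have [] := mfd_chart ac. Qed.

Lemma chart_img_open : open (chart_img c).
Proof. by have [] := mfd_chart ac. Qed.

Lemma chart_funK x : chart_dom c x -> chart_inv c (chart_fun c x) = x.
Proof. by have [_ _ + _ _] := mfd_chart ac; apply. Qed.

Lemma chart_fun_img x : chart_dom c x -> chart_img c (chart_fun c x).
Proof. by move=> dx; exists x. Qed.

Lemma chart_inv_dom z : chart_img c z -> chart_dom c (chart_inv c z).
Proof. by move=> [x dx <-]; rewrite chart_funK. Qed.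

Lemma chart_invK z : chart_img c z -> chart_fun c (chart_inv c z) = z.
Proof. by move=> [x dx <-]; rewrite chart_funK. Qed.

Lemma chart_fun_continuous x : chart_dom c x -> {for x, continuous (chart_fun c)}.
Proof.
move=> dx; have [od _ _ cf _] := mfd_chart ac.
by rewrite continuous_open_subspace // in cf; apply: cf; rewrite inE.
Qed.

Lemma chart_inv_continuous z : chart_img c z -> {for z, continuous (chart_inv c)}.
Proof.
move=> dz; have [_ oi _ _ ci] := mfd_chart ac.
by rewrite continuous_open_subspace // in ci; apply: ci; rewrite inE.
Qed.

Lemma near_chart_inv z (P : M -> Prop) : chart_img c z ->
  (\forall y \near chart_inv c z, P y) -> \forall u \near z, P (chart_inv c u).
Proof. by move=> iz nP; have := chart_inv_continuous iz; move=> /(_ _ nP). Qed.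

Lemma near_chart_fun x (P : 'rV[R]_m -> Prop) : chart_dom c x ->
  (\forall z \near chart_fun c x, P z) -> \forall y \near x, P (chart_fun c y).
Proof. by move=> dx nP; have := chart_fun_continuous dx; move=> /(_ _ nP). Qed.

Lemma near_chart_dom x : chart_dom c x -> \forall y \near x, chart_dom c y.
Proof. by move=> dx; apply: open_nbhs_nbhs; split => //; exact: chart_dom_open. Qed.

End Chart.

Lemma near_open (T : topologicalType) (x : T) (P : T -> Prop) :
  (\forall y \near x, P y) -> exists U : set T, [/\ open U, U x & forall z, U z -> P z].
Proof. by rewrite /prop_near1 nbhsE => -[U [oU Ux] UP]; exists U. Qed.

Lemma smooth_near f : (forall x, exists h, smooth h /\ \forall y \near x, f y = h y) ->
  smooth f.
Proof.
move=> loc; apply/smoothP => c ac k; apply: Cn_local => z iz.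
have [h [sh fh]] := loc (chart_inv c z).
have [U [oU Uz UP]] := near_open (near_chart_inv ac iz fh).
exists (chart_img c `&` U); split => //.
  by apply: openI => //; exact: chart_img_open.
apply: (@Cn_eq _ _ _ _ _ (h \o chart_inv c)).
- by apply: openI => //; exact: chart_img_open.
- by move=> u [_ /UP /= ->].
- by apply: (Cn_sub (A := chart_img c)) => [u []//|]; exact: (smoothP h).1.
Qed.

Lemma smooth_cst (a : R) : smooth (fun _ : M => a).
Proof. by apply/smoothP => c ac k; exact: Cn_cst. Qed.

Lemma smoothD f h : smooth f -> smooth h -> smooth (fun y => f y + h y).
Proof.
move=> /smoothP sf /smoothP sh; apply/smoothP => c ac k.
by apply: (CnD (chart_img_open ac) (sf c ac k) (sh c ac k)).
Qed.

Lemma smoothM f h : smooth f -> smooth h -> smooth (fun y => f y * h y).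
Proof.
move=> /smoothP sf /smoothP sh; apply/smoothP => c ac k.
by apply: (CnM (chart_img_open ac) (sf c ac k) (sh c ac k)).
Qed.

Lemma smoothZ (a : R) f : smooth f -> smooth (fun y => a * f y).
Proof. by apply: smoothM; exact: smooth_cst. Qed.

Lemma smoothN f : smooth f -> smooth (fun y => - f y).
Proof.
move=> sf; have := smoothZ (-1) sf.
by congr smooth; apply/funext => y; rewrite mulN1r.
Qed.

Lemma smoothB f h : smooth f -> smooth h -> smooth (fun y => f y - h y).
Proof. by move=> sf sh; apply: smoothD => //; exact: smoothN. Qed.

Lemma smooth_sum I (r : seq I) (P : pred I) (F : I -> M -> R) :
  (forall i, P i -> smooth (F i)) -> smooth (fun y => \sum_(i <- r | P i) F i y).
Proof.
move=> sF; elim: r => [|i r IH].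
  by have := smooth_cst 0; congr smooth; apply/funext => y; rewrite big_nil.
case: (boolP (P i)) => Pi.
  have := smoothD (sF i Pi) IH.
  by congr smooth; apply/funext => y; rewrite big_cons Pi.
by have := IH; congr smooth; apply/funext => y; rewrite big_cons (negbTE Pi).
Qed.

Lemma smooth_continuous f : smooth f -> continuous f.
Proof.
move=> /smoothP sf x; have [c ac dx] := mfd_cover x.
have cf := Cn_continuous (sf c ac 0%N) (chart_fun_img dx).
have cc := chart_fun_continuous ac dx.
have h : {for x, continuous ((f \o chart_inv c) \o chart_fun c)}.
  exact: continuous_comp.
apply: cvg_trans (cvg_trans _ h) _.
  apply: near_eq_cvg; apply: filterS (near_chart_dom ac dx) => y dy.
  by rewrite /= chart_funK.
by rewrite /= chart_funK.
Qed.

(** Extension by zero from a chart. The support is the image K of a compact box, hence closed since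
    M is Hausdorff, so the product is smooth both near K and off K. The function g need only be
    smooth on A, because K is mapped into A. *)
Lemma chart_cutoff c x (U : set M) (A : set 'rV[R]_m) : mfd_atlas c ->
  chart_dom c x -> nbhs x U -> open A -> A (chart_fun c x) ->
  exists chi : M -> R,
    [/\ forall y, 0 <= chi y <= 1, \forall y \near x, chi y = 1,
        forall y, ~ (chart_dom c y /\ U y) -> chi y = 0 &
        forall g, (forall k, Cn k A g) -> smooth (fun y => chi y * g (chart_fun c y))].
Proof.
move=> ac dx nU oA Ax; set p := chart_fun c x.
have ip : chart_img c p by exact: chart_fun_img.
have nUp : \forall u \near p, U (chart_inv c u).
  by apply: near_chart_inv => //; rewrite chart_funK.
have nip : \forall u \near p, chart_img c u.
  by apply: open_nbhs_nbhs; split => //; exact: chart_img_open.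
have nA : \forall u \near p, A u by exact: open_nbhs_nbhs.
have [r r0 rP] := near_ball_sub (filterI nUp (filterI nip nA)).
have r20 : 0 < r / 2 by rewrite divr_gt0.
have [b [bC b01 b1 b0]] := bump_rV p r20.
(* For the maximum norm this is the closed ball of radius r / 2; written as a product of segments it
   is visibly compact. *)
pose box : set 'rV[R]_m := [set z | forall j, `[p 0 j - r / 2, p 0 j + r / 2]%classic (z 0 j)].
have boxK : compact box.
  exact: (rV_compact (fun j => @segment_compact R (p 0 j - r / 2) (p 0 j + r / 2))).
have box_ball z : box z -> ball p r z.
  move=> bz; rewrite -ball_normE /=.
  rewrite [ltLHS]/Num.Def.normr/= mx_normrE; apply: bigmax_lt => //= -[i j] _ /=.
  rewrite (ord1 i) !mxE; have := bz j; rewrite /= in_itv /= => /andP[h1 h2].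
  by rewrite ltr_norml; apply/andP; split; lra.
have notbox z : ~ box z -> b z = 0.
  move=> nz; apply: b0; rewrite leNgt; apply/negP => hz; apply: nz => j.
  have := le_lt_trans (coord_le_norm (z - p) j) hz; rewrite !mxE ltr_norml => /andP[h1 h2].
  by rewrite /= in_itv /=; apply/andP; split; lra.
pose K : set M := chart_inv c @` box.
have Kc : closed K.
  apply: compact_closed; first exact: mfd_hausdorff.
  apply: continuous_compact => //; apply: continuous_in_subspaceT => z.
  rewrite inE => bz; apply: chart_inv_continuous => //.
  by have [_ []] := rP z (box_ball z bz).
pose chi y := if `[< chart_dom c y >] then b (chart_fun c y) else 0.
have chiK y : ~ K y -> chi y = 0.
  move=> nK; rewrite /chi; case: asboolP => // dy; apply: notbox => bz.
  by apply: nK; exists (chart_fun c y) => //; rewrite chart_funK.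
have KP y : K y -> [/\ chart_dom c y, U y & A (chart_fun c y)].
  move=> [z bz <-]; have [Uz [iz Az]] := rP z (box_ball z bz).
  by split=> //; [exact: chart_inv_dom|rewrite chart_invK].
exists chi; split.
- by move=> y; rewrite /chi; case: ifP => // _; rewrite lexx ler01.
- apply: filterS2 (near_chart_dom ac dx) (near_chart_fun ac dx b1) => y dy by1.
  by rewrite /chi; case: asboolP.
- by move=> y nd; apply: chiK => /KP[? ?]; apply: contra_not nd.
move=> g gC; apply/smoothP => c' ac' k; apply: Cn_local => z iz.
(* Near a point of K the function is read through the transition map; away from K it vanishes
   locally. *)
have [Ky|nKy] := EM (K (chart_inv c' z)).
- have [dy Uy Ay] := KP _ Ky.
  have n1 : \forall u \near z, chart_dom c (chart_inv c' u) /\ A (chart_fun c (chart_inv c' u)).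
    apply: (near_chart_inv (P := fun y => chart_dom c y /\ A (chart_fun c y)) ac' iz).
    apply: filterI; first exact: near_chart_dom.
    by apply: (near_chart_fun ac dy); exact: open_nbhs_nbhs.
  have [V [oV Vz VP]] := near_open n1.
  have oW : open (chart_img c' `&` V) by apply: openI => //; exact: chart_img_open.
  exists (chart_img c' `&` V); split => //.
  have tC : Cn k (chart_img c' `&` V) (transition c' c).
    have [/smooth_on_Cn + _] := mfd_compat ac' ac => /(_ k).
    apply: Cn_sub => u [iu /VP[du _]]; exists (chart_inv c' u); last exact: chart_invK.
    by split=> //; exact: chart_inv_dom.
  have bgC : Cn k A (fun u => b u * g u).
    by apply: CnM => //; apply: (Cn_sub (A := setT)).
  apply: (Cn_eq oW _ (Cn_comp oW oA _ tC bgC)); last by move=> u [_ /VP[]].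
  by move=> u [iu /VP[du Au]] /=; rewrite /chi; case: asboolP.
- have n1 : \forall u \near z, ~ K (chart_inv c' u).
    apply: (near_chart_inv (P := fun y => ~ K y) ac' iz).
    by apply: open_nbhs_nbhs; split => //; exact: closed_openC.
  have [V [oV Vz VP]] := near_open n1; exists V; split => //.
  by apply: Cn_eq (Cn_cst k V 0) => // u /VP nK /=; rewrite chiK // mul0r.
Qed.

Lemma smooth_bump x (U : set M) : nbhs x U -> exists chi : M -> R,
  [/\ smooth chi, forall y, 0 <= chi y <= 1, \forall y \near x, chi y = 1 &
      forall y, ~ U y -> chi y = 0].
Proof.
move=> nU; have [c ac dx] := mfd_cover x.
have [chi [c01 c1 c0 cg]] := chart_cutoff ac dx nU openT I.
exists chi; split => //; last by move=> y nUy; apply: c0 => -[].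
have := cg (fun=> 1) (fun k => Cn_cst _ _ _); congr smooth.
by apply/funext => y; rewrite mulr1.
Qed.

Lemma smooth_inv_near f x : smooth f -> f x != 0 ->
  exists h, smooth h /\ \forall y \near x, h y * f y = 1.
Proof.
move=> sf fx0; have [c ac dx] := mfd_cover x.
have n1 : \forall y \near x, f y != 0.
  have := smooth_continuous sf; move=> /(_ x) cf.
  exact: cvgr_neq0 fx0.
have n2 : \forall u \near chart_fun c x, f (chart_inv c u) != 0 /\ chart_img c u.
  apply: filterI.
    apply: (near_chart_inv (P := fun y => f y != 0) ac); first exact: chart_fun_img.
    by rewrite chart_funK.
  apply: open_nbhs_nbhs; split; [exact: chart_img_open|exact: chart_fun_img].
have [A [oA Ax AP]] := near_open n2.
have [chi [c01 c1 c0 cg]] := chart_cutoff ac dx filterT oA Ax.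
exists (fun y => chi y * (f (chart_inv c (chart_fun c y)))^-1); split.
  apply: (cg (fun u => (f (chart_inv c u))^-1)) => k.
  apply: CnV => // [u /AP[]//|].
  by apply: (Cn_sub (A := chart_img c)) => [u /AP[]//|]; exact: (smoothP f).1.
apply: filterS2 (filterI c1 n1) (near_chart_dom ac dx) => y [-> fy] dy.
by rewrite chart_funK // mul1r mulVf.
Qed.

End SmoothFunctions.

(** * Global functions serving as local coordinates *)

Section Coordinates.
Variables (R : realType) (m : nat) (M : oriented_manifold R m).
Implicit Types (f h w : M -> R) (c : chart R M m) (x y : M).

Lemma near_near (T : topologicalType) (x : T) (P : T -> Prop) :
  (\forall y \near x, P y) -> \forall y \near x, \forall z \near y, P z.
Proof.
move=> /near_open[U [oU Ux UP]].
suff : \forall y \near x, U y.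
  by apply: filterS => y Uy; apply: (filterS UP); exact: open_nbhs_nbhs.
exact: open_nbhs_nbhs.
Qed.

(** Cut-off chart coordinates, with what later arguments need of a chart: first order expansions
    with smooth coefficients around every nearby y (not only x, since vector fields are compared
    near x), straight lines in every direction, and injectivity near x. *)
Lemma coordinates x : exists Y : 'I_m -> M -> R,
  [/\ forall j, smooth (Y j),
    \forall y \near x, forall w, smooth w -> exists Q : 'I_m -> M -> R,
      (forall j, smooth (Q j)) /\
      \forall z \near y, w z = w y + \sum_j (Y j z - Y j y) * Q j z,
    forall a : 'I_m -> R, exists s : R -> M,
      [/\ {for 0, continuous s}, s 0 = x &
        \forall t \near (0:R), forall j, Y j (s t) = Y j x + t * a j] &
    exists2 N, nbhs x N &
      forall y z, N y -> N z -> (forall j, Y j y = Y j z) -> y = z].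
Proof.
have [c ac dx] := mfd_cover x; set p := chart_fun c x.
have ip : chart_img c p by exact: chart_fun_img.
have oi := chart_img_open ac.
have [chi [c01 c1 c0 cg]] := chart_cutoff ac dx filterT oi ip.
pose Y j y := chi y * chart_fun c y 0 j.
have sY j : smooth (Y j).
  by apply: (cg (fun z => z 0 j)) => k; exact: (Cn_coord j oi (Cn_id k _)).
have ndc : \forall y \near x, chart_dom c y /\ chi y = 1.
  by apply: filterI => //; exact: near_chart_dom.
have YE y j : chart_dom c y /\ chi y = 1 -> Y j y = chart_fun c y 0 j.
  by move=> [_ cy]; rewrite /Y cy mul1r.
have xE := nbhs_singleton ndc.
exists Y; split => //.
- have nip : \forall u \near p, chart_img c u by exact: open_nbhs_nbhs.
  have [r r0 rP] := near_ball_sub nip.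
  have r20 : 0 < r / 2 by rewrite divr_gt0.
  have nb : \forall y \near x, ball p (r / 2) (chart_fun c y).
    apply: (near_chart_fun ac dx); apply: open_nbhs_nbhs.
    by split; [exact: ball_open|exact: ballxx].
  apply: filterS2 nb (near_near ndc) => y qb ny w sw.
  set q := chart_fun c y in qb *.
  have yE := nbhs_singleton ny; have [dy _] := yE.
  (* Halving the radius leaves a ball around each nearby base point q inside the chart image, where
     Hadamard's lemma applies. *)
  have qsub : ball q (r / 2) `<=` chart_img c.
    move=> z qz; apply: rP; rewrite (splitr r); exact: ball_triangle qb qz.
  have wC i : Cn i (ball q (r / 2)) (w \o chart_inv c).
    exact: (Cn_sub qsub ((smoothP w).1 sw c ac i)).
  have [Q [QC wQ]] := hadamard wC.
  have [chi' [_ c'1 _ c'g]] := chart_cutoff ac dy filterT (ball_open q (r / 2)) (ballxx _ r20).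
  exists (fun j z => chi' z * Q j (chart_fun c z)); split.
    by move=> j; apply: c'g; exact: QC.
  have nq : \forall z \near y, ball q (r / 2) (chart_fun c z).
    apply: (near_chart_fun ac dy); apply: open_nbhs_nbhs.
    by split; [exact: ball_open|exact: ballxx].
  apply: filterS2 (filterI c'1 ny) nq => z [cz zE] qz.
  have := wQ _ qz; rewrite /= !chart_funK //; last by case: zE.
  by move=> ->; congr (_ + _); apply: eq_bigr => j _; rewrite !YE // cz mul1r.
- move=> a; pose l (t : R) : 'rV[R]_m := p + t *: \row_j a j.
  have lc : continuous l.
    move=> t; have := @ray_continuous R 'rV[R]_m p (p + \row_j a j) t.
    congr continuous_at; apply/funext => s.
    by rewrite /ray /l (addrC p (\row_j a j)) addrK.
  have l0 : l 0 = p by rewrite /l scale0r addr0.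
  have i0 : chart_img c (l 0) by rewrite l0.
  have cs : {for 0, continuous (fun t => chart_inv c (l t))}.
    apply: (@continuous_comp _ _ _ l (chart_inv c)); first exact: lc.
    exact: (chart_inv_continuous ac i0).
  exists (fun t => chart_inv c (l t)); split => //.
    by rewrite l0 chart_funK.
  have n1 : \forall t \near (0:R), chart_img c (l t).
    have := lc 0; apply; exact: open_nbhs_nbhs.
  have n2 : \forall t \near (0:R), chart_dom c (chart_inv c (l t)) /\ chi (chart_inv c (l t)) = 1.
    have e0 : chart_inv c (l 0) = x by rewrite l0 chart_funK.
    by move: cs; rewrite /prop_for /continuous_at e0 => /(_ _ ndc).
  apply: filterS2 n1 n2 => t it yE j.
  by rewrite !YE // chart_invK // /l !mxE.
- exists [set y | chart_dom c y /\ chi y = 1] => // y z yN zN yz.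
  rewrite -(chart_funK ac yN.1) -(chart_funK ac zN.1); congr (chart_inv c _).
  by apply/rowP => j; have := yz j; rewrite !YE.
Qed.

(** A ball of a chart is the union of the segments from its centre, hence connected. This makes the
    components of M open. *)
Lemma near_connected x (U : set M) : nbhs x U ->
  exists B : set M, [/\ nbhs x B, connected B & B `<=` U].
Proof.
move=> nU; have [c ac dx] := mfd_cover x; set p := chart_fun c x.
have ip : chart_img c p by exact: chart_fun_img.
have n1 : \forall u \near p, chart_img c u /\ U (chart_inv c u).
  apply: filterI; first by apply: open_nbhs_nbhs; split => //; exact: chart_img_open.
  by apply: (near_chart_inv ac ip); rewrite chart_funK.
have [r r0 rP] := near_ball_sub n1.
exists (chart_inv c @` ball p r); split.
- have nb : \forall y \near x, ball p r (chart_fun c y).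
    apply: (near_chart_fun ac dx); apply: open_nbhs_nbhs.
    by split; [exact: ball_open|exact: ballxx].
  apply: filterS2 nb (near_chart_dom ac dx) => y yb dy.
  by exists (chart_fun c y) => //; rewrite chart_funK.
- apply: connected_continuous_connected; last first.
    by apply: continuous_in_subspaceT => z; rewrite inE => /rP[iz _]; exact: chart_inv_continuous.
  have -> : ball p r = \bigcup_(z in ball p r) (ray p z @` `[(0:R), 1]%classic).
    apply/seteqP; split=> [z zb|z [y yb [t t01 <-]]].
      exists z => //; exists 1; first by rewrite /= in_itv /= ler01 lexx.
      by rewrite /ray scale1r addrC subrK.
    exact: ray_ball.
  apply: bigcup_connected.
    exists p => z zb; exists 0; first by rewrite /= in_itv /= ler01 lexx.
    by rewrite /ray scale0r addr0.
  move=> z zb; apply: connected_continuous_connected.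
    exact: segment_connected.
  by apply: continuous_subspaceT; exact: ray_continuous.
- by move=> y [z /rP[_ Uz] <-].
Qed.

Lemma smooth_curve_comp (I : set R) (g : R -> M) f : open I -> smooth_curve I g ->
  smooth f -> smooth_on I (f \o g).
Proof.
move=> oI [gc gs] sf; apply/smooth_on_Cn => k; apply: Cn_local => t It.
have [c ac dt] := mfd_cover (g t).
have n1 : \forall s \near t, I s /\ chart_dom c (g s).
  apply: filterI; first exact: open_nbhs_nbhs.
  by have := gc t It; move=> /(_ _ (near_chart_dom ac dt)).
have [V [oV Vt VP]] := near_open n1; exists V; split => //.
have cC : Cn k V (chart_fun c \o g).
  have /smooth_on_Cn/(_ k) := gs c ac.
  by apply: Cn_sub => s /VP.
apply: (Cn_eq oV _ (Cn_comp oV (chart_img_open ac) _ cC ((smoothP f).1 sf c ac k))).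
  by move=> s /VP[_ ds] /=; rewrite chart_funK.
by move=> s /VP[_ ds]; exact: chart_fun_img.
Qed.

End Coordinates.

(** * Tangent vectors and vector fields *)

Section TangentVectors.
Variables (R : realType) (m : nat) (M : oriented_manifold R m).
Local Notation tvec := ((M -> R) -> R).
Local Notation vfield := (M -> tvec).
Implicit Types (f h w : M -> R) (x y : M) (u v : tvec) (X Y Z : vfield).

Section AtPoint.
Variables (x : M) (v : tvec).
Hypothesis tv : tangent x v.

Lemma tv_nsmooth f : ~ smooth f -> v f = 0.
Proof. by case: tv => + _ _ _; apply. Qed.

Lemma tvD f h : smooth f -> smooth h -> v (fun y => f y + h y) = v f + v h.
Proof. by case: tv => _ + _ _; apply. Qed.

Lemma tvZ (a : R) f : smooth f -> v (fun y => a * f y) = a * v f.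
Proof. by case: tv => _ _ + _; apply. Qed.

Lemma tvM f h : smooth f -> smooth h -> v (fun y => f y * h y) = v f * h x + f x * v h.
Proof. by case: tv => _ _ _ +; apply. Qed.

Lemma tv_cst (a : R) : v (fun=> a) = 0.
Proof.
have c1 : v (fun=> 1) = 0.
  have := tvM (@smooth_cst _ _ M 1) (@smooth_cst _ _ M 1).
  under eq_fun do rewrite mulr1; rewrite mulr1 mul1r => /eqP.
  by rewrite -subr_eq subrr eq_sym => /eqP.
have := tvZ a (@smooth_cst _ _ M 1); rewrite c1 mulr0.
by under eq_fun do rewrite mulr1.
Qed.

Lemma tvN f : smooth f -> v (fun y => - f y) = - v f.
Proof.
move=> sf; rewrite -mulN1r -tvZ //; congr v.
by apply/funext => y; rewrite mulN1r.
Qed.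

Lemma tvB f h : smooth f -> smooth h -> v (fun y => f y - h y) = v f - v h.
Proof. by move=> sf sh; rewrite tvD ?tvN //; exact: smoothN. Qed.

Lemma tv_sum I (r : seq I) (P : pred I) (F : I -> M -> R) :
  (forall i, P i -> smooth (F i)) ->
  v (fun y => \sum_(i <- r | P i) F i y) = \sum_(i <- r | P i) v (F i).
Proof.
move=> sF; elim: r => [|i r IH].
  by rewrite big_nil; under eq_fun do rewrite big_nil; exact: tv_cst.
case: (boolP (P i)) => Pi; last first.
  by under eq_fun do rewrite big_cons (negbTE Pi); rewrite IH big_cons (negbTE Pi).
under eq_fun do rewrite big_cons Pi.
by rewrite big_cons Pi tvD ?IH //; [exact: sF|exact: smooth_sum].
Qed.

(** With a bump chi supported where f = h, one has f - h = (f - h)(1 - chi); both factors vanish at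
    x and the Leibniz rule gives 0. *)
Lemma tv_near f h : smooth f -> smooth h -> (\forall y \near x, f y = h y) -> v f = v h.
Proof.
move=> sf sh fh; apply/eqP; rewrite -subr_eq0 -tvB //; apply/eqP.
have [chi [sc _ c1 c0]] := smooth_bump fh.
have -> : (fun y => f y - h y) = (fun y => (f y - h y) * (1 - chi y)).
  apply/funext => y; have [e|ne] := EM (f y = h y).
    by rewrite e subrr mul0r.
  by rewrite c0 // subr0 mulr1.
have sd := smoothB sf sh; have sc1 := smoothB (@smooth_cst _ _ M 1) sc.
rewrite tvM // (nbhs_singleton fh) subrr mul0r addr0 (nbhs_singleton c1).
by rewrite subrr mulr0.
Qed.

End AtPoint.

Lemma tangent_lin x (a : R) u v : tangent x u -> tangent x v -> tangent x (a *: u + v).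
Proof.
have E f : (a *: u + v) f = a * u f + v f by [].
move=> tu tv; split=> [f nf|f h sf sh|b f sf|f h sf sh]; rewrite !E.
- by rewrite (tv_nsmooth tu) // (tv_nsmooth tv) // mulr0 addr0.
- by rewrite (tvD tu) // (tvD tv) // mulrDr addrACA.
- by rewrite (tvZ tu) // (tvZ tv) // mulrDr mulrCA.
- rewrite (tvM tu) // (tvM tv) //; ring.
Qed.

Lemma tangent0 x : tangent x (0 : tvec).
Proof.
have E f : (0 : tvec) f = 0 by [].
split=> [f nf|f h sf sh|b f sf|f h sf sh]; rewrite !E //.
- by rewrite addr0.
- by rewrite mulr0.
- by rewrite mul0r mulr0 addr0.
Qed.

Lemma tangentZ x (a : R) u : tangent x u -> tangent x (a *: u).
Proof. by move=> tu; have := tangent_lin a tu (tangent0 x); rewrite addr0. Qed.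

Lemma tangentD x u v : tangent x u -> tangent x v -> tangent x (u + v).
Proof. by move=> tu tv; have := tangent_lin 1 tu tv; rewrite scale1r. Qed.

Lemma tangentN x u : tangent x u -> tangent x (- u).
Proof. by move=> tu; rewrite -scaleN1r; exact: tangentZ. Qed.

Lemma tangentB x u v : tangent x u -> tangent x v -> tangent x (u - v).
Proof. by move=> tu tv; apply: tangentD => //; exact: tangentN. Qed.

Lemma tangent_sum x I (r : seq I) (P : pred I) (F : I -> tvec) :
  (forall i, P i -> tangent x (F i)) -> tangent x (\sum_(i <- r | P i) F i).
Proof. by move=> tF; elim/big_ind : _ => //; [exact: tangent0|exact: tangentD]. Qed.

Lemma tangent_eq x u v : tangent x u -> tangent x v ->
  (forall f, smooth f -> u f = v f) -> u = v.
Proof.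
move=> tu tv uv; apply/funext => f; have [/uv//|nf] := EM (smooth f).
by rewrite (tv_nsmooth tu) // (tv_nsmooth tv).
Qed.

Lemma vf_tangent X x : is_vfield X -> tangent x (X x).
Proof. by move=> [+ _]; apply. Qed.

Lemma vf_smooth X f : is_vfield X -> smooth f -> smooth (fun x => X x f).
Proof. by move=> [_ +]; apply. Qed.

Lemma vfieldD X Y : is_vfield X -> is_vfield Y -> is_vfield (fun y => X y + Y y).
Proof.
move=> vX vY; split=> [x|f sf]; first by apply: tangentD; exact: vf_tangent.
by apply: smoothD; exact: vf_smooth.
Qed.

Lemma vfieldM h X : smooth h -> is_vfield X -> is_vfield (fun y => h y *: X y).
Proof.
move=> sh vX; split=> [x|f sf]; first by apply: tangentZ; exact: vf_tangent.
by apply: smoothM => //; exact: vf_smooth.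
Qed.

Lemma vfieldZ (a : R) X : is_vfield X -> is_vfield (fun y => a *: X y).
Proof. by move=> vX; apply: (vfieldM (@smooth_cst _ _ M a)). Qed.

Lemma vfield0 : is_vfield (fun _ : M => (0 : tvec)).
Proof. by split=> [x|f sf]; [exact: tangent0|exact: smooth_cst]. Qed.

Lemma vfieldN X : is_vfield X -> is_vfield (fun y => - X y).
Proof.
by move=> vX; have := vfieldZ (-1) vX; under eq_fun do rewrite scaleN1r.
Qed.

Lemma vfieldB X Y : is_vfield X -> is_vfield Y -> is_vfield (fun y => X y - Y y).
Proof. by move=> vX vY; apply: vfieldD => //; exact: vfieldN. Qed.

Lemma vfield_sum I (r : seq I) (P : pred I) (F : I -> vfield) :
  (forall i, P i -> is_vfield (F i)) -> is_vfield (fun y => \sum_(i <- r | P i) F i y).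
Proof.
move=> vF; elim: r => [|i r IH].
  by under eq_fun do rewrite big_nil; exact: vfield0.
case: (boolP (P i)) => Pi; last by under eq_fun do rewrite big_cons (negbTE Pi).
by under eq_fun do rewrite big_cons Pi; apply: vfieldD => //; exact: vF.
Qed.

Lemma vfield_near X : (forall x, tangent x (X x)) ->
  (forall x, exists Y, is_vfield Y /\ \forall y \near x, X y = Y y) -> is_vfield X.
Proof.
move=> tX loc; split=> // f sf; apply: smooth_near => x.
have [Y [vY XY]] := loc x; exists (fun y => Y y f); split; first exact: vf_smooth.
by apply: filterS XY => y ->.
Qed.

Lemma vfield_bracket X Y : is_vfield X -> is_vfield Y -> is_vfield (bracket X Y).
Proof.
move=> vX vY; split=> [x|f sf]; last first.
  by apply: smoothB; apply: vf_smooth => //; exact: vf_smooth.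
have tX := vf_tangent x vX; have tY := vf_tangent x vY.
rewrite /bracket; split=> [f nf|f h sf sh|a f sf|f h sf sh].
- have z Z : is_vfield Z -> (fun y => Z y f) = fun=> 0.
    by move=> vZ; apply/funext => y; rewrite (tv_nsmooth (vf_tangent y vZ)).
  by rewrite !z // (tv_cst tX) (tv_cst tY) subr0.
- have z Z : is_vfield Z -> (fun y => Z y (fun z => f z + h z)) = fun y => Z y f + Z y h.
    by move=> vZ; apply/funext => y; rewrite (tvD (vf_tangent y vZ)).
  rewrite !z // (tvD tX) ?(tvD tY); try exact: vf_smooth.
  by rewrite opprD addrACA.
- have z Z : is_vfield Z -> (fun y => Z y (fun z => a * f z)) = fun y => a * Z y f.
    by move=> vZ; apply/funext => y; rewrite (tvZ (vf_tangent y vZ)).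
  rewrite !z // (tvZ tX) ?(tvZ tY); try exact: vf_smooth.
  by rewrite mulrBr.
- have z Z : is_vfield Z -> (fun y => Z y (fun z => f z * h z)) =
      fun y => Z y f * h y + f y * Z y h.
    by move=> vZ; apply/funext => y; rewrite (tvM (vf_tangent y vZ)).
  have sXf := vf_smooth vX sf; have sYf := vf_smooth vY sf.
  have sXh := vf_smooth vX sh; have sYh := vf_smooth vY sh.
  rewrite !z // (tvD tX) ?(tvD tY); try exact: smoothM.
  rewrite !(tvM tX) // !(tvM tY) //; ring.
Qed.

Lemma bracketN X Y x : bracket X Y x = - bracket Y X x.
Proof. by apply/funext => f; rewrite /bracket !fctE opprB. Qed.

Lemma bracketDl X X' Y x : is_vfield X -> is_vfield X' -> is_vfield Y ->
  bracket (fun y => X y + X' y) Y x = bracket X Y x + bracket X' Y x.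
Proof.
move=> vX vX' vY; apply: (@tangent_eq x).
- by apply: vf_tangent; apply: vfield_bracket => //; exact: vfieldD.
- by apply: tangentD; apply: vf_tangent; exact: vfield_bracket.
move=> f sf; rewrite /bracket !fctE (tvD (vf_tangent x vY)); try exact: vf_smooth.
ring.
Qed.

Lemma bracketMl h X Y x : smooth h -> is_vfield X -> is_vfield Y ->
  bracket (fun y => h y *: X y) Y x = h x *: bracket X Y x - Y x h *: X x.
Proof.
move=> sh vX vY; apply: (@tangent_eq x).
- by apply: vf_tangent; apply: vfield_bracket => //; exact: vfieldM.
- apply: tangentB; apply: tangentZ; apply: vf_tangent => //.
  exact: vfield_bracket.
move=> f sf; have sX := vf_smooth vX sf; rewrite /bracket !fctE /GRing.scale /=.
by rewrite (tvM (vf_tangent x vY)) //; ring.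
Qed.

Lemma jacobi X Y Z x : is_vfield X -> is_vfield Y -> is_vfield Z ->
  bracket X (bracket Y Z) x + bracket Y (bracket Z X) x + bracket Z (bracket X Y) x = 0.
Proof.
move=> vX vY vZ; apply: (@tangent_eq x).
- have b3 A B C : is_vfield A -> is_vfield B -> is_vfield C ->
      tangent x (bracket A (bracket B C) x).
    move=> vA vB vC; apply: vf_tangent; apply: vfield_bracket => //.
    exact: vfield_bracket.
  by apply: tangentD; [apply: tangentD|]; exact: b3.
- exact: tangent0.
move=> f sf; rewrite -[RHS]/(0 : R) -[LHS]/(bracket X (bracket Y Z) x f +
  bracket Y (bracket Z X) x f + bracket Z (bracket X Y) x f) /bracket.
have s2 V W : is_vfield V -> is_vfield W -> smooth (fun y => V y (fun z => W z f)).
  by move=> vV vW; apply: vf_smooth => //; exact: vf_smooth.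
rewrite !(tvB (vf_tangent x vX)) ?(tvB (vf_tangent x vY)) ?(tvB (vf_tangent x vZ));
  try exact: s2.
ring.
all: by apply: vf_smooth => //; apply: vf_smooth.
Qed.

(** The increments [Y j z - Y j y] vanish at y, so the Leibniz rule keeps only the values of v on
    the coordinates. *)
Lemma tangent_hadamard (Y Q : 'I_m -> M -> R) w y v : tangent y v -> smooth w ->
  (forall j, smooth (Y j)) -> (forall j, smooth (Q j)) ->
  (\forall z \near y, w z = w y + \sum_j (Y j z - Y j y) * Q j z) ->
  v w = \sum_j v (Y j) * Q j y.
Proof.
move=> tv sw sY sQ wQ.
have sYc j : smooth (fun z => Y j z - Y j y) by apply: smoothB => //; exact: smooth_cst.
have sYQ j : smooth (fun z => (Y j z - Y j y) * Q j z) by exact: smoothM.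
rewrite (tv_near tv sw _ wQ); last first.
  by apply: smoothD; [exact: smooth_cst|exact: smooth_sum].
rewrite (tvD tv) //; [|exact: smooth_cst|exact: smooth_sum].
rewrite (tv_cst tv) add0r (tv_sum tv) //; apply: eq_bigr => j _.
rewrite (tvM tv) // subrr mul0r addr0 (tvB tv) //; last exact: smooth_cst.
by rewrite (tv_cst tv) subr0.
Qed.

Lemma tangent_coords (Y : 'I_m -> M -> R) y :
  (forall j, smooth (Y j)) ->
  (forall w, smooth w -> exists Q : 'I_m -> M -> R, (forall j, smooth (Q j)) /\
      \forall z \near y, w z = w y + \sum_j (Y j z - Y j y) * Q j z) ->
  forall u v, tangent y u -> tangent y v -> (forall j, u (Y j) = v (Y j)) -> u = v.
Proof.
move=> sY had u v tu tv uv; apply: (tangent_eq tu tv) => f sf.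
have [Q [sQ fQ]] := had f sf.
rewrite (tangent_hadamard tu sf sY sQ fQ) (tangent_hadamard tv sf sY sQ fQ).
by apply: eq_bigr => j _; rewrite uv.
Qed.

(** No integral curve of X is needed: at a critical point the second derivative along X is a
    quadratic form in the coordinates of X at x, so a straight coordinate line in that direction
    tests its sign. *)
Lemma local_max_derivatives x w : smooth w -> (\forall y \near x, w y <= w x) ->
  (forall v, tangent x v -> v w = 0) /\
  forall X, is_vfield X -> X x (fun y => X y w) <= 0.
Proof.
move=> sw wx; have [Y [sY had line _]] := coordinates x.
have hadx := nbhs_singleton had.
have [Q [sQ wQ]] := hadx w sw.
(* An inequality valid at the points x + t a for small t > 0 passes to t = 0 by continuity of q. *)
have lim0 (a : 'I_m -> R) (q : M -> R) (E : M -> Prop) : smooth q ->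
    (\forall z \near x, E z) ->
    (forall t z, 0 < t -> E z -> (forall j, Y j z - Y j x = t * a j) -> q z <= 0) ->
    q x <= 0.
  move=> sq nE hq; rewrite leNgt; apply/negP => q0.
  have [s [cs s0 sY']] := line a.
  have nE' : \forall t \near (0:R), E (s t).
    by move: cs; rewrite /prop_for /continuous_at s0 => /(_ _ nE).
  have cqs : {for 0, continuous (q \o s)}.
    by apply: continuous_comp => //; exact: smooth_continuous.
  have h2 : \forall t \near (0:R), 0 < q (s t).
    by apply: (cvgr_gt _ cqs); rewrite /= s0.
  have [d d0 dP] := near_ball_sub (filterI nE' (filterI sY' h2)).
  have d20 : 0 < d / 2 by rewrite divr_gt0.
  have [] := dP (d / 2).
    by rewrite -ball_normE /= sub0r normrN gtr0_norm // ltr_pdivrMr // ltr_pMr // ltr1n.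
  move=> Es [Ys qs]; have := hq _ _ d20 Es.
  rewrite leNgt qs; move=> h; suff : false by [].
  by apply: h => j; rewrite Ys addrC addKr.
have le0 b : \sum_j b j * Q j x <= 0.
  apply: (lim0 b (fun z => \sum_j b j * Q j z) _ _ (filterI wx wQ)).
    by apply: smooth_sum => j _; exact: smoothZ.
  move=> t z t0 [wz wE] Yz; move: wz; rewrite wE gerDl.
  under eq_bigr do rewrite Yz -mulrA.
  by rewrite -mulr_sumr pmulr_rle0.
(* The first order inequality is applied to both signs of each coordinate direction. *)
have Q0 j : Q j x = 0.
  have delta (e : R) : \sum_i (e * (i == j)%:R) * Q i x = e * Q j x.
    rewrite (bigD1 j) //= eqxx mulr1 big1 ?addr0 // => i /negbTE ->.
    by rewrite mulr0 mul0r.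
  have := le0 (fun i => 1 * (i == j)%:R); have := le0 (fun i => -1 * (i == j)%:R).
  by rewrite !delta mul1r mulN1r oppr_le0 => h1 h2; apply/eqP; rewrite eq_le h1 h2.
split=> [v tv|X vX].
  by rewrite (tangent_hadamard tv sw sY sQ wQ) big1 // => j _; rewrite Q0 mulr0.
have /choice[Q2 Q2P] : forall j, exists Q2 : 'I_m -> M -> R,
    (forall k, smooth (Q2 k)) /\
    \forall z \near x, Q j z = Q j x + \sum_k (Y k z - Y k x) * Q2 k z.
  by move=> j; exact: hadx.
have tX y := vf_tangent y vX.
have sYc j : smooth (fun z => Y j z - Y j x) by apply: smoothB => //; exact: smooth_cst.
have sYQ j : smooth (fun z => (Y j z - Y j x) * Q j z) by exact: smoothM.
have n1 : \forall y \near x, X y w =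
    \sum_j (X y (Y j) * Q j y + (Y j y - Y j x) * X y (Q j)).
  apply: filterS (near_near wQ) => y ny.
  rewrite (tv_near (tX y) sw _ ny); last first.
    by apply: smoothD; [exact: smooth_cst|exact: smooth_sum].
  rewrite (tvD (tX y)) //; [|exact: smooth_cst|exact: smooth_sum].
  rewrite (tv_cst (tX y)) add0r (tv_sum (tX y)) //; apply: eq_bigr => j _.
  rewrite (tvM (tX y)) // (tvB (tX y)) //; last exact: smooth_cst.
  by rewrite (tv_cst (tX y)) subr0.
have sXY j : smooth (fun y => X y (Y j)) by exact: vf_smooth.
have sXQ j : smooth (fun y => X y (Q j)) by exact: vf_smooth.
have sterm j : smooth (fun y => X y (Y j) * Q j y + (Y j y - Y j x) * X y (Q j)).
  by apply: smoothD; exact: smoothM.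
have XQ j : X x (Q j) = \sum_k X x (Y k) * Q2 j k x.
  by have [s2 q2] := Q2P j; exact: (tangent_hadamard (tX x) (sQ j) sY s2 q2).
(* Both factors of (Y j - Y j x) Q j vanish at x, so only the two mixed terms of the second
   derivative survive, whence the 2. *)
have -> : X x (fun y => X y w) = 2 * \sum_j X x (Y j) * X x (Q j).
  rewrite (tv_near (tX x) _ _ n1); [|exact: vf_smooth|exact: smooth_sum].
  rewrite (tv_sum (tX x)) // mulr_sumr; apply: eq_bigr => j _.
  rewrite (tvD (tX x)); try exact: smoothM.
  rewrite !(tvM (tX x)) // (tvB (tX x)) //; last exact: smooth_cst.
  by rewrite (tv_cst (tX x)) Q0 subrr; ring.
rewrite pmulr_rle0 //; under eq_bigr do rewrite XQ.
pose a j := X x (Y j).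
have nQ2 : \forall z \near x, forall j, Q j z = Q j x + \sum_k (Y k z - Y k x) * Q2 j k z.
  by apply: (@filter_forall _ _ _ (nbhs x) _) => j; case: (Q2P j).
(* Since [Q j x = 0], the increment of w along the line is t^2 times this quadratic form. *)
apply: (lim0 a (fun z => \sum_j a j * \sum_k a k * Q2 j k z) _ _ (filterI (filterI wx wQ) nQ2)).
  apply: smooth_sum => j _; apply: smoothZ; apply: smooth_sum => k _.
  by apply: smoothZ; case: (Q2P j).
move=> t z t0 [[wz wE] qE] Yz; move: wz; rewrite wE gerDl.
have -> : \sum_j (Y j z - Y j x) * Q j z = t ^+ 2 * \sum_j a j * \sum_k a k * Q2 j k z.
  rewrite mulr_sumr; apply: eq_bigr => j _; rewrite qE Q0 add0r Yz.
  under eq_bigr do rewrite Yz -mulrA.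
  by rewrite -mulr_sumr; ring.
by rewrite pmulr_rle0 // exprn_gt0.
Qed.

End TangentVectors.

(** * Frames, tensoriality and traces *)

Section Frames.
Variables (R : realType) (m : nat) (M : oriented_manifold R m).
Local Notation tvec := ((M -> R) -> R).
Local Notation vfield := (M -> tvec).
Implicit Types (f h w : M -> R) (x y : M) (u v : tvec) (X Y Z : vfield).

Lemma smooth_prod I (r : seq I) (P : pred I) (F : I -> M -> R) :
  (forall i, P i -> smooth (F i)) -> smooth (fun y => \prod_(i <- r | P i) F i y).
Proof.
move=> sF; elim: r => [|i r IH].
  by under eq_fun do rewrite big_nil; exact: smooth_cst.
case: (boolP (P i)) => Pi; last by under eq_fun do rewrite big_cons (negbTE Pi).
by under eq_fun do rewrite big_cons Pi; apply: smoothM => //; exact: sF.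
Qed.

Lemma smooth_det n (A : M -> 'M[R]_n) : (forall i j, smooth (fun y => A y i j)) ->
  smooth (fun y => \det (A y)).
Proof.
move=> sA; apply: smooth_sum => s _; apply: smoothZ.
by apply: smooth_prod => i _; exact: sA.
Qed.

Lemma smooth_adj n (A : M -> 'M[R]_n) i j : (forall i j, smooth (fun y => A y i j)) ->
  smooth (fun y => (\adj (A y)) i j).
Proof.
move=> sA; under eq_fun do rewrite mxE /cofactor.
apply: smoothZ; apply: smooth_det => k l; under eq_fun do rewrite !mxE; exact: sA.
Qed.

Definition is_frame x (E : 'I_m -> vfield) : Prop :=
  (forall i, is_vfield (E i)) /\ is_basis x (fun i => E i x).

Lemma sum_tvec I (r : seq I) (P : pred I) (F : I -> tvec) f :
  (\sum_(i <- r | P i) F i) f = \sum_(i <- r | P i) F i f.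
Proof.
elim: r => [|i r IH]; first by rewrite !big_nil.
by rewrite !big_cons; case: (P i); rewrite -IH.
Qed.

(** The matrix of the E i applied to the coordinates is invertible at x, since a kernel vector would
    be a linear relation. [B] is its inverse near x, smooth as the adjugate times a global
    reciprocal of the determinant. *)
Lemma frame_coef x (E : 'I_m -> vfield) (Y : 'I_m -> M -> R) : is_frame x E ->
  (forall j, smooth (Y j)) ->
  (\forall y \near x, forall w, smooth w -> exists Q : 'I_m -> M -> R,
      (forall j, smooth (Q j)) /\
      \forall z \near y, w z = w y + \sum_j (Y j z - Y j y) * Q j z) ->
  exists B : 'I_m -> 'I_m -> M -> R,
  [/\ forall i j, smooth (B i j),
      \forall y \near x, forall v, tangent y v ->
        v = \sum_i (\sum_j v (Y j) * B j i y) *: E i y,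
      \forall y \near x, forall i k, \sum_j E k y (Y j) * B j i y = (i == k)%:R &
      \forall y \near x, forall b : 'I_m -> R,
        (forall i, \sum_j b j * E i y (Y j) = 0) -> forall j, b j = 0].
Proof.
move=> [vE bE] sY had.
pose A y : 'M[R]_m := \matrix_(i, j) E i y (Y j).
have sA i j : smooth (fun y => A y i j).
  by under eq_fun do rewrite mxE; exact: vf_smooth.
have D0 : \det (A x) != 0.
  apply/negP => /det0P[a a0 aA].
  have [tE _ /(_ (fun i => a 0 i)) free] := bE.
  have : \sum_i a 0 i *: E i x = 0.
    apply: (tangent_coords sY (nbhs_singleton had)).
    - by apply: tangent_sum => i _; exact: tangentZ.
    - exact: tangent0.
    move=> j; have := congr1 (fun r : 'rV[R]_m => r 0 j) aA.
    rewrite !mxE => e; rewrite sum_tvec -[RHS]/(0 : R) -[RHS]e.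
    by apply: eq_bigr => i _; rewrite !mxE.
  move=> /free az; move/eqP: a0; apply; apply/rowP => i; rewrite mxE; exact: az.
have [h [sh hD]] := smooth_inv_near (smooth_det sA) D0.
exists (fun j i y => h y * (\adj (A y)) j i).
have AB : \forall y \near x, A y *m (h y *: \adj (A y)) = 1%:M.
  by apply: filterS hD => y hy; rewrite -scalemxAr mul_mx_adj scale_scalar_mx hy.
split.
- by move=> i j; apply: smoothM => //; exact: smooth_adj.
- apply: filterS2 had AB => y hady /mulmx1C BA v tv.
  apply: (tangent_coords sY hady) => //.
    by apply: tangent_sum => i _; apply: tangentZ; exact: vf_tangent.
  move=> l; rewrite sum_tvec.
  have E1 : \sum_j v (Y j) * (j == l)%:R = v (Y l).
    by rewrite (bigD1 l) //= eqxx mulr1 big1 ?addr0 // => j /negbTE ->; rewrite mulr0.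
  rewrite -E1; transitivity (\sum_j v (Y j) * (h y *: \adj (A y) *m A y) j l).
    by apply: eq_bigr => j _; rewrite BA !mxE.
  under eq_bigr do rewrite mxE mulr_sumr.
  rewrite exchange_big /=; apply: eq_bigr => i _.
  rewrite -[RHS]/(_ * E i y (Y l)) mulr_suml; apply: eq_bigr => j _.
  by rewrite !mxE mulrA.
- apply: filterS AB => y AB i k.
  have := congr1 (fun B : 'M[R]_m => B k i) AB; rewrite !mxE eq_sym => <-.
  by apply: eq_bigr => j _; rewrite !mxE.
- apply: filterS AB => y /mulmx1C BA b b0 j.
  have : b j = (h y *: \adj (A y) *m (A y *m \col_j b j)) j 0.
    by rewrite mulmxA BA mul1mx mxE.
  suff -> : A y *m \col_j b j = 0 by rewrite mulmx0 mxE.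
  apply/colP => i; rewrite !mxE -[RHS](b0 i); apply: eq_bigr => l _.
  by rewrite !mxE mulrC.
Qed.

Section Tensors.
Hypothesis frames : forall x, exists E, is_frame x E.

Lemma vfield_ext x v : tangent x v -> exists X, is_vfield X /\ X x = v.
Proof.
have [E [vE [_ sp _]]] := frames x => /sp[a ->].
exists (fun y => \sum_i a i *: E i y); split => //.
by apply: vfield_sum => i _; exact: vfieldZ.
Qed.

(** Linearity over smooth functions implies dependence on the value at x only. The frames assumed
    here are supplied below by the CR structure together with the characteristic field. *)
Lemma tensorial (A : lmodType R) x (T : vfield -> A) :
  (forall X Y, is_vfield X -> is_vfield Y -> T (fun y => X y + Y y) = T X + T Y) ->
  (forall h X, smooth h -> is_vfield X -> T (fun y => h y *: X y) = h x *: T X) ->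
  forall X X', is_vfield X -> is_vfield X' -> X x = X' x -> T X = T X'.
Proof.
move=> TD TM.
have T0 D : is_vfield D -> D x = 0 -> T D = 0.
  move=> vD D0; have [E fE] := frames x; have [vE _] := fE.
  have [Y [sY had _ _]] := coordinates x.
  have [B [sB DE _ _]] := frame_coef fE sY had.
  have [chi [sc _ c1 c0]] := smooth_bump DE.
  pose k i y := \sum_j D y (Y j) * B j i y.
  have sk i : smooth (k i).
    by apply: smooth_sum => j _; apply: smoothM => //; exact: vf_smooth.
  (* Multiplication by chi turns the local expansion into an identity of global fields, whose
     coefficients vanish at x along with [D x]. *)
  have e : (fun y => chi y *: D y) = fun y => \sum_i (chi y * k i y) *: E i y.
    apply/funext => y; have [h|nh] := EM (forall v, tangent y v ->
        v = \sum_i (\sum_j v (Y j) * B j i y) *: E i y).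
      rewrite {1}(h (D y) (vf_tangent y vD)) scaler_sumr.
      by apply: eq_bigr => i _; rewrite scalerA.
    by rewrite c0 // scale0r big1 // => i _; rewrite mul0r scale0r.
  have := TM chi D sc vD; rewrite (nbhs_singleton c1) scale1r => <-; rewrite e.
  have Tsum (r : seq 'I_m) :
      T (fun y => \sum_(i <- r) (chi y * k i y) *: E i y) = 0.
    elim: r => [|i r IH].
      under eq_fun do rewrite big_nil.
      have e0 := TM (fun=> 0) (fun=> 0) (@smooth_cst _ _ M 0) (vfield0 M).
      rewrite [RHS]scale0r in e0; rewrite -[RHS]e0.
      by congr T; apply/funext => y; rewrite scaler0.
    under eq_fun do rewrite big_cons.
    rewrite TD ?IH ?addr0.
    - rewrite (TM (fun y => chi y * k i y)) //; last exact: smoothM.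
      rewrite (_ : k i x = 0) ?mulr0 ?scale0r //.
      by rewrite /k big1 // => j _; rewrite D0 mul0r.
    - by apply: vfieldM => //; exact: smoothM.
    - by apply: vfield_sum => l _; apply: vfieldM => //; exact: smoothM.
  exact: Tsum.
move=> X X' vX vX' XX'.
have vD := vfieldB vX vX'.
have := T0 _ vD; rewrite XX' subrr => /(_ erefl) TDz.
have := TD _ _ vX' vD; rewrite TDz addr0 => <-.
by congr T; apply/funext => y; rewrite addrC subrK.
Qed.

Lemma xget_eq (A : choiceType) (a0 a : A) (P : set A) :
  P a -> (forall b, P b -> b = a) -> xget a0 P = a.
Proof. by move=> Pa Pu; apply: Pu; exact: (xgetI _ Pa). Qed.

(** Tensoriality in each slot leaves a single candidate for the value picked by [xget]. *)
Lemma ext2E (A : lmodType R) (B : vfield -> vfield -> A) x X Y :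
  (forall X X' Y, is_vfield X -> is_vfield X' -> is_vfield Y -> X x = X' x ->
     B X Y = B X' Y) ->
  (forall X Y Y', is_vfield X -> is_vfield Y -> is_vfield Y' -> Y x = Y' x ->
     B X Y = B X Y') ->
  is_vfield X -> is_vfield Y -> ext2 B x (X x) (Y x) = B X Y.
Proof.
move=> B1 B2 vX vY; apply: xget_eq; first by exists X, Y.
move=> b [X' [Y' [vX' vY' eX eY ->]]].
by rewrite (B1 X' X Y') // (B2 X Y' Y).
Qed.

Lemma ext3E (A : lmodType R) (B : vfield -> vfield -> vfield -> A) x X Y Z :
  (forall X X' Y Z, is_vfield X -> is_vfield X' -> is_vfield Y -> is_vfield Z ->
     X x = X' x -> B X Y Z = B X' Y Z) ->
  (forall X Y Y' Z, is_vfield X -> is_vfield Y -> is_vfield Y' -> is_vfield Z ->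
     Y x = Y' x -> B X Y Z = B X Y' Z) ->
  (forall X Y Z Z', is_vfield X -> is_vfield Y -> is_vfield Z -> is_vfield Z' ->
     Z x = Z' x -> B X Y Z = B X Y Z') ->
  is_vfield X -> is_vfield Y -> is_vfield Z ->
  ext3 B x (X x) (Y x) (Z x) = B X Y Z.
Proof.
move=> B1 B2 B3 vX vY vZ; apply: xget_eq; first by exists X, Y, Z.
move=> b [X' [Y' [Z' [[vX' vY' vZ'] [eX eY eZ ->]]]]].
by rewrite (B1 X' X Y' Z') // (B2 X Y' Y Z') // (B3 X Y Z' Z).
Qed.

End Tensors.

Lemma basis_coef_unique x (e : 'I_m -> tvec) (a b : 'I_m -> R) : is_basis x e ->
  \sum_i a i *: e i = \sum_i b i *: e i -> forall i, a i = b i.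
Proof.
move=> [_ _ free] ab i; apply/eqP; rewrite -subr_eq0; apply/eqP.
apply: (free (fun i => a i - b i)).
under eq_bigr do rewrite scalerBl.
by rewrite sumrB ab subrr.
Qed.

(** Two bases give similar matrices, so [trace_at] has a single candidate. Linearity of L is asked
    on tangent vectors only. *)
Lemma trace_atE x (L : tvec -> tvec) (e : 'I_m -> tvec) (A : 'M[R]_m) :
  (forall a u v, tangent x u -> tangent x v -> L (a *: u + v) = a *: L u + L v) ->
  is_basis x e -> (forall j, L (e j) = \sum_i A i j *: e i) -> trace_at x L = \tr A.
Proof.
move=> Ll be LA; apply: xget_eq; first by exists e, A.
move=> r [e' [A' [be' LA' ->]]].
have [te sp _] := be; have [te' sp' _] := be'.
have L0 : L 0 = 0.
  by have := Ll (-1) 0 0 (tangent0 x) (tangent0 x); rewrite scaler0 addr0 scaleN1r addNr.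
have Lsum (a : 'I_m -> R) (d : 'I_m -> tvec) (s : seq 'I_m) : (forall i, tangent x (d i)) ->
    L (\sum_(i <- s) a i *: d i) = \sum_(i <- s) a i *: L (d i).
  move=> td; elim: s => [|i s IH]; first by rewrite !big_nil.
  rewrite !big_cons Ll ?IH //; apply: tangent_sum => j _; exact: tangentZ.
have /choice[P PE] : forall j, exists a : 'I_m -> R, e' j = \sum_i a i *: e i.
  by move=> j; exact: sp.
have /choice[Q QE] : forall j, exists a : 'I_m -> R, e j = \sum_i a i *: e' i.
  by move=> j; exact: sp'.
pose Pm : 'M[R]_m := \matrix_(i, j) P j i; pose Qm : 'M[R]_m := \matrix_(i, j) Q j i.
have swap (a : 'I_m -> R) (C : 'I_m -> 'I_m -> R) (d : 'I_m -> tvec) :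
    \sum_i a i *: (\sum_k C k i *: d k) = \sum_k (\sum_i C k i * a i) *: d k.
  under eq_bigr do rewrite scaler_sumr; rewrite exchange_big /=.
  apply: eq_bigr => k _; rewrite scaler_suml; apply: eq_bigr => i _.
  by rewrite scalerA mulrC.
have PQ : Pm *m Qm = 1%:M.
  apply/matrixP => i j.
  have h : \sum_k (Pm *m Qm) k j *: e k = \sum_k (k == j)%:R *: e k.
    transitivity (e j); last first.
      rewrite (bigD1 j) //= eqxx scale1r big1 ?addr0 // => k /negbTE ->.
      by rewrite scale0r.
    rewrite [RHS]QE; under [RHS]eq_bigr do rewrite PE.
    rewrite swap; apply: eq_bigr => k _; congr (_ *: _); rewrite mxE.
    by apply: eq_bigr => l _; rewrite !mxE.
  by rewrite (basis_coef_unique be h) !mxE.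
have APA : A *m Pm = Pm *m A'.
  apply/matrixP => i j.
  have h : \sum_k (A *m Pm) k j *: e k = \sum_k (Pm *m A') k j *: e k.
    transitivity (L (e' j)).
      rewrite PE Lsum //; under [RHS]eq_bigr do rewrite LA.
      rewrite swap; apply: eq_bigr => k _; congr (_ *: _); rewrite mxE.
      by apply: eq_bigr => l _; rewrite !mxE.
    rewrite LA'; under eq_bigr do rewrite PE.
    rewrite swap; apply: eq_bigr => k _; congr (_ *: _); rewrite mxE.
    by apply: eq_bigr => l _; rewrite !mxE.
  exact: (basis_coef_unique be h).
have QP := mulmx1C PQ.
by rewrite -[A']mul1mx -QP -mulmxA -APA mxtrace_mulC -mulmxA PQ mulmx1.
Qed.

End Frames.

Local Open Scope complex_scope.

(** * The Levi distribution *)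

Section ExtendBasis.
Variables (R : realType) (V : lmodType R) (N : nat).

Definition extend_basis (A : Type) (d : 'I_N -> A) (t : A) (i : 'I_N.+1) : A :=
  if unlift ord_max i is Some j then d j else t.

Lemma extend_basis_lift A (d : 'I_N -> A) t j : extend_basis d t (lift ord_max j) = d j.
Proof. by rewrite /extend_basis liftK. Qed.

Lemma extend_basis_max A (d : 'I_N -> A) t : extend_basis d t ord_max = t.
Proof. by rewrite /extend_basis unlift_none. Qed.

Lemma sum_ord_max (U : nmodType) (F : 'I_N.+1 -> U) :
  \sum_i F i = \sum_j F (lift ord_max j) + F ord_max.
Proof.
rewrite big_ord_recr /=; congr (_ + _); apply: eq_bigr => j _; congr F.
by apply: val_inj; rewrite /= /bump leqNgt ltn_ord.
Qed.

End ExtendBasis.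

Section ContactForms.
Variables (R : realType) (n : nat) (M : cr_manifold R n).
Local Notation tvec := ((M -> R) -> R).
Local Notation vfield := (M -> tvec).
Local Notation ctvec := ((M -> R) -> R[i]).
Implicit Types (f h w : M -> R) (x y : M) (u v : tvec) (X Y : vfield) (Z W : ctvec).

(** The real vector Z + conj Z; through it the fibre of T10 is identified with the real space H. *)
Definition re2 Z : tvec := fun f => 2 * complex.Re (Z f).

Lemma T10_lin x (a b : R[i]) Z W : T10 x Z -> T10 x W ->
  T10 x (fun f => a * Z f + b * W f).
Proof.
have [F [_ /nbhs_singleton[sp _]]] := T10_bundle x.
move=> /sp[p ->] /sp[q ->]; apply/sp; exists (fun i => a * p i + b * q i).
apply/funext => f; rewrite !mulr_sumr -big_split /=; apply: eq_bigr => i _.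
by rewrite mulrDl !mulrA.
Qed.

Lemma T10Z x (a : R[i]) Z : T10 x Z -> T10 x (fun f => a * Z f).
Proof.
by move=> tZ; have := T10_lin a 0 tZ tZ; under eq_fun do rewrite mul0r addr0.
Qed.

(** The difference is purely imaginary, so its conjugate is its opposite and lies in T10 as well;
    [T10_conj] makes it zero. *)
Lemma re2_inj x Z W : T10 x Z -> T10 x W -> re2 Z = re2 W -> Z = W.
Proof.
move=> tZ tW e; pose D : ctvec := fun f => 1 * Z f + (-1) * W f.
have tD : T10 x D by exact: T10_lin.
have D0 : D = fun=> 0.
  apply: (T10_conj tD); suff -> : cconj D = fun f => (-1) * D f by exact: T10Z.
  apply/funext => f; have := congr1 (fun u => u f) e; rewrite /re2 /cconj /D.
  case: (Z f) (W f) => [a b] [a' b'] /= h; have {}h : a = a' by lra.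
  by rewrite h; simpc; congr (_ +i* _); ring.
apply/funext => f; have := congr1 (fun u : ctvec => u f) D0; rewrite /D /=.
by rewrite mul1r mulN1r => /eqP; rewrite subr_eq0 => /eqP.
Qed.

Lemma levi_distrP x v : levi_distr x v <-> exists2 Z, T10 x Z & v = re2 Z.
Proof.
split=> [[Z tZ e]|[Z tZ ->]]; exists Z => //; apply/funext => f.
  have := congr1 (fun u : ctvec => complex.Re (u f)) e; rewrite /complexify /re2 /cconj /=.
  by case: (Z f) => a b /= ->; ring.
by rewrite /complexify /re2 /cconj; case: (Z f) => a b /=; simpc; congr (_ +i* _); ring.
Qed.

Lemma cr_JE x Z : T10 x Z -> cr_J x (re2 Z) = fun f => - 2 * complex.Im (Z f).
Proof.
move=> tZ; apply: xget_eq.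
  exists Z; split => //.
    apply/funext => f; rewrite /complexify /re2 /cconj; case: (Z f) => a b /=.
    by simpc; congr (_ +i* _); ring.
  apply/funext => f; rewrite /complexify /cconj; case: (Z f) => a b /=.
  by simpc; congr (_ +i* _); ring.
move=> w [W [tW e1 e2]].
have e : re2 Z = re2 W.
  apply/funext => f; have := congr1 (fun u : ctvec => complex.Re (u f)) e1.
  by rewrite /complexify /re2 /cconj /=; case: (W f) => a b /= ->; ring.
rewrite (re2_inj tZ tW e); apply/funext => f.
have := congr1 (fun u : ctvec => complex.Re (u f)) e2.
by rewrite /complexify /cconj; case: (W f) => a b /=; simpc => /= ->; ring.
Qed.

Lemma cr_JE' x Z : T10 x Z -> cr_J x (re2 Z) = re2 (fun f => 'i%C * Z f).
Proof.
move=> tZ; rewrite cr_JE //; apply/funext => f; rewrite /re2.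
by case: (Z f) => a b /=; simpc; ring.
Qed.

Lemma levi_lin x (a : R) u v : levi_distr x u -> levi_distr x v ->
  levi_distr x (a *: u + v).
Proof.
move=> /levi_distrP[Z tZ ->] /levi_distrP[W tW ->]; apply/levi_distrP.
exists (fun f => a%:C * Z f + 1 * W f); first exact: T10_lin.
apply/funext => f; rewrite -[LHS]/(a * re2 Z f + re2 W f) /re2.
by case: (Z f) (W f) => ? ? [? ?] /=; simpc; ring.
Qed.

Lemma levi0 x : levi_distr x 0.
Proof.
have [F [_ /nbhs_singleton[sp _]]] := T10_bundle x.
apply/levi_distrP; exists (fun f => \sum_(i < n) 0 * F i x f).
  by apply/sp; exists (fun=> 0).
apply/funext => f; rewrite /re2 big1 ?mulr0 // => i _; by rewrite mul0r.
Qed.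

Lemma leviZ x (a : R) u : levi_distr x u -> levi_distr x (a *: u).
Proof. by move=> hu; have := levi_lin a hu (levi0 x); rewrite addr0. Qed.

Lemma leviD x u v : levi_distr x u -> levi_distr x v -> levi_distr x (u + v).
Proof. by move=> hu hv; have := levi_lin 1 hu hv; rewrite scale1r. Qed.

Lemma leviN x u : levi_distr x u -> levi_distr x (- u).
Proof. by move=> hu; rewrite -scaleN1r; exact: leviZ. Qed.

Lemma leviB x u v : levi_distr x u -> levi_distr x v -> levi_distr x (u - v).
Proof. by move=> hu hv; apply: leviD => //; exact: leviN. Qed.

Lemma levi_sum x I (r : seq I) (P : pred I) (F : I -> tvec) :
  (forall i, P i -> levi_distr x (F i)) -> levi_distr x (\sum_(i <- r | P i) F i).
Proof. by move=> tF; elim/big_ind : _ => //; [exact: levi0|exact: leviD]. Qed.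

Lemma levi_tangent x v : levi_distr x v -> tangent x v.
Proof.
move=> /levi_distrP[Z tZ ->]; have [tr _] := T10_tangent tZ.
exact: (tangentZ 2 tr).
Qed.

Lemma cr_J_levi x v : levi_distr x v -> levi_distr x (cr_J x v).
Proof.
move=> /levi_distrP[Z tZ ->]; rewrite cr_JE' //; apply/levi_distrP.
by exists (fun f => 'i%C * Z f) => //; exact: T10Z.
Qed.

Lemma cr_JJ x v : levi_distr x v -> cr_J x (cr_J x v) = - v.
Proof.
move=> /levi_distrP[Z tZ ->]; rewrite cr_JE' // cr_JE'; last exact: T10Z.
apply/funext => f; rewrite -[RHS]/(- re2 Z f) /re2.
by case: (Z f) => a b /=; simpc; ring.
Qed.

Lemma cr_J_lin x (a : R) u v : levi_distr x u -> levi_distr x v ->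
  cr_J x (a *: u + v) = a *: cr_J x u + cr_J x v.
Proof.
move=> /levi_distrP[Z tZ ->] /levi_distrP[W tW ->].
have -> : a *: re2 Z + re2 W = re2 (fun f => a%:C * Z f + 1 * W f).
  apply/funext => f; rewrite -[LHS]/(a * re2 Z f + re2 W f) /re2.
  by case: (Z f) (W f) => ? ? [? ?] /=; simpc; ring.
rewrite !cr_JE //; last exact: T10_lin.
apply/funext => f; rewrite -[RHS]/(a * (- 2 * complex.Im (Z f)) + - 2 * complex.Im (W f)).
by case: (Z f) (W f) => ? ? [? ?] /=; simpc; ring.
Qed.

Lemma cr_J0 x : cr_J x (0 : tvec) = 0.
Proof.
have := cr_J_lin (-1) (levi0 x) (levi0 x).
by rewrite scaler0 addr0 scaleN1r addNr.
Qed.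

Lemma cr_JZ x (a : R) u : levi_distr x u -> cr_J x (a *: u) = a *: cr_J x u.
Proof. by move=> hu; have := cr_J_lin a hu (levi0 x); rewrite !addr0 cr_J0 addr0. Qed.

Lemma cr_JN x u : levi_distr x u -> cr_J x (- u) = - cr_J x u.
Proof. by move=> hu; rewrite -scaleN1r cr_JZ // scaleN1r. Qed.

Lemma re_part_levi x Z : T10 x Z -> levi_distr x (re_part Z) /\
  cr_J x (re_part Z) = - im_part Z.
Proof.
move=> tZ; pose W f := (2^-1)%:C * Z f.
have tW : T10 x W by exact: T10Z.
have e : re_part Z = re2 W.
  apply/funext => f; rewrite /re_part /re2 /W.
  by case: (Z f) => a b /=; simpc; field.
split; first by rewrite e; apply/levi_distrP; exists W.
rewrite e cr_JE //; apply/funext => f; rewrite -[RHS]/(- im_part Z f) /im_part /W.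
by case: (Z f) => a b /=; simpc; field.
Qed.

Lemma im_part_levi x Z : T10 x Z -> levi_distr x (im_part Z) /\
  cr_J x (im_part Z) = re_part Z.
Proof.
move=> tZ; have [hr jr] := re_part_levi tZ.
have e : im_part Z = - cr_J x (re_part Z) by rewrite jr opprK.
split; first by rewrite e; apply: leviN; exact: cr_J_levi.
by rewrite e cr_JN ?cr_JJ ?opprK //; exact: cr_J_levi.
Qed.

End ContactForms.

Local Open Scope complex_scope.

Record tw_structure (R : realType) (n : nat) (M : cr_manifold R n)
    (theta : M -> ((M -> R) -> R) -> R) (T : M -> (M -> R) -> R) (D : connection M) : Prop :=
  TWStructure {
    tw_ph : is_pseudohermitian theta;
    tw_pos : levi_positive theta;
    tw_char : is_characteristic theta T;
    tw_conn : is_tanaka_webster theta T D }.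

Section LeviFrames.
Variables (R : realType) (n : nat) (M : cr_manifold R n).
Local Notation tvec := ((M -> R) -> R).
Local Notation vfield := (M -> tvec).
Local Notation ctvec := ((M -> R) -> R[i]).

Lemma card_levi_index : #|{: 'I_n * bool}| = n.*2.
Proof. by rewrite card_prod card_ord card_bool muln2. Qed.

(** The boolean selects the imaginary part ([true]) or the real part ([false]) of a complex frame
    field. *)
Definition levi_index (j : 'I_(n.*2)) : 'I_n * bool :=
  enum_val (cast_ord (esym card_levi_index) j).

Definition levi_unindex (p : 'I_n * bool) : 'I_(n.*2) :=
  cast_ord card_levi_index (enum_rank p).

Lemma levi_indexK : cancel levi_index levi_unindex.
Proof. by move=> j; rewrite /levi_unindex /levi_index enum_valK cast_ordKV. Qed.

Lemma levi_unindexK : cancel levi_unindex levi_index.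
Proof. by move=> p; rewrite /levi_unindex /levi_index cast_ordK enum_rankK. Qed.

Lemma sum_levi_index (U : nmodType) (F : 'I_n * bool -> U) :
  \sum_j F (levi_index j) = \sum_i (F (i, false) + F (i, true)).
Proof.
transitivity (\sum_p F p).
  by rewrite [RHS](reindex levi_index) //; exists levi_unindex => p _;
    [exact: levi_indexK|exact: levi_unindexK].
transitivity (\sum_i \sum_(b : bool) F (i, b)).
  by rewrite pair_big /=; apply: eq_bigr => -[i b].
by apply: eq_bigr => i _; rewrite big_bool /= addrC.
Qed.

Definition levi_basis (x : M) (d : 'I_(n.*2) -> tvec) : Prop :=
  [/\ forall j, levi_distr x (d j),
      forall v, levi_distr x v -> exists a : 'I_(n.*2) -> R, v = \sum_j a j *: d j &
      forall a : 'I_(n.*2) -> R, \sum_j a j *: d j = 0 -> forall j, a j = 0].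

Definition real_frame (F : 'I_n -> M -> ctvec) (j : 'I_(n.*2)) : vfield :=
  let p := levi_index j in
  fun x => if p.2 then im_part (F p.1 x) else re_part (F p.1 x).

Definition real_frameJ (F : 'I_n -> M -> ctvec) (j : 'I_(n.*2)) : vfield :=
  let p := levi_index j in
  fun x => if p.2 then re_part (F p.1 x) else - im_part (F p.1 x).

Lemma cframe_mem x (F : 'I_n -> M -> ctvec) i : is_cframe (T10 x) (fun i => F i x) ->
  T10 x (F i x).
Proof.
move=> [sp _]; apply/sp; exists (fun k => (k == i)%:R); apply/funext => f.
rewrite (bigD1 i) //= eqxx mul1r big1 ?addr0 // => k /negbTE ->; by rewrite mul0r.
Qed.

Lemma real_frame_levi x (F : 'I_n -> M -> ctvec) j :
  is_cframe (T10 x) (fun i => F i x) ->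
  levi_distr x (real_frame F j x) /\ cr_J x (real_frame F j x) = real_frameJ F j x.
Proof.
move=> fF; rewrite /real_frame /real_frameJ; case: (levi_index j) => i b /=.
have tF := cframe_mem i fF.
by case: b; [exact: im_part_levi|exact: re_part_levi].
Qed.

Lemma real_frame_basis x (F : 'I_n -> M -> ctvec) :
  is_cframe (T10 x) (fun i => F i x) -> levi_basis x (fun j => real_frame F j x).
Proof.
move=> fF; have [sp free] := fF.
(* Since a Re F + b Im F = Re ((a - i b) F), real combinations of the frame are real parts of
   vectors of T10. *)
have sumE (a : 'I_(n.*2) -> R) : \sum_j a j *: real_frame F j x =
    re_part (fun f => \sum_i (a (levi_unindex (i, false)) -i* a (levi_unindex (i, true))) * F i x f).
  transitivity (\sum_j a (levi_unindex (levi_index j)) *: (if (levi_index j).2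
      then im_part (F (levi_index j).1 x) else re_part (F (levi_index j).1 x))).
    by apply: eq_bigr => j _; rewrite levi_indexK.
  rewrite (sum_levi_index (fun p => a (levi_unindex p) *: (if p.2
    then im_part (F p.1 x) else re_part (F p.1 x)))) /=.
  apply/funext => f; rewrite sum_tvec /re_part raddf_sum; apply: eq_bigr => i _.
  rewrite -[LHS]/(a _ * complex.Re (F i x f) + a _ * complex.Im (F i x f)).
  by case: (F i x f) => p q /=; simpc.
split.
- by move=> j; have [] := real_frame_levi j fF.
- move=> v /levi_distrP[Z /sp[a ->] ->].
  exists (fun j => let p := levi_index j in
    if p.2 then - 2 * complex.Im (a p.1) else 2 * complex.Re (a p.1)).
  rewrite sumE; apply/funext => f; rewrite /re2 /re_part -[LHS]/(2 * complex.Re _).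
  rewrite !raddf_sum mulr_sumr; apply: eq_bigr => i _; rewrite !levi_unindexK /=.
  by case: (a i) (F i x f) => ? ? [? ?] /=; simpc => /=; ring.
- move=> a; rewrite sumE.
  set W : ctvec := fun f => _ => W0.
  have tW : T10 x W by apply/sp; exists (fun i => a (levi_unindex (i, false)) -i* a (levi_unindex (i, true))).
  have t0 : T10 x (fun f => 0 * W f) by exact: T10Z.
  have WE : W = fun f => 0 * W f.
    apply: (re2_inj tW t0); apply/funext => f; have := congr1 (fun u : tvec => u f) W0.
    by rewrite /re_part /re2 => ->; rewrite mul0r.
  have := free (fun i => a (levi_unindex (i, false)) -i* a (levi_unindex (i, true))).
  have Wz f : W f = 0 by rewrite WE mul0r.
  move=> /(_ Wz) az j; rewrite -(levi_indexK j); case: (levi_index j) => i b.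
  by have [e1 e2] := az i; case: b => //; apply/eqP; rewrite -oppr_eq0 e2.
Qed.

End LeviFrames.

(** * The contact form, the splitting H + RT and the tensor J *)

Section ContactGeometry.
Variables (R : realType) (n : nat) (M : cr_manifold R n).
Variables (theta : M -> ((M -> R) -> R) -> R) (T : M -> (M -> R) -> R).
Variable D : connection M.
Hypothesis S : tw_structure theta T D.
Local Notation tvec := ((M -> R) -> R).
Local Notation vfield := (M -> tvec).
Implicit Types (f h w : M -> R) (x y : M) (u v : tvec) (X Y Z : vfield).
Local Notation dth := (ext_deriv theta).
Local Notation P := (proj_H theta T).
Local Notation JJ := (J theta T).

Lemma vfieldT : is_vfield T. Proof. by case: (tw_char S). Qed.

Lemma tangentT x : tangent x (T x). Proof. exact: vf_tangent vfieldT. Qed.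

Lemma theta_lin x (a : R) u v : tangent x u -> tangent x v ->
  theta x (a *: u + v) = a * theta x u + theta x v.
Proof. by case: (tw_ph S) => -[+ _] _; apply. Qed.

Lemma theta_smooth X : is_vfield X -> smooth (fun x => theta x (X x)).
Proof. by case: (tw_ph S) => -[_ +] _; apply. Qed.

Lemma theta_levi x v : tangent x v -> theta x v = 0 <-> levi_distr x v.
Proof. by move=> tv; case: (tw_ph S) => _ h; exact: h. Qed.

Lemma thetaT x : theta x (T x) = 1. Proof. by case: (tw_char S) => _ + _; apply. Qed.

Lemma theta0 x v : levi_distr x v -> theta x v = 0.
Proof. by move=> hv; apply/theta_levi => //; exact: levi_tangent. Qed.

Lemma thetaD x u v : tangent x u -> tangent x v ->
  theta x (u + v) = theta x u + theta x v.
Proof. by move=> tu tv; have := theta_lin 1 tu tv; rewrite scale1r mul1r. Qed.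

Lemma thetaZ x (a : R) u : tangent x u -> theta x (a *: u) = a * theta x u.
Proof.
move=> tu; have := theta_lin a tu (tangent0 x).
by rewrite addr0 (theta0 (levi0 x)) addr0.
Qed.

Lemma thetaN x u : tangent x u -> theta x (- u) = - theta x u.
Proof. by move=> tu; rewrite -scaleN1r thetaZ // mulN1r. Qed.

Lemma thetaB x u v : tangent x u -> tangent x v ->
  theta x (u - v) = theta x u - theta x v.
Proof. by move=> tu tv; rewrite thetaD ?thetaN //; exact: tangentN. Qed.

Lemma proj_levi x v : tangent x v -> levi_distr x (P x v).
Proof.
move=> tv; have tT := tangentZ (theta x v) (tangentT x).
apply/theta_levi; first exact: tangentB.
by rewrite thetaB // thetaZ ?thetaT ?mulr1 ?subrr //; exact: tangentT.
Qed.

Lemma proj_id x v : levi_distr x v -> P x v = v.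
Proof. by move=> hv; rewrite /proj_H theta0 // scale0r subr0. Qed.

Lemma projT x : P x (T x) = 0.
Proof. by rewrite /proj_H thetaT scale1r subrr. Qed.

Lemma proj_lin x (a : R) u v : tangent x u -> tangent x v ->
  P x (a *: u + v) = a *: P x u + P x v.
Proof.
move=> tu tv; rewrite /proj_H theta_lin // scalerDl scalerBr scalerA.
by rewrite opprD addrACA.
Qed.

Lemma projE x v : v = P x v + theta x v *: T x.
Proof. by rewrite /proj_H subrK. Qed.

Lemma vfieldP X : is_vfield X -> is_vfield (fun y => P y (X y)).
Proof.
move=> vX; apply: vfieldB => //; apply: vfieldM; last exact: vfieldT.
exact: theta_smooth.
Qed.

Lemma levi_basis_basis x d : levi_basis x d -> is_basis x (extend_basis d (T x)).
Proof.
move=> [hd sp free]; split.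
- move=> i; rewrite /extend_basis; case: unlift => [j|]; last exact: tangentT.
  exact: levi_tangent.
- move=> v tv; have [a aE] := sp _ (proj_levi tv).
  exists (extend_basis a (theta x v)); rewrite sum_ord_max !extend_basis_max.
  by under eq_bigr do rewrite !extend_basis_lift; rewrite -aE -projE.
- move=> a; rewrite sum_ord_max !extend_basis_max.
  under eq_bigr do rewrite !extend_basis_lift.
  set s := \sum_j _ => e.
  have hs : levi_distr x s by apply: levi_sum => j _; exact: leviZ.
  have am : a ord_max = 0.
    have := congr1 (theta x) e; rewrite (theta0 (levi0 x)) thetaD ?thetaZ ?thetaT.
    - by rewrite (theta0 hs) add0r mulr1.
    - exact: tangentT.
    - exact: levi_tangent.
    - by apply: tangentZ; exact: tangentT.
  move=> i; have [j ->|->] := unliftP ord_max i; last by [].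
  apply: (free (fun j => a (lift ord_max j))).
  by move: e; rewrite am scale0r addr0.
Qed.

(** Real and imaginary parts of local T10 fields, completed by T. The fields [real_frameJ] are their
    images under J and are smooth by construction. *)
Lemma local_frame x : exists F : 'I_n -> M -> (M -> R) -> R[i],
  [/\ forall j, is_vfield (real_frame F j), forall j, is_vfield (real_frameJ F j),
      \forall y \near x, is_cframe (T10 y) (fun i => F i y) &
      is_frame x (extend_basis (real_frame F) T)].
Proof.
have [F [vF nF]] := T10_bundle x; exists F.
have vr j : is_vfield (real_frame F j).
  by rewrite /real_frame; case: (levi_index j) => i [] /=; have [] := vF i.
have vj j : is_vfield (real_frameJ F j).
  rewrite /real_frameJ; case: (levi_index j) => i [] /=; have [vre vim] := vF i => //.
  exact: vfieldN.
split=> //; split.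
  by move=> i; rewrite /extend_basis; case: unlift => [j|]; [exact: vr|exact: vfieldT].
have := levi_basis_basis (real_frame_basis (nbhs_singleton nF)).
congr is_basis; apply/funext => i; rewrite /extend_basis; by case: unlift.
Qed.

Lemma frames x : exists E, is_frame x E.
Proof. by have [F [_ _ _ fF]] := local_frame x; exists (extend_basis (real_frame F) T). Qed.

Lemma vf_ext x v : tangent x v -> exists X, is_vfield X /\ X x = v.
Proof. exact: (vfield_ext frames). Qed.

Lemma levi_ext x v : levi_distr x v -> exists X,
  [/\ is_vfield X, X x = v & forall y, levi_distr y (X y)].
Proof.
move=> hv; have [X [vX Xv]] := vf_ext (levi_tangent hv).
exists (fun y => P y (X y)); split; first exact: vfieldP.
  by rewrite Xv proj_id.
by move=> y; apply: proj_levi; exact: vf_tangent.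
Qed.

Lemma JE x v : levi_distr x v -> JJ x v = cr_J x v.
Proof. by move=> hv; rewrite /J proj_id. Qed.

Lemma JT x : JJ x (T x) = 0. Proof. by rewrite /J projT cr_J0. Qed.

Lemma J_lin x (a : R) u v : tangent x u -> tangent x v ->
  JJ x (a *: u + v) = a *: JJ x u + JJ x v.
Proof. by move=> tu tv; rewrite /J proj_lin // cr_J_lin //; exact: proj_levi. Qed.

Lemma J_levi x v : tangent x v -> levi_distr x (JJ x v).
Proof. by move=> tv; apply: cr_J_levi; exact: proj_levi. Qed.

Lemma JJE x v : levi_distr x v -> JJ x (JJ x v) = - v.
Proof. by move=> hv; rewrite (JE hv) JE ?cr_JJ //; exact: cr_J_levi. Qed.

(** J is picked pointwise; smoothness comes from the frame, in which JX has the smooth coefficients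
    of X on the fields [real_frameJ]. *)
Lemma vfieldJ X : is_vfield X -> is_vfield (fun y => JJ y (X y)).
Proof.
move=> vX; apply: vfield_near => x.
  by apply: levi_tangent; apply: J_levi; exact: vf_tangent.
have [F [vr vj nF fF]] := local_frame x.
have [Y [sY had _ _]] := coordinates x.
have [B [sB XE _ _]] := frame_coef fF sY had.
pose k i y := \sum_j X y (Y j) * B j i y.
have sk i : smooth (k i).
  by apply: smooth_sum => j _; apply: smoothM => //; exact: vf_smooth.
exists (fun y => \sum_j k (lift ord_max j) y *: real_frameJ F j y); split.
  by apply: vfield_sum => j _; exact: vfieldM.
apply: filterS2 nF XE => y Fy Ey.
have tX := vf_tangent y vX.
rewrite [in LHS](Ey _ tX) sum_ord_max extend_basis_max.
have hr j : levi_distr y (real_frame F j y) by have [] := real_frame_levi j Fy.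
under eq_bigr do rewrite extend_basis_lift.
set s := \sum_j _.
have hs : levi_distr y s by apply: levi_sum => j _; exact: leviZ.
rewrite addrC J_lin ?JT ?scaler0 ?add0r; [|exact: tangentT|exact: levi_tangent].
rewrite JE //.
have cJs (r : seq 'I_(n.*2)) :
    levi_distr y (\sum_(j <- r) k (lift ord_max j) y *: real_frame F j y) /\
    cr_J y (\sum_(j <- r) k (lift ord_max j) y *: real_frame F j y) =
    \sum_(j <- r) k (lift ord_max j) y *: real_frameJ F j y.
  split; first by apply: levi_sum => j _; exact: leviZ.
  elim: r => [|j r IH]; first by rewrite !big_nil cr_J0.
  rewrite !big_cons cr_J_lin ?IH //; last by apply: levi_sum => i _; exact: leviZ.
  by have [_ ->] := real_frame_levi j Fy.
by have [_] := cJs (index_enum _).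
Qed.

Lemma dthetaE x X Y : is_vfield X -> is_vfield Y -> dth x (X x) (Y x) =
  2^-1 * (X x (fun y => theta y (Y y)) - Y x (fun y => theta y (X y))
          - theta x (bracket X Y x)).
Proof.
(* [R^o] presents the scalars as a module, as [tensorial] and [ext2E] require. *)
pose B X Y : R^o := 2^-1 * (X x (fun y => theta y (Y y)) - Y x (fun y => theta y (X y))
          - theta x (bracket X Y x)).
have anti X1 Y1 : is_vfield X1 -> is_vfield Y1 -> B X1 Y1 = - B Y1 X1.
  move=> v1 v2; rewrite /B bracketN thetaN; last first.
    by apply: vf_tangent; exact: vfield_bracket.
  by ring.
have t1 X1 X2 Y1 : is_vfield X1 -> is_vfield X2 -> is_vfield Y1 -> X1 x = X2 x ->
    B X1 Y1 = B X2 Y1.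
  move=> v1 v2 vY e; apply: (tensorial frames (T := fun X => B X Y1) (x := x)) => //.
    move=> X3 X4 v3 v4; rewrite /B bracketDl // thetaD;
      [|exact/vf_tangent/vfield_bracket|exact/vf_tangent/vfield_bracket].
    have -> : (fun y => theta y (X3 y + X4 y)) = fun y => theta y (X3 y) + theta y (X4 y).
      by apply/funext => y; rewrite thetaD //; exact: vf_tangent.
    rewrite (tvD (vf_tangent x vY)); try exact: theta_smooth.
    rewrite -[(X3 x + X4 x) _]/(X3 x _ + X4 x _); ring.
  move=> h X3 sh v3; rewrite /B bracketMl // thetaB ?thetaZ;
    [|exact/vf_tangent|exact/vf_tangent/vfield_bracket
     |exact/tangentZ/vf_tangent/vfield_bracket|exact/tangentZ/vf_tangent].
  have -> : (fun y => theta y (h y *: X3 y)) = fun y => h y * theta y (X3 y).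
    by apply/funext => y; rewrite thetaZ //; exact: vf_tangent.
  rewrite (tvM (vf_tangent x vY)) //; last exact: theta_smooth.
  rewrite -[(h x *: X3 x) _]/(h x * X3 x _) /GRing.scale /=; ring.
move=> vX vY; apply: (ext2E (A := R^o) (B := B)) => // X1 Y1 Y2 v1 v2 v3 e.
by rewrite anti // [RHS]anti // (t1 Y1 Y2).
Qed.

End ContactGeometry.

Local Open Scope complex_scope.

Lemma tvecE (R : realType) (A : Type) :
  ((forall (u v : A -> R) f, ((u + v) f = u f + v f)%R) *
   (forall (u : A -> R) f, ((- u) f = - u f)%R) *
   (forall (a : R) (u : A -> R) f, ((a *: u) f = a * u f)%R) *
   (forall f, (0%R : A -> R) f = 0%R))%type.
Proof. by []. Qed.

Ltac tvec_ring := let f := fresh "f" in apply/funext => f; rewrite !tvecE; ring.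

(** * The Tanaka-Webster connection *)

Section Connections.
Variables (R : realType) (m : nat) (M : oriented_manifold R m).
Local Notation tvec := ((M -> R) -> R).
Local Notation vfield := (M -> tvec).
Hypothesis frames : forall x : M, exists E, is_frame x E.
Variable D : connection M.
Hypothesis Dconn : is_connection D.

Let D_lin x (a : R) u v Y : tangent x u -> tangent x v -> is_vfield Y ->
  D x (a *: u + v) Y = a *: D x u Y + D x v Y.
Proof. by case: Dconn => _ + _ _; apply. Qed.

Let DD x u Y Z : tangent x u -> is_vfield Y -> is_vfield Z ->
  D x u (fun y => Y y + Z y) = D x u Y + D x u Z.
Proof. by case: Dconn => _ _ + _; apply. Qed.

Let DM x u h Y : tangent x u -> smooth h -> is_vfield Y ->
  D x u (fun y => h y *: Y y) = u h *: Y x + h x *: D x u Y.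
Proof. by case: Dconn => _ _ _ +; apply. Qed.

(** Stated for any connection, since it serves both the Tanaka-Webster and the Levi-Civita one. *)
Lemma connection_torsionE x (X Y : vfield) : is_vfield X -> is_vfield Y ->
  torsion D x (X x) (Y x) = D x (X x) Y - D x (Y x) X - bracket X Y x.
Proof.
pose B X Y := D x (X x) Y - D x (Y x) X - bracket X Y x.
have anti X1 Y1 : B X1 Y1 = - B Y1 X1.
  by rewrite /B bracketN; tvec_ring.
have t1 X1 X2 Y1 : is_vfield X1 -> is_vfield X2 -> is_vfield Y1 -> X1 x = X2 x ->
    B X1 Y1 = B X2 Y1.
  move=> v1 v2 vY e; apply: (tensorial frames (T := fun X => B X Y1) (x := x)) => //.
    move=> X3 X4 v3 v4; rewrite /B bracketDl // DD //; last exact: vf_tangent.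
    have := D_lin 1 (vf_tangent x v3) (vf_tangent x v4) vY; rewrite !scale1r => ->.
    by tvec_ring.
  move=> h X3 sh v3; rewrite /B bracketMl // DM //; last exact: vf_tangent.
  have := D_lin (h x) (vf_tangent x v3) (tangent0 x) vY.
  have D0 : D x 0 Y1 = 0.
    have := D_lin (-1) (tangent0 x) (tangent0 x) vY.
    by rewrite scaler0 addr0 scaleN1r addNr.
  by rewrite addr0 D0 addr0 => ->; tvec_ring.
move=> vX vY; apply: (ext2E (A := (tvec : lmodType R)) (B := B)) => // X1 Y1 Y2 v1 v2 v3 e.
by rewrite anti // [RHS]anti // (t1 Y1 Y2).
Qed.

End Connections.

Section Webster.
Variables (R : realType) (n : nat) (M : cr_manifold R n).
Variables (theta : M -> ((M -> R) -> R) -> R) (T : M -> (M -> R) -> R).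
Variable D : connection M.
Hypothesis S : tw_structure theta T D.
Local Notation tvec := ((M -> R) -> R).
Local Notation vfield := (M -> tvec).
Implicit Types (f h w : M -> R) (x y : M) (u v : tvec) (X Y Z : vfield).
Local Notation dth := (ext_deriv theta).
Local Notation G := (levi_form theta).
Local Notation g := (webster theta T).
Local Notation JJ := (J theta T).
Local Notation tor := (torsion D).

Lemma dth_anti x u v : tangent x u -> tangent x v -> dth x u v = - dth x v u.
Proof.
move=> /(vf_ext S)[X [vX <-]] /(vf_ext S)[Y [vY <-]].
rewrite !(dthetaE S) // bracketN (thetaN S); last exact/vf_tangent/vfield_bracket.
ring.
Qed.

Lemma dth_linl x (a : R) u u' v : tangent x u -> tangent x u' -> tangent x v ->
  dth x (a *: u + u') v = a * dth x u v + dth x u' v.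
Proof.
move=> /(vf_ext S)[X [vX <-]] /(vf_ext S)[X' [vX' <-]] /(vf_ext S)[Y [vY <-]].
have vaX := vfieldZ a vX; have vs := vfieldD vaX vX'.
have := dthetaE S x vs vY; rewrite /= => ->.
rewrite !(dthetaE S) // bracketDl // (bracketMl x (@smooth_cst _ _ M a) vX vY).
rewrite (tv_cst (vf_tangent x vY)) scale0r subr0 (theta_lin S);
  [|exact/vf_tangent/vfield_bracket|exact/vf_tangent/vfield_bracket].
have -> : (fun y => theta y (a *: X y + X' y)) =
    fun y => a * theta y (X y) + theta y (X' y).
  by apply/funext => y; rewrite (theta_lin S) //; exact: vf_tangent.
have sX := theta_smooth S vX; have sX' := theta_smooth S vX'.
rewrite (tvD (vf_tangent x vY)) //; last exact: smoothZ.
rewrite (tvZ (vf_tangent x vY)) //.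
rewrite -[(a *: X x + X' x) _]/(a * X x _ + X' x _); ring.
Qed.

Lemma dth_linr x (a : R) u v v' : tangent x u -> tangent x v -> tangent x v' ->
  dth x u (a *: v + v') = a * dth x u v + dth x u v'.
Proof.
move=> tu tv tv'; rewrite dth_anti ?dth_linl //; last exact: tangent_lin.
by rewrite (dth_anti tv) // (dth_anti tv') //; ring.
Qed.

Lemma dthT x v : tangent x v -> dth x (T x) v = 0.
Proof. by case: (tw_char S) => _ _; apply. Qed.

Lemma dth_levi x X Y : is_vfield X -> is_vfield Y ->
  (forall y, levi_distr y (X y)) -> (forall y, levi_distr y (Y y)) ->
  theta x (bracket X Y x) = - 2 * dth x (X x) (Y x).
Proof.
move=> vX vY hX hY; rewrite (dthetaE S) //.
have z Z : (forall y, levi_distr y (Z y)) -> (fun y => theta y (Z y)) = fun=> 0.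
  by move=> hZ; apply/funext => y; rewrite (theta0 S).
by rewrite !z // (tv_cst (vf_tangent x vX)) (tv_cst (vf_tangent x vY)); lra.
Qed.

Lemma theta_bracketT x X : is_vfield X -> (forall y, levi_distr y (X y)) ->
  theta x (bracket T X x) = 0.
Proof.
move=> vX hX; have := dthT (vf_tangent x vX); rewrite (dthetaE S) //; last exact: vfieldT S.
have -> : (fun y => theta y (X y)) = fun=> 0.
  by apply/funext => y; rewrite (theta0 S).
have -> : (fun y => theta y (T y)) = fun=> 1 by apply/funext => y; rewrite (thetaT S).
rewrite (tv_cst (vf_tangent x vX)) (tv_cst (tangentT S x)) => h; lra.
Qed.

Lemma Dconn : is_connection D. Proof. by case: (tw_conn S). Qed.

Lemma D_vf X Y : is_vfield X -> is_vfield Y -> is_vfield (fun x => D x (X x) Y).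
Proof. by case: Dconn => + _ _ _; apply. Qed.

Lemma D_lin x (a : R) u v Y : tangent x u -> tangent x v -> is_vfield Y ->
  D x (a *: u + v) Y = a *: D x u Y + D x v Y.
Proof. by case: Dconn => _ + _ _; apply. Qed.

Lemma DD x u Y Z : tangent x u -> is_vfield Y -> is_vfield Z ->
  D x u (fun y => Y y + Z y) = D x u Y + D x u Z.
Proof. by case: Dconn => _ _ + _; apply. Qed.

Lemma DM x u h Y : tangent x u -> smooth h -> is_vfield Y ->
  D x u (fun y => h y *: Y y) = u h *: Y x + h x *: D x u Y.
Proof. by case: Dconn => _ _ _ +; apply. Qed.

Lemma D_tangent x u Y : tangent x u -> is_vfield Y -> tangent x (D x u Y).
Proof.
move=> /(vf_ext S)[X [vX <-]] vY; exact: (vf_tangent x (D_vf vX vY)).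
Qed.

Lemma D_near x u Y Z : tangent x u -> is_vfield Y -> is_vfield Z ->
  (\forall y \near x, Y y = Z y) -> D x u Y = D x u Z.
Proof.
move=> tu vY vZ YZ; have [chi [sc _ c1 c0]] := smooth_bump YZ.
have uc : u chi = 0.
  by rewrite (tv_near tu sc (@smooth_cst _ _ M 1) c1) (tv_cst tu).
have e X : is_vfield X -> D x u (fun y => chi y *: X y) = D x u X.
  by move=> vX; rewrite DM // uc scale0r add0r (nbhs_singleton c1) scale1r.
rewrite -(e Y) // -(e Z) //; congr (D x u _); apply/funext => y.
have [->//|ne] := EM (Y y = Z y); by rewrite c0 // !scale0r.
Qed.

Lemma D_levi x u Y : tangent x u -> is_vfield Y -> (forall y, levi_distr y (Y y)) ->
  levi_distr x (D x u Y).
Proof. by case: (tw_conn S) => _ + _ _ _; apply. Qed.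

Lemma D_metric x u Y Z : tangent x u -> is_vfield Y -> is_vfield Z ->
  u (fun y => g y (Y y) (Z y)) = g x (D x u Y) (Z x) + g x (Y x) (D x u Z).
Proof. by case: (tw_conn S) => _ _ + _ _; apply. Qed.

Lemma D_J x u Y : tangent x u -> is_vfield Y ->
  D x u (fun y => JJ y (Y y)) = JJ x (D x u Y).
Proof. by case: (tw_conn S) => _ _ _ + _; apply. Qed.

Lemma torsionE x X Y : is_vfield X -> is_vfield Y ->
  tor x (X x) (Y x) = D x (X x) Y - D x (Y x) X - bracket X Y x.
Proof. exact: (connection_torsionE (frames S) Dconn). Qed.

Lemma tor_tangent x u v : tangent x u -> tangent x v -> tangent x (tor x u v).
Proof.
move=> /(vf_ext S)[X [vX <-]] /(vf_ext S)[Y [vY <-]]; rewrite torsionE //.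
apply: tangentB; last exact/vf_tangent/vfield_bracket.
by apply: tangentB; apply: D_tangent => //; exact: vf_tangent.
Qed.

Lemma tor_anti x u v : tangent x u -> tangent x v -> tor x u v = - tor x v u.
Proof.
move=> /(vf_ext S)[X [vX <-]] /(vf_ext S)[Y [vY <-]].
by rewrite !torsionE // bracketN; tvec_ring.
Qed.

Lemma tor_linl x (a : R) u u' v : tangent x u -> tangent x u' -> tangent x v ->
  tor x (a *: u + u') v = a *: tor x u v + tor x u' v.
Proof.
move=> /(vf_ext S)[X [vX <-]] /(vf_ext S)[X' [vX' <-]] /(vf_ext S)[Y [vY <-]].
have vaX := vfieldZ a vX; have vs := vfieldD vaX vX'.
have tY := vf_tangent x vY.
have := torsionE x vs vY; rewrite /= => ->.
rewrite !torsionE // bracketDl // (bracketMl x (@smooth_cst _ _ M a) vX vY).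
rewrite (tv_cst tY) scale0r subr0 D_lin //; try exact: vf_tangent.
rewrite DD // (DM tY (@smooth_cst _ _ M a) vX) (tv_cst tY) scale0r add0r.
by tvec_ring.
Qed.

Lemma torZl x (a : R) u v : tangent x u -> tangent x v ->
  tor x (a *: u) v = a *: tor x u v.
Proof.
move=> tu tv.
have z : tor x 0 v = 0.
  have := tor_linl (-1) (tangent0 x) (tangent0 x) tv.
  by rewrite scaler0 addr0 scaleN1r addNr.
by have := tor_linl a tu (tangent0 x) tv; rewrite z !addr0.
Qed.

Lemma torZr x (a : R) u v : tangent x u -> tangent x v ->
  tor x u (a *: v) = a *: tor x u v.
Proof.
move=> tu tv; rewrite tor_anti //; last exact: tangentZ.
by rewrite torZl // (tor_anti tu) // scalerN.
Qed.

Lemma theta_torsion x u v : levi_distr x u -> levi_distr x v ->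
  theta x (tor x u v) = 2 * dth x u v.
Proof.
move=> /(levi_ext S)[X [vX <- hX]] /(levi_ext S)[Y [vY <- hY]].
have tX := vf_tangent x vX; have tY := vf_tangent x vY.
have tb := vf_tangent x (vfield_bracket vX vY).
have t1 := D_tangent tX vY; have t2 := D_tangent tY vX.
rewrite torsionE // (thetaB S (tangentB t1 t2) tb) (thetaB S t1 t2) (dth_levi x vX vY hX hY).
rewrite !(theta0 S (D_levi _ _ _)) //; ring.
Qed.

(** The real part of T(Z, W) = 0 gives the equality. With it, the real part of T(Z, conj W) is twice
    the torsion of the real parts, and the prescribed value is a multiple of T. *)
Lemma torsion_re_im x (Z W : (M -> R) -> R[i]) : T10 x Z -> T10 x W ->
  tor x (re_part Z) (re_part W) = tor x (im_part Z) (im_part W) /\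
  exists k, tor x (re_part Z) (re_part W) = k *: T x.
Proof.
move=> tZ tW; have [_ _ _ _ [t1 t2 _]] := tw_conn S.
have [tZr tZi] := T10_tangent tZ; have [tWr tWi] := T10_tangent tW.
have e f : tor x (re_part Z) (re_part W) f = tor x (im_part Z) (im_part W) f.
  have := congr1 (fun u : (M -> R) -> R[i] => complex.Re (u f)) (t1 x Z W tZ tW).
  by rewrite /cbilin /cform /= => /eqP; rewrite subr_eq0 => /eqP.
split; first by apply/funext => f; exact: e.
exists (- complex.Im (cform (G x) Z (cconj W))); apply/funext => f.
have := congr1 (fun u : (M -> R) -> R[i] => complex.Re (u f)) (t2 x Z W tZ tW).
rewrite /cbilin; move: (cform (G x) Z (cconj W)) => [p q]; rewrite /cform /=.
have -> : re_part (cconj W) = re_part W.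
  by apply/funext => h; rewrite /re_part /cconj; case: (W h).
have -> : im_part (cconj W) = - im_part W.
  by apply/funext => h; rewrite -[RHS]/(- complex.Im (W h)) /im_part /cconj; case: (W h).
have -> : tor x (im_part Z) (- im_part W) f = - tor x (im_part Z) (im_part W) f.
  by have := torZr (-1) tZi tWi; rewrite !scaleN1r => ->.
rewrite /complexify -e; simpc => /= h.
rewrite -[RHS]/(- q * T x f); lra.
Qed.

(** The complex conditions only show that the torsion is vertical; its coefficient is read off by
    theta, as D preserves H. *)
Lemma torsion_levi x u v : levi_distr x u -> levi_distr x v ->
  tor x u v = (2 * dth x u v) *: T x.
Proof.
move=> hu hv; rewrite -theta_torsion //.
suff [k ->] : exists k, tor x u v = k *: T x.
  by rewrite (thetaZ S) ?(thetaT S) ?mulr1 //; exact: tangentT S x.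
move: hu hv => /levi_distrP[Z tZ ->] /levi_distrP[W tW ->].
have [tZr tZi] := T10_tangent tZ; have [tWr tWi] := T10_tangent tW.
rewrite -[re2 Z]/(2 *: re_part Z) -[re2 W]/(2 *: re_part W).
rewrite torZl ?torZr //; last exact: tangentZ.
have [_ [k kE]] := torsion_re_im tZ tW.
by exists (4 * k); rewrite kE !scalerA; congr (_ *: _); ring.
Qed.

(** J exchanges real and imaginary parts up to sign, on which the torsion agrees by [torsion_re_im].
    Symmetry of the Levi form follows. *)
Lemma dth_JJ x u v : levi_distr x u -> levi_distr x v ->
  dth x (cr_J x u) (cr_J x v) = dth x u v.
Proof.
move=> hu hv.
have := theta_torsion (cr_J_levi hu) (cr_J_levi hv).
have := theta_torsion hu hv.
suff -> : tor x (cr_J x u) (cr_J x v) = tor x u v by lra.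
move: hu hv => /levi_distrP[Z tZ ->] /levi_distrP[W tW ->].
have [tZr tZi] := T10_tangent tZ; have [tWr tWi] := T10_tangent tW.
rewrite !cr_JE //.
have lin (a : R) p q : tangent x p -> tangent x q ->
    tor x (a *: p) (a *: q) = (a * a) *: tor x p q.
  by move=> tp tq; rewrite torZl ?torZr ?scalerA //; exact: tangentZ.
have [e _] := torsion_re_im tZ tW.
rewrite -[re2 Z]/(2 *: re_part Z) -[re2 W]/(2 *: re_part W).
rewrite -[fun f => - 2 * complex.Im (Z f)]/(- 2 *: im_part Z).
rewrite -[fun f => - 2 * complex.Im (W f)]/(- 2 *: im_part W).
by rewrite !lin // e; congr (_ *: _); ring.
Qed.

End Webster.

(** Gram-Schmidt as an induction on block matrices: the first pivot is split off and the hypothesis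
    is applied to its Schur complement. *)
Lemma gram_schmidt (R : rcfType) N (Q : 'M[R]_N) : Q^T = Q ->
  (forall w : 'rV[R]_N, w != 0 -> 0 < (w *m Q *m w^T) 0 0) ->
  exists A : 'M[R]_N, A *m Q *m A^T = 1%:M.
Proof.
elim: N Q => [|N IH] Q symQ posQ.
  by exists 0; apply/matrixP => -[].
move: Q symQ posQ; rewrite -[N.+1]/(1 + N)%N => Q symQ posQ.
set a := ulsubmx Q 0 0; set b := ursubmx Q; set c := dlsubmx Q; set C := drsubmx Q.
have QE : Q = block_mx a%:M b c C by rewrite -[LHS]submxK -mx11_scalar.
have [bE CE] : b = c^T /\ C^T = C.
  move: symQ; rewrite QE tr_block_mx => /eq_block_mx[_ <- _ ->] //.
have a0 : 0 < a.
  have w0 : row_mx 1%:M 0 != 0 :> 'rV[R]_(1 + N).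
    apply/eqP => /(congr1 (fun w : 'rV[R]_(1 + N) => w 0 (lshift N 0))).
    by rewrite row_mxEl !mxE eqxx => /eqP; rewrite oner_eq0.
  have := posQ _ w0; rewrite QE mul_row_block tr_row_mx mul_row_col.
  by rewrite !mul0mx !mul1mx !addr0 trmx0 mulmx0 addr0 trmx1 mulmx1 !mxE mulr1n.
have an0 : a != 0 by rewrite gt_eqF.
have [||A' A'E] := IH (C - a^-1 *: (c *m b)).
- by rewrite linearB linearZ /= trmx_mul CE bE trmxK.
(* This first coordinate cancels the cross term, so that Q at (t, w) is the Schur complement at
   w. *)
- move=> w w0; pose t := - a^-1 *: (w *m c).
  have r0 : row_mx t w != 0.
    apply: contraNneq w0 => /(congr1 rsubmx).
    by rewrite row_mxKr linear0 => ->.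
  have := posQ _ r0; rewrite QE mul_row_block tr_row_mx mul_row_col.
  have -> : t *m a%:M + w *m c = 0.
    by rewrite mul_mx_scalar /t scalerA mulrN divff // scaleN1r addNr.
  rewrite mul0mx add0r /t -scalemxAl.
  rewrite (_ : - a^-1 *: _ + _ = w *m (C - a^-1 *: (c *m b))) //.
  by rewrite mulmxBr -scalemxAr mulmxA addrC scaleNr.
pose s := (Num.sqrt a)^-1.
have ss : s * a * s = 1.
  rewrite /s -{2}(sqr_sqrtr (ltW a0)) expr2.
  have q0 : Num.sqrt a != 0 by rewrite sqrtr_eq0 -ltNge.
  by rewrite mulrA mulVf // mul1r divff.
exists (block_mx s%:M 0 (- a^-1 *: (A' *m c)) A').
rewrite {1}QE mulmx_block tr_block_mx !mul0mx !addr0 trmx0.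
have -> : - a^-1 *: (A' *m c) *m a%:M + A' *m c = 0.
  by rewrite mul_mx_scalar scalerA mulrN divff // scaleN1r addNr.
have -> : - a^-1 *: (A' *m c) *m b + A' *m C = A' *m (C - a^-1 *: (c *m b)).
  by rewrite mulmxBr -scalemxAr mulmxA -scalemxAl addrC scaleNr.
rewrite mulmx_block !mul0mx !mulmx0 !addr0 !add0r A'E.
have -> : s%:M *m a%:M *m (s%:M)^T = 1%:M :> 'M[R]_1.
  by rewrite tr_scalar_mx -!scalar_mxM ss.
have -> : s%:M *m a%:M *m (- a^-1 *: (A' *m c))^T + s%:M *m b *m A'^T = 0.
  rewrite linearZ /= trmx_mul -bE -scalar_mxM !mul_scalar_mx !scalerA -scalemxAl -scalerDl.
  by rewrite mulrN mulfK // addNr scale0r.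
by rewrite -scalar_mx_block.
Qed.

(** * The Webster metric *)

Section Metric.
Variables (R : realType) (n : nat) (M : cr_manifold R n).
Variables (theta : M -> ((M -> R) -> R) -> R) (T : M -> (M -> R) -> R).
Variable D : connection M.
Hypothesis S : tw_structure theta T D.
Local Notation tvec := ((M -> R) -> R).
Local Notation vfield := (M -> tvec).
Implicit Types (f h : M -> R) (x y : M) (u v w : tvec) (X Y Z : vfield).
Local Notation dth := (ext_deriv theta).
Local Notation G := (levi_form theta).
Local Notation g := (webster theta T).
Local Notation P := (proj_H theta T).
Local Notation JJ := (J theta T).
Local Notation tor := (torsion D).

Lemma G_linl x (a : R) u u' v : levi_distr x u -> levi_distr x u' -> levi_distr x v ->
  G x (a *: u + u') v = a * G x u v + G x u' v.
Proof.
move=> hu hu' hv; rewrite /levi_form (dth_linl S) //; try exact: levi_tangent.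
by apply: levi_tangent; exact: cr_J_levi.
Qed.

(** By J-invariance dtheta(u, Jv) = - dtheta(Ju, v) = dtheta(v, Ju). *)
Lemma G_sym x u v : levi_distr x u -> levi_distr x v -> G x u v = G x v u.
Proof.
move=> hu hv; rewrite /levi_form -(dth_JJ S hu (cr_J_levi hv)) cr_JJ //.
rewrite (dth_anti S); try by [apply: levi_tangent; exact: cr_J_levi|apply: tangentN; exact: levi_tangent].
have := dth_linl S (-1) (levi_tangent hv) (tangent0 x) (levi_tangent (cr_J_levi hu)).
have := dth_linl S (-1) (tangent0 x) (tangent0 x) (levi_tangent (cr_J_levi hu)).
rewrite scaler0 !addr0 scaleN1r => h1 ->; lra.
Qed.

Lemma G_JJ x u v : levi_distr x u -> levi_distr x v ->
  G x (cr_J x u) (cr_J x v) = G x u v.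
Proof. by move=> hu hv; rewrite /levi_form (dth_JJ S) //; exact: cr_J_levi. Qed.

Lemma g_lin x (a : R) u u' v : tangent x u -> tangent x u' -> tangent x v ->
  g x (a *: u + u') v = a * g x u v + g x u' v.
Proof.
move=> tu tu' tv; rewrite /webster (proj_lin S) // (theta_lin S) //.
by rewrite G_linl; try exact: (proj_levi S); ring.
Qed.

Lemma g_sym x u v : tangent x u -> tangent x v -> g x u v = g x v u.
Proof.
by move=> tu tv; rewrite /webster G_sym ?(mulrC (theta x u)) //; exact: proj_levi S _ _ _.
Qed.

Lemma g0l x v : tangent x v -> g x 0 v = 0.
Proof.
by move=> tv; have := g_lin (-1) (tangent0 x) (tangent0 x) tv; rewrite scaler0 addr0 => h; lra.
Qed.

Lemma gZl x (a : R) u v : tangent x u -> tangent x v -> g x (a *: u) v = a * g x u v.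
Proof. by move=> tu tv; have := g_lin a tu (tangent0 x) tv; rewrite addr0 g0l // addr0. Qed.

Lemma gZr x (a : R) u v : tangent x u -> tangent x v -> g x u (a *: v) = a * g x u v.
Proof. by move=> tu tv; rewrite g_sym ?gZl ?(g_sym tu) //; exact: tangentZ. Qed.

Lemma gDl x u u' v : tangent x u -> tangent x u' -> tangent x v ->
  g x (u + u') v = g x u v + g x u' v.
Proof. by move=> tu tu' tv; have := g_lin 1 tu tu' tv; rewrite scale1r mul1r. Qed.

Lemma gDr x u v v' : tangent x u -> tangent x v -> tangent x v' ->
  g x u (v + v') = g x u v + g x u v'.
Proof.
move=> tu tv tv'; rewrite g_sym //; last exact: tangentD.
by rewrite gDl // (g_sym tv) // (g_sym tv').
Qed.

Lemma gNl x u v : tangent x u -> tangent x v -> g x (- u) v = - g x u v.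
Proof. by move=> tu tv; rewrite -scaleN1r gZl // mulN1r. Qed.

Lemma gNr x u v : tangent x u -> tangent x v -> g x u (- v) = - g x u v.
Proof. by move=> tu tv; rewrite -scaleN1r gZr // mulN1r. Qed.

Lemma gBl x u u' v : tangent x u -> tangent x u' -> tangent x v ->
  g x (u - u') v = g x u v - g x u' v.
Proof. by move=> tu tu' tv; rewrite gDl ?gNl //; exact: tangentN. Qed.

Lemma gBr x u v v' : tangent x u -> tangent x v -> tangent x v' ->
  g x u (v - v') = g x u v - g x u v'.
Proof. by move=> tu tv tv'; rewrite gDr ?gNr //; exact: tangentN. Qed.

Lemma g_suml x I (r : seq I) (F : I -> tvec) v : (forall i, tangent x (F i)) ->
  tangent x v -> g x (\sum_(i <- r) F i) v = \sum_(i <- r) g x (F i) v.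
Proof.
move=> tF tv; elim: r => [|i r IH]; first by rewrite !big_nil g0l.
by rewrite !big_cons gDl ?IH //; exact: tangent_sum.
Qed.

Lemma g_sumr x I (r : seq I) (F : I -> tvec) v : (forall i, tangent x (F i)) ->
  tangent x v -> g x v (\sum_(i <- r) F i) = \sum_(i <- r) g x v (F i).
Proof.
move=> tF tv; rewrite g_sym //; last exact: tangent_sum.
by rewrite g_suml //; apply: eq_bigr => i _; rewrite g_sym.
Qed.

Lemma g_levi x u v : levi_distr x u -> levi_distr x v -> g x u v = G x u v.
Proof. by move=> hu hv; rewrite /webster !(proj_id S) // (theta0 S hu) mul0r addr0. Qed.

Lemma G0l x v : levi_distr x v -> G x 0 v = 0.
Proof.
by move=> hv; rewrite -g_levi ?g0l //; [exact: levi_tangent|exact: levi0].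
Qed.

Lemma gT x v : tangent x v -> g x (T x) v = theta x v.
Proof.
move=> tv; rewrite /webster (projT S) G0l ?(thetaT S) ?mul1r ?add0r //.
exact: (proj_levi S).
Qed.

Lemma gTr x v : tangent x v -> g x v (T x) = theta x v.
Proof. by move=> tv; rewrite g_sym ?gT //; exact: tangentT S x. Qed.

Lemma G_ge0 x u : levi_distr x u -> 0 <= G x u u.
Proof.
move=> hu; have [->|/eqP u0] := EM (u = 0); first by rewrite G0l //; exact: levi0.
by apply: ltW; apply: (tw_pos S) => // /eqP; rewrite (negbTE u0).
Qed.

Lemma g_eq0 x u : tangent x u -> g x u u = 0 -> u = 0.
Proof.
move=> tu; rewrite /webster -expr2 => /eqP; have hP := proj_levi S tu.
rewrite paddr_eq0 ?sqr_ge0 ?G_ge0 // sqrf_eq0 => /andP[/eqP e /eqP th].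
have P0 : P x u = 0.
  apply: contrapT => /(tw_pos S hP); by rewrite e ltxx.
by rewrite (projE theta T x u) P0 th scale0r addr0.
Qed.

Lemma g_ge0 x u : tangent x u -> 0 <= g x u u.
Proof. by move=> tu; rewrite addr_ge0 ?G_ge0 -?expr2 ?sqr_ge0 //; exact: (proj_levi S). Qed.

Lemma g_inj x u u' : tangent x u -> tangent x u' ->
  (forall w, tangent x w -> g x u w = g x u' w) -> u = u'.
Proof.
move=> tu tu' h; apply/eqP; rewrite -subr_eq0; apply/eqP.
have td := tangentB tu tu'; apply: (g_eq0 td).
by rewrite gBl // h // subrr.
Qed.

Lemma g_levi_proj x u v : levi_distr x u -> tangent x v -> g x u v = g x u (P x v).
Proof.
move=> hu tv; have hP := proj_levi S tv.
have tu := levi_tangent hu; have tT := tangentT S x.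
rewrite [in LHS](projE theta T x v) gDr //.
- by rewrite gZr ?gTr ?(theta0 S hu) ?mulr0 ?addr0.
- exact: levi_tangent.
- exact: tangentZ.
Qed.

Lemma g_levi_inj x u u' : levi_distr x u -> levi_distr x u' ->
  (forall w, levi_distr x w -> g x u w = g x u' w) -> u = u'.
Proof.
move=> hu hu' h; apply: (g_inj (levi_tangent hu) (levi_tangent hu')) => w tw.
by rewrite (g_levi_proj hu tw) (g_levi_proj hu' tw) h //; exact: (proj_levi S).
Qed.

Lemma gJ x u v : levi_distr x u -> levi_distr x v -> g x (JJ x u) v = - g x u (JJ x v).
Proof.
move=> hu hv; rewrite !(JE S) //.
have hJu := cr_J_levi hu; have hJv := cr_J_levi hv.
rewrite !g_levi // -(G_JJ hJu hv) cr_JJ //.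
by rewrite -g_levi ?gNl ?g_levi //; try exact: levi_tangent; exact: leviN.
Qed.

Lemma gJJ x u v : levi_distr x u -> levi_distr x v -> g x (JJ x u) (JJ x v) = g x u v.
Proof.
move=> hu hv; rewrite !(JE S) // !g_levi ?G_JJ //; exact: cr_J_levi.
Qed.

Lemma dthG x u v : levi_distr x u -> levi_distr x v -> dth x u v = - g x u (JJ x v).
Proof.
move=> hu hv; have hJ := cr_J_levi hv; rewrite (JE S) // g_levi // /levi_form cr_JJ //.
have := dth_linr S (-1) (levi_tangent hu) (levi_tangent hv) (tangent0 x).
have := dth_linr S (-1) (levi_tangent hu) (tangent0 x) (tangent0 x).
rewrite scaler0 !addr0 scaleN1r => h1 ->; lra.
Qed.

Lemma g_smooth X Y : is_vfield X -> is_vfield Y -> smooth (fun y => g y (X y) (Y y)).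
Proof.
move=> vX vY; have vPX := vfieldP S vX; have vJY := vfieldJ S vY.
have -> : (fun y => g y (X y) (Y y)) = fun y =>
   2^-1 * (P y (X y) (fun z => theta z (JJ z (Y z))) - JJ y (Y y) (fun z => theta z (P z (X z)))
          - theta y (bracket (fun z => P z (X z)) (fun z => JJ z (Y z)) y))
   + theta y (X y) * theta y (Y y).
  apply/funext => y; rewrite /webster /levi_form; congr (_ + _).
  exact: (dthetaE S y vPX vJY).
have tsm := theta_smooth S.
apply: smoothD; last by apply: smoothM; exact: tsm.
apply: smoothZ; apply: smoothB; last exact: (tsm _ (vfield_bracket vPX vJY)).
apply: smoothB; first exact: (vf_smooth vPX (tsm _ vJY)).
exact: (vf_smooth vJY (tsm _ vPX)).
Qed.

(** Differentiating g(T, T) = 1 removes the vertical part; differentiating g(T, X) = 0, with D X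
    horizontal, removes the horizontal part. *)
Lemma DT x u : tangent x u -> D x u T = 0.
Proof.
move=> tu; have vT := vfieldT S; have tT := tangentT S x; have tD := D_tangent S tu vT.
apply: (g_inj tD (tangent0 x)) => w tw; rewrite g0l // (projE theta T x w).
have hP := proj_levi S tw; have [X [vX <- hX]] := levi_ext S hP.
have tX := vf_tangent x vX.
rewrite gDr // ?gZr //; last exact: tangentZ.
have := D_metric S tu vT vT; have := D_metric S tu vT vX.
have -> : (fun y => g y (T y) (T y)) = fun=> 1.
  by apply/funext => y; rewrite gT ?(thetaT S) //; exact: tangentT S y.
have -> : (fun y => g y (T y) (X y)) = fun=> 0.
  by apply/funext => y; rewrite gT ?(theta0 S) //; exact: vf_tangent.
rewrite !(tv_cst tu) (gT (D_tangent S tu vX)) (theta0 S (D_levi S tu vX hX)) addr0 => <-.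
rewrite (g_sym tT tD) add0r => h; have -> : g x (D x u T) (T x) = 0 by lra.
by rewrite mulr0.
Qed.

(** For horizontal X, tau X = D_T X - [T, X] because T is parallel, and [T, X] is horizontal because
    T annihilates dtheta. *)
Lemma tau_levi x u : tangent x u -> levi_distr x (tor x (T x) u).
Proof.
move=> tu; have tT := tangentT S x.
rewrite (projE theta T x u); have hP := proj_levi S tu.
have tTT : tor x (T x) (T x) = 0.
  have := tor_anti S tT tT => /eqP; rewrite -subr_eq0 opprK -mulr2n -scaler_nat.
  by rewrite scaler_eq0 pnatr_eq0 /= => /eqP.
rewrite (tor_anti S) //; last by apply: tangentD; [exact: levi_tangent|exact: tangentZ].
rewrite addrC (tor_linl S) //; last exact: levi_tangent.
rewrite tTT scaler0 add0r -(tor_anti S) //; last exact: levi_tangent.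
have [X [vX <- hX]] := levi_ext S hP; have vT := vfieldT S; have tX := vf_tangent x vX.
have tt := tor_tangent S tT tX; apply/(theta_levi S tt).
rewrite (torsionE S) //.
have t1 := D_tangent S tT vX; have t2 := D_tangent S tX vT.
have tb := vf_tangent x (vfield_bracket vT vX).
rewrite (thetaB S (tangentB t1 t2) tb) (thetaB S t1 t2) (theta_bracketT S x vX hX).
by rewrite (theta0 S (D_levi S tT vX hX)) DT // (theta0 S (levi0 x)) !subr0.
Qed.

Lemma tau_J x u : tangent x u -> tor x (T x) (JJ x u) = - JJ x (tor x (T x) u).
Proof.
move=> tu; have [_ _ _ _ [_ _ h]] := tw_conn S.
by apply/eqP; rewrite -addr_eq0 h.
Qed.

Lemma orthonormal_levi_basis x : exists e : 'I_(n.*2) -> tvec,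
  levi_basis x e /\ forall i j, g x (e i) (e j) = (i == j)%:R.
Proof.
have [F [vr vj nF fF]] := local_frame S x.
have := real_frame_basis (nbhs_singleton nF).
set d := fun j => real_frame F j x => -[hd sp free].
have td j : tangent x (d j) by exact: levi_tangent.
pose Q : 'M[R]_(n.*2) := \matrix_(i, j) g x (d i) (d j).
have QE (a b : 'I_(n.*2) -> R) :
    g x (\sum_i a i *: d i) (\sum_j b j *: d j) = \sum_i \sum_j a i * b j * Q i j.
  have tb : tangent x (\sum_j b j *: d j) by apply: tangent_sum => j _; exact: tangentZ.
  rewrite g_suml //; last by move=> i; exact: tangentZ.
  apply: eq_bigr => i _; rewrite gZl // g_sumr //; last by move=> j; exact: tangentZ.
  by rewrite mulr_sumr; apply: eq_bigr => j _; rewrite gZr // mxE mulrA.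
have [||A AE] := @gram_schmidt R _ Q.
- by apply/matrixP => i j; rewrite !mxE g_sym.
- move=> w w0; set v := \sum_i w 0 i *: d i.
  have hv : levi_distr x v by apply: levi_sum => j _; exact: leviZ.
  have -> : (w *m Q *m w^T) 0 0 = g x v v.
    rewrite /v QE mxE exchange_big /=; apply: eq_bigr => i _.
    rewrite mxE mulr_suml; apply: eq_bigr => j _; rewrite !mxE; ring.
  rewrite g_levi //; apply: (tw_pos S) => // v0.
  move/eqP: w0; apply; apply/rowP => i; rewrite mxE; exact: (free _ v0).
exists (fun i => \sum_j A i j *: d j); split; last first.
  move=> i j; rewrite QE.
  have := congr1 (fun B : 'M[R]_(n.*2) => B i j) AE; rewrite !mxE => <-.
  rewrite exchange_big /=; apply: eq_bigr => k _.
  rewrite mxE mulr_suml; apply: eq_bigr => l _; rewrite !mxE; ring.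
have AQ : A \in unitmx by move: AE; rewrite -mulmxA => /mulmx1_unit[].
have swap (a : 'I_(n.*2) -> R) : \sum_i a i *: (\sum_j A i j *: d j) =
    \sum_j (\sum_i a i * A i j) *: d j.
  under eq_bigr do rewrite scaler_sumr; rewrite exchange_big /=.
  apply: eq_bigr => k _; rewrite scaler_suml; apply: eq_bigr => i _.
  by rewrite scalerA.
split.
- by move=> i; apply: levi_sum => j _; exact: leviZ.
- move=> v /sp[a ->]; exists (fun i => ((\row_j a j) *m invmx A) 0 i).
  rewrite swap; apply: eq_bigr => j _; congr (_ *: _).
  have := congr1 (fun r : 'rV[R]_(n.*2) => r 0 j) (mulmxKV AQ (\row_j a j)).
  by rewrite !mxE => <-; apply: eq_bigr => i _; rewrite mxE.
- move=> a; rewrite swap => /free az i.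
  have : (\row_j a j) *m A = 0.
    by apply/rowP => j; rewrite !mxE -[RHS](az j); apply: eq_bigr => k _; rewrite !mxE.
  move=> e; have := mulmxK AQ (\row_j a j); rewrite e mul0mx.
  by move=> /(congr1 (fun r : 'rV[R]_(n.*2) => r 0 i)); rewrite !mxE => <-.
Qed.

End Metric.

(** * The sublaplacian *)

Section Sublaplacian.
Variables (R : realType) (n : nat) (M : cr_manifold R n).
Variables (theta : M -> ((M -> R) -> R) -> R) (T : M -> (M -> R) -> R).
Variable D : connection M.
Hypothesis S : tw_structure theta T D.
Local Notation tvec := ((M -> R) -> R).
Local Notation vfield := (M -> tvec).
Implicit Types (f h : M -> R) (x y : M) (u v w : tvec) (X Y Z : vfield).
Local Notation g := (webster theta T).
Local Notation P := (proj_H theta T).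
Local Notation JJ := (J theta T).
Local Notation tor := (torsion D).

Definition levi_orthonormal x (e : 'I_(n.*2) -> tvec) : Prop :=
  levi_basis x e /\ forall i j, g x (e i) (e j) = (i == j)%:R.

Section Orthonormal.
Variables (x : M) (e : 'I_(n.*2) -> tvec).
Hypothesis oe : levi_orthonormal x e.

Lemma orth_levi i : levi_distr x (e i).
Proof. by have [[h _ _] _] := oe. Qed.

Lemma orth_tangent i : tangent x (e i).
Proof. exact/levi_tangent/orth_levi. Qed.

Lemma orth_expand_levi v : levi_distr x v -> v = \sum_i g x v (e i) *: e i.
Proof.
move=> hv; have [[_ sp _] oee] := oe; have [a aE] := sp v hv.
rewrite {1}aE; apply: eq_bigr => i _; congr (_ *: _).
rewrite aE (g_suml S); [|by move=> j; apply: tangentZ; exact: orth_tangent|exact: orth_tangent].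
rewrite (bigD1 i) //= (gZl S _ (orth_tangent i) (orth_tangent i)) oee eqxx mulr1.
rewrite big1 ?addr0 // => j /negbTE ji.
by rewrite (gZl S _ (orth_tangent j) (orth_tangent i)) oee ji mulr0.
Qed.

Lemma orth_expand v : tangent x v ->
  v = \sum_i g x v (e i) *: e i + theta x v *: T x.
Proof.
move=> tv; rewrite {1}(projE theta T x v); congr (_ + _).
rewrite {1}(orth_expand_levi (proj_levi S tv)); apply: eq_bigr => i _; congr (_ *: _).
have ti := orth_tangent i; have tP := levi_tangent (proj_levi S tv).
rewrite (g_sym S tP ti) -(g_levi_proj S (orth_levi i) tv); exact: (g_sym S).
Qed.

Lemma orth_parseval u v : levi_distr x u -> levi_distr x v ->
  g x u v = \sum_i g x u (e i) * g x v (e i).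
Proof.
move=> hu hv; have tu := levi_tangent hu.
rewrite {1}(orth_expand_levi hv) (g_sumr S) //; last first.
  by move=> i; apply: tangentZ; exact: orth_tangent.
by apply: eq_bigr => i _; rewrite (gZr S _ tu (orth_tangent i)) mulrC.
Qed.

Lemma orth_basis : is_basis x (extend_basis e (T x)).
Proof. by apply: (levi_basis_basis S); case: oe. Qed.

Lemma trace_orth (L : tvec -> tvec) :
  (forall a u v, tangent x u -> tangent x v -> L (a *: u + v) = a *: L u + L v) ->
  (forall u, tangent x u -> tangent x (L u)) ->
  trace_at x L = \sum_i g x (L (e i)) (e i) + theta x (L (T x)).
Proof.
move=> Ll Lt; pose b := extend_basis e (T x).
have tb j : tangent x (b j) by case: orth_basis.
rewrite (trace_atE (e := b) (A := \matrix_(i, j)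
  extend_basis (fun k => g x (L (b j)) (e k)) (theta x (L (b j))) i) Ll orth_basis).
  rewrite /mxtrace sum_ord_max !mxE extend_basis_max /b extend_basis_max.
  by congr (_ + _); apply: eq_bigr => i _; rewrite mxE !extend_basis_lift.
move=> j; rewrite {1}(orth_expand (Lt _ (tb j))) sum_ord_max !mxE.
rewrite /b !extend_basis_max; congr (_ + _); apply: eq_bigr => i _.
by rewrite mxE !extend_basis_lift.
Qed.

Lemma orthJ : levi_orthonormal x (fun i => JJ x (e i)).
Proof.
have [[_ _ free] oee] := oe.
have hJ i : levi_distr x (JJ x (e i)) by exact: (J_levi S (orth_tangent i)).
split; last by move=> i j; rewrite (gJJ S) //; exact: orth_levi.
have Jsum (a : 'I_(n.*2) -> R) (d : 'I_(n.*2) -> tvec) (r : seq 'I_(n.*2)) :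
    (forall i, tangent x (d i)) ->
    JJ x (\sum_(i <- r) a i *: d i) = \sum_(i <- r) a i *: JJ x (d i).
  move=> td; elim: r => [|i r IH].
    by rewrite !big_nil /J /proj_H (theta0 S (levi0 x)) scale0r subrr cr_J0.
  rewrite !big_cons (J_lin S) ?IH //; apply: tangent_sum => k _; exact: tangentZ.
split=> //.
- move=> v hv; have hJv := J_levi S (levi_tangent hv).
  exists (fun i => - g x (JJ x v) (e i)).
  under eq_bigr do rewrite scaleNr.
  rewrite sumrN -Jsum; last by exact: orth_tangent.
  by rewrite -(orth_expand_levi hJv) (JJE S) // opprK.
- move=> a e0; apply: free.
  have hs : levi_distr x (\sum_j a j *: e j).
    by apply: levi_sum => j _; apply: leviZ; exact: orth_levi.
  apply/eqP; rewrite -oppr_eq0 -(JJE S hs) Jsum ?e0; last exact: orth_tangent.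
  by rewrite /J /proj_H (theta0 S (levi0 x)) scale0r subrr cr_J0.
Qed.

End Orthonormal.

Lemma orthonormal_exists x : exists e, levi_orthonormal x e.
Proof. exact: (orthonormal_levi_basis S). Qed.

Lemma gradE x h v : smooth h -> tangent x v ->
  tangent x (gradient g h x) /\ g x (gradient g h x) v = v h.
Proof.
move=> sh; move: v; suff : tangent x (gradient g h x) /\
    forall v, tangent x v -> g x (gradient g h x) v = v h.
  by move=> [t gE] v tv; split=> //; exact: gE.
have [e oe] := orthonormal_exists x; have te := orth_tangent oe.
pose q := \sum_i (e i) h *: e i + T x h *: T x.
have tT := tangentT S x.
have tq1 : tangent x (\sum_i (e i) h *: e i) by apply: tangent_sum => i _; exact: tangentZ.
have tq : tangent x q by apply: tangentD => //; exact: tangentZ.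
have qE w : tangent x w -> g x q w = w h.
  move=> tw; rewrite [in RHS](orth_expand oe tw) /q (gDl S) //; last exact: tangentZ.
  rewrite (gZl S) // (gT S) // (g_suml S) //; last by move=> i; exact: tangentZ.
  rewrite !tvecE sum_tvec mulrC; congr (_ + _); apply: eq_bigr => i _.
  by rewrite (gZl S) // tvecE mulrC (g_sym S (te i)).
suff -> : gradient g h x = q by [].
apply: xget_eq; first by [].
by move=> p [tp pE]; apply: (g_inj S tp tq) => w tw; rewrite pE // qE.
Qed.

Lemma grad_tangent x h : smooth h -> tangent x (gradient g h x).
Proof. by move=> sh; have [] := gradE sh (tangent0 x). Qed.

(** The gradient is picked pointwise; near x its coefficients are the inverse Gram matrix of a frame
    applied to the derivatives of h. *)
Lemma grad_vf h : smooth h -> is_vfield (gradient g h).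
Proof.
move=> sh; apply: vfield_near => [x|x]; first exact: grad_tangent.
have [E fE] := frames S x; have [vE bE] := fE.
have [Y [sY had _ _]] := coordinates x.
have [B [sB EE _ _]] := frame_coef fE sY had.
pose Q y : 'M[R]_(n.*2.+1) := \matrix_(i, j) g y (E i y) (E j y).
have sQ i j : smooth (fun y => Q y i j).
  by under eq_fun do rewrite mxE; exact: (g_smooth S).
have tE y i : tangent y (E i y) by exact: vf_tangent.
have D0 : \det (Q x) != 0.
  apply/negP => /det0P[a a0 aQ]; have [_ _ /(_ (fun i => a 0 i)) free] := bE.
  have ts : tangent x (\sum_i a 0 i *: E i x) by apply: tangent_sum => i _; exact: tangentZ.
  have : \sum_i a 0 i *: E i x = 0.
    apply: (g_eq0 S ts); rewrite (g_sumr S) //; last by move=> i; exact: tangentZ.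
    rewrite big1 // => j _; rewrite (gZr S) // (g_suml S) //; last by move=> i; exact: tangentZ.
    have := congr1 (fun r : 'rV[R]_(n.*2.+1) => r 0 j) aQ; rewrite !mxE => e0.
    rewrite (_ : \sum_i _ = 0) ?mulr0 // -[RHS]e0; apply: eq_bigr => i _.
    by rewrite (gZl S) // mxE.
  move=> /free az; move/eqP: a0; apply; apply/rowP => i; rewrite mxE; exact: az.
have [d [sd dD]] := smooth_inv_near (smooth_det sQ) D0.
pose k i y := \sum_j (d y * (\adj (Q y)) i j) * E j y h.
have sk i : smooth (k i).
  apply: smooth_sum => j _; apply: smoothM; last exact: vf_smooth.
  by apply: smoothM => //; exact: smooth_adj.
exists (fun y => \sum_i k i y *: E i y); split.
  by apply: vfield_sum => i _; exact: vfieldM.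
apply: filterS2 EE dD => y Ey dy.
have ts : tangent y (\sum_i k i y *: E i y) by apply: tangent_sum => i _; exact: tangentZ.
apply: (g_inj S (grad_tangent y sh) ts) => w tw.
have [_ ->] := gradE sh tw; rewrite (Ey w tw).
rewrite sum_tvec (g_sumr S) //; last by move=> i; exact: tangentZ.
apply: eq_bigr => l _; rewrite (gZr S) // tvecE; congr (_ * _).
rewrite (g_suml S) //; last by move=> i; exact: tangentZ.
have QA : Q y *m (d y *: \adj (Q y)) = 1%:M.
  by rewrite -scalemxAr mul_mx_adj scale_scalar_mx dy.
transitivity ((Q y *m (d y *: \adj (Q y)) *m \col_j E j y h) l 0).
  by rewrite QA mul1mx mxE.
rewrite -mulmxA mxE; apply: eq_bigr => i _; rewrite (gZl S) // [RHS]mulrC.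
congr (_ * _); first by rewrite mxE (g_sym S).
by rewrite mxE; apply: eq_bigr => j _; rewrite !mxE.
Qed.

Definition hgrad h : vfield := fun x => P x (gradient g h x).

Lemma hgrad_vf h : smooth h -> is_vfield (hgrad h).
Proof. by move=> sh; apply: (vfieldP S); exact: grad_vf. Qed.

Lemma hgrad_levi h x : smooth h -> levi_distr x (hgrad h x).
Proof. by move=> sh; apply: (proj_levi S); exact: grad_tangent. Qed.

Lemma hgradE h x u : smooth h -> levi_distr x u -> g x (hgrad h x) u = u h.
Proof.
move=> sh hu; have tu := levi_tangent hu; have tg := grad_tangent x sh.
have [_ <-] := gradE sh tu.
rewrite (g_sym S tg tu) (g_levi_proj S hu tg); apply: (g_sym S) => //.
exact/levi_tangent/hgrad_levi.
Qed.

(** The sublaplacian through the Tanaka-Webster connection; [Lap_LC] identifies it with the given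
    one. *)
Definition Lap h x : R := trace_at x (fun v => D x v (hgrad h)).

Lemma Lap_orth h x e : smooth h -> levi_orthonormal x e ->
  Lap h x = \sum_i g x (D x (e i) (hgrad h)) (e i).
Proof.
move=> sh oe; have vh := hgrad_vf sh; rewrite /Lap (trace_orth oe).
- rewrite (theta0 S) ?addr0 //; apply: (D_levi S) => //; first exact: tangentT S x.
  by move=> y; exact: hgrad_levi.
- by move=> a u v tu tv; exact: (D_lin S).
- by move=> u tu; exact: (D_tangent S).
Qed.

(** A form with derivatives of h only, from which the product rules and the sign at a local maximum
    are read off. The E i need to be orthonormal only at x. *)
Lemma Lap_second h x e (E : 'I_(n.*2) -> vfield) : smooth h -> levi_orthonormal x e ->
  (forall i, is_vfield (E i)) -> (forall i, E i x = e i) ->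
  (forall i y, levi_distr y (E i y)) ->
  Lap h x = \sum_i (E i x (fun y => E i y h) - D x (E i x) (E i) h).
Proof.
move=> sh oe vE Ee hE; rewrite (Lap_orth sh oe); apply: eq_bigr => i _.
have tE := vf_tangent x (vE i); have vh := hgrad_vf sh.
have := D_metric S tE vh (vE i).
have -> : (fun y => g y (hgrad h y) (E i y)) = fun y => E i y h.
  by apply/funext => y; exact: hgradE.
rewrite Ee => ->; rewrite (hgradE (u := D x (e i) (E i)) sh) ?addrK //.
by rewrite -Ee; apply: (D_levi S).
Qed.

Lemma orth_fields x e : levi_orthonormal x e -> exists E : 'I_(n.*2) -> vfield,
  [/\ forall i, is_vfield (E i), forall i, E i x = e i &
      forall i y, levi_distr y (E i y)].
Proof.
move=> oe; have /choice[E EP] : forall i, exists X, [/\ is_vfield X, X x = e i &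
    forall y, levi_distr y (X y)].
  by move=> i; apply: (levi_ext S); exact: orth_levi.
by exists E; split=> i; have [] := EP i.
Qed.

Lemma Lap_local_max h x : smooth h -> (\forall y \near x, h y <= h x) -> Lap h x <= 0.
Proof.
move=> sh mx; have [e oe] := orthonormal_exists x.
have [E [vE Ee hE]] := orth_fields oe.
rewrite (Lap_second sh oe vE Ee hE); have [d1 d2] := local_max_derivatives sh mx.
apply: sumr_le0 => i _; rewrite (d1 (D x (E i x) (E i))) ?subr0; first exact: d2.
by apply: (D_tangent S) => //; exact: vf_tangent.
Qed.

Lemma LapD h1 h2 x : smooth h1 -> smooth h2 ->
  Lap (fun y => h1 y + h2 y) x = Lap h1 x + Lap h2 x.
Proof.
move=> s1 s2; have [e oe] := orthonormal_exists x.
have [E [vE Ee hE]] := orth_fields oe.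
rewrite !(Lap_second _ oe vE Ee hE) //; last exact: smoothD.
rewrite -big_split /=; apply: eq_bigr => i _; have tE y := vf_tangent y (vE i).
have -> : (fun y => E i y (fun z => h1 z + h2 z)) = fun y => E i y h1 + E i y h2.
  by apply/funext => y; rewrite (tvD (tE y)).
rewrite (tvD (tE x)); try exact: vf_smooth.
by rewrite (tvD (D_tangent S (tE x) (vE i))) //; ring.
Qed.

Lemma LapZ (a : R) h x : smooth h -> Lap (fun y => a * h y) x = a * Lap h x.
Proof.
move=> sh; have [e oe] := orthonormal_exists x.
have [E [vE Ee hE]] := orth_fields oe.
rewrite !(Lap_second _ oe vE Ee hE) //; last exact: smoothZ.
rewrite mulr_sumr; apply: eq_bigr => i _; have tE y := vf_tangent y (vE i).
have -> : (fun y => E i y (fun z => a * h z)) = fun y => a * E i y h.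
  by apply/funext => y; rewrite (tvZ (tE y)).
rewrite (tvZ (tE x)); last exact: vf_smooth.
by rewrite (tvZ (D_tangent S (tE x) (vE i))) //; ring.
Qed.

Lemma Lap_sqr h x e : smooth h -> levi_orthonormal x e ->
  Lap (fun y => h y * h y) x = 2 * h x * Lap h x + 2 * \sum_i (e i h) ^+ 2.
Proof.
move=> sh oe; have [E [vE Ee hE]] := orth_fields oe.
rewrite !(Lap_second _ oe vE Ee hE) //; last exact: smoothM.
rewrite !mulr_sumr -big_split /=; apply: eq_bigr => i _; have tE y := vf_tangent y (vE i).
have -> : (fun y => E i y (fun z => h z * h z)) = fun y => E i y h * h y + h y * E i y h.
  by apply/funext => y; rewrite (tvM (tE y)).
have sE := vf_smooth (vE i) sh.
rewrite (tvD (tE x)); try exact: smoothM.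
rewrite !(tvM (tE x)) // (tvM (D_tangent S (tE x) (vE i))) // Ee; ring.
Qed.

(** For a metric connection g(D_X Z, X) is determined by g, the bracket [X, Z] and g(Tor(X, Z), X).
    The last term vanishes for X = e_i, where the torsion is vertical, and for X = T, where it is
    horizontal. *)
Lemma Lap_LC (LC : connection M) h x : is_levi_civita g LC -> smooth h ->
  sublaplacian theta T LC h x = Lap h x.
Proof.
move=> [Lconn Lmet Ltor] sh; have [e oe] := orthonormal_exists x.
have vh := hgrad_vf sh; have th := vf_tangent x vh.
have Llin a u v : tangent x u -> tangent x v ->
    LC x (a *: u + v) (hgrad h) = a *: LC x u (hgrad h) + LC x v (hgrad h).
  by case: Lconn => _ + _ _ => H tu tv; exact: H.
have LT X Y : is_vfield X -> is_vfield Y -> tangent x (LC x (X x) Y).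
  by move=> vX vY; case: Lconn => + _ _ _ => H; exact: (vf_tangent x (H X Y vX vY)).
rewrite /sublaplacian /divergence -/(hgrad h) /Lap !(trace_orth oe) //; last first.
- by move=> u /(vf_ext S)[X [vX <-]]; exact: LT.
- by move=> u tu; exact: (D_tangent S).
- by move=> a u v tu tv; exact: (D_lin S).
suff key v : tangent x v -> g x (tor x v (hgrad h x)) v = 0 ->
    g x (LC x v (hgrad h)) v = g x (D x v (hgrad h)) v.
  have tT := tangentT S x; congr (_ + _).
    apply: eq_bigr => i _; have hi := orth_levi oe i; apply: key; first exact: orth_tangent oe i.
    rewrite (torsion_levi S hi (hgrad_levi x sh)) (gZl S) ?(gT S) ?(theta0 S hi) ?mulr0 //;
      exact: levi_tangent.
  have tL : tangent x (LC x (T x) (hgrad h)) by apply: LT => //; exact: vfieldT S.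
  rewrite -(gTr S tL) -(gTr S (D_tangent S tT vh)); apply: key => //.
  by rewrite (gTr S (tor_tangent S tT th)) (theta0 S (tau_levi S th)).
move=> /(vf_ext S)[X [vX <-]]; have tX := vf_tangent x vX.
have tb := vf_tangent x (vfield_bracket vX vh).
have e1 := Ltor x _ _ tX th.
rewrite (connection_torsionE (frames S) Lconn x vX vh) in e1.
have e2 := torsionE S x vX vh.
have m1 := Lmet x _ _ _ th vX vX; have m2 := D_metric S th vX vX.
have tL1 := LT _ _ vX vh; have tL2 := LT _ _ vh vX.
have tD1 := D_tangent S tX vh; have tD2 := D_tangent S th vX.
rewrite e2 (gBl S (tangentB tD1 tD2) tb tX) (gBl S tD1 tD2 tX).
have : g x (LC x (X x) (hgrad h) - LC x (hgrad h x) X - bracket X (hgrad h) x) (X x) = 0.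
  by rewrite e1 (g0l S).
rewrite (gBl S (tangentB tL1 tL2) tb tX) (gBl S tL1 tL2 tX).
move: m1; rewrite m2 (g_sym S tX tD2) (g_sym S tX tL2).
move: (g x _ _) (g x _ _) (g x _ _) (g x _ _) (g x _ _) => a1 a2 a3 a4 a5; lra.
Qed.

End Sublaplacian.

(** * Curvature *)

Section Curvature.
Variables (R : realType) (n : nat) (M : cr_manifold R n).
Variables (theta : M -> ((M -> R) -> R) -> R) (T : M -> (M -> R) -> R).
Variable D : connection M.
Hypothesis S : tw_structure theta T D.
Local Notation tvec := ((M -> R) -> R).
Local Notation vfield := (M -> tvec).
Implicit Types (f h : M -> R) (x y : M) (u v w : tvec) (X Y Z : vfield).
Local Notation dth := (ext_deriv theta).
Local Notation g := (webster theta T).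
Local Notation P := (proj_H theta T).
Local Notation JJ := (J theta T).
Local Notation tor := (torsion D).
Local Notation curv := (curvature D).

Lemma D0l x Y : is_vfield Y -> D x 0 Y = 0.
Proof.
move=> vY; have := D_lin S (-1) (tangent0 x) (tangent0 x) vY.
by rewrite scaler0 addr0 scaleN1r addNr.
Qed.

Lemma DZl x (a : R) u Y : tangent x u -> is_vfield Y -> D x (a *: u) Y = a *: D x u Y.
Proof. by move=> tu vY; have := D_lin S a tu (tangent0 x) vY; rewrite D0l // !addr0. Qed.

Lemma DDl x u v Y : tangent x u -> tangent x v -> is_vfield Y ->
  D x (u + v) Y = D x u Y + D x v Y.
Proof. by move=> tu tv vY; have := D_lin S 1 tu tv vY; rewrite !scale1r. Qed.

Lemma DNl x u Y : tangent x u -> is_vfield Y -> D x (- u) Y = - D x u Y.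
Proof. by move=> tu vY; rewrite -scaleN1r DZl // scaleN1r. Qed.

Lemma DBl x u v Y : tangent x u -> tangent x v -> is_vfield Y ->
  D x (u - v) Y = D x u Y - D x v Y.
Proof. by move=> tu tv vY; rewrite DDl ?DNl //; exact: tangentN. Qed.

Lemma DNr x u Y : tangent x u -> is_vfield Y -> D x u (fun y => - Y y) = - D x u Y.
Proof.
move=> tu vY; have := DM S tu (@smooth_cst _ _ M (-1)) vY.
rewrite (tv_cst tu) scale0r add0r scaleN1r => <-; congr (D x u _).
by apply/funext => y; rewrite scaleN1r.
Qed.

Lemma DBr x u Y Z : tangent x u -> is_vfield Y -> is_vfield Z ->
  D x u (fun y => Y y - Z y) = D x u Y - D x u Z.
Proof. by move=> tu vY vZ; rewrite (DD S) ?DNr //; exact: vfieldN. Qed.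

(** The curvature before evaluation on vectors, so that it can be manipulated as an operator on
    fields; [curvatureE] returns to the tensor. *)
Definition curvature_field X Y Z : vfield := fun x =>
  D x (X x) (fun y => D y (Y y) Z) - D x (Y x) (fun y => D y (X y) Z)
  - D x (bracket X Y x) Z.

Lemma curvf_vf X Y Z : is_vfield X -> is_vfield Y -> is_vfield Z ->
  is_vfield (curvature_field X Y Z).
Proof.
move=> vX vY vZ; apply: vfieldB; last by apply: (D_vf S) => //; exact: vfield_bracket.
by apply: vfieldB; apply: (D_vf S) => //; exact: (D_vf S).
Qed.

Lemma curvf_anti X Y Z x : is_vfield X -> is_vfield Y -> is_vfield Z ->
  curvature_field X Y Z x = - curvature_field Y X Z x.
Proof.
move=> vX vY vZ; rewrite /curvature_field [in RHS]bracketN DNl //; last exact/vf_tangent/vfield_bracket.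
tvec_ring.
Qed.

Lemma curvatureE x X Y Z : is_vfield X -> is_vfield Y -> is_vfield Z ->
  curv x (X x) (Y x) (Z x) = curvature_field X Y Z x.
Proof.
have t1 X1 X2 Y1 Z1 : is_vfield X1 -> is_vfield X2 -> is_vfield Y1 -> is_vfield Z1 ->
    X1 x = X2 x -> curvature_field X1 Y1 Z1 x = curvature_field X2 Y1 Z1 x.
  move=> v1 v2 vY vZ e.
  apply: (tensorial (frames S) (T := fun X => curvature_field X Y1 Z1 x) (x := x)) => //.
    move=> X3 X4 v3 v4; rewrite /curvature_field bracketDl //.
    have t3 y := vf_tangent y v3; have t4 y := vf_tangent y v4.
    have -> : (fun y => D y (X3 y + X4 y) Z1) = fun y => D y (X3 y) Z1 + D y (X4 y) Z1.
      by apply/funext => y; rewrite DDl.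
    rewrite (DD S (vf_tangent x vY)); try exact: (D_vf S).
    have tb3 := vf_tangent x (vfield_bracket v3 vY).
    have tb4 := vf_tangent x (vfield_bracket v4 vY).
    rewrite (DDl tb3 tb4 vZ) (DDl (t3 x) (t4 x) (D_vf S vY vZ)).
    tvec_ring.
  move=> h X3 sh v3; have t3 y := vf_tangent y v3; rewrite /curvature_field bracketMl //.
  have tb := vf_tangent x (vfield_bracket v3 vY).
  have -> : (fun y => D y (h y *: X3 y) Z1) = fun y => h y *: D y (X3 y) Z1.
    by apply/funext => y; rewrite DZl.
  rewrite (DM S (vf_tangent x vY)) //; last exact: (D_vf S).
  rewrite (DBl (tangentZ _ tb) (tangentZ _ (t3 x))) // !DZl //; last exact: (D_vf S).
  tvec_ring.
have t3 X1 Y1 Z1 Z2 : is_vfield X1 -> is_vfield Y1 -> is_vfield Z1 -> is_vfield Z2 ->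
    Z1 x = Z2 x -> curvature_field X1 Y1 Z1 x = curvature_field X1 Y1 Z2 x.
  move=> v1 v2 vZ vZ' e.
  have tX y := vf_tangent y v1; have tY y := vf_tangent y v2.
  have tb := vf_tangent x (vfield_bracket v1 v2).
  apply: (tensorial (frames S) (T := fun Z => curvature_field X1 Y1 Z x) (x := x)) => //.
    move=> X3 X4 v3 v4; rewrite /curvature_field.
    have e1 W : (forall y, tangent y (W y)) -> (fun y => D y (W y) (fun z => X3 z + X4 z)) =
        fun y => D y (W y) X3 + D y (W y) X4.
      by move=> tW; apply/funext => y; rewrite (DD S).
    rewrite !e1 // !(DD S) //; try exact: (D_vf S).
    tvec_ring.
  move=> h X3 sh v3; rewrite /curvature_field.
  have e1 W : (forall y, tangent y (W y)) -> (fun y => D y (W y) (fun z => h z *: X3 z)) =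
      fun y => W y h *: X3 y + h y *: D y (W y) X3.
    by move=> tW; apply/funext => y; rewrite (DM S).
  have sX := vf_smooth v1 sh; have sY := vf_smooth v2 sh.
  have vDX := D_vf S v1 v3; have vDY := D_vf S v2 v3.
  rewrite !e1 // !(DD S (tX x)) ?(DD S (tY x)); try exact: vfieldM.
  rewrite !(DM S (tX x)) // !(DM S (tY x)) // (DM S tb) // /bracket.
  tvec_ring.
move=> vX vY vZ; apply: (ext3E (A := (tvec : lmodType R)) (B := fun X Y Z => curvature_field X Y Z x)) => //.
move=> X1 Y1 Y2 Z1 v1 v2 v3 v4 e.
by rewrite curvf_anti // [RHS]curvf_anti // (t1 Y1 Y2).
Qed.

Lemma curvf_levi X Y Z x : is_vfield X -> is_vfield Y -> is_vfield Z ->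
  (forall y, levi_distr y (Z y)) -> levi_distr x (curvature_field X Y Z x).
Proof.
move=> vX vY vZ hZ.
have hD W y : is_vfield W -> levi_distr y (D y (W y) Z).
  by move=> vW; apply: (D_levi S) => //; exact: vf_tangent.
apply: leviB; last by apply: (D_levi S) => //; exact/vf_tangent/vfield_bracket.
by apply: leviB; apply: (D_levi S); try exact: vf_tangent; try exact: (D_vf S);
  move=> y; exact: hD.
Qed.

Lemma curvf_skew X Y Z W x : is_vfield X -> is_vfield Y -> is_vfield Z -> is_vfield W ->
  g x (curvature_field X Y Z x) (W x) = - g x (Z x) (curvature_field X Y W x).
Proof.
move=> vX vY vZ vW.
have tX := vf_tangent x vX; have tY := vf_tangent x vY.
have vb := vfield_bracket vX vY; have tb := vf_tangent x vb.
have m A V1 V2 : is_vfield A -> is_vfield V1 -> is_vfield V2 ->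
   (fun y => A y (fun z => g z (V1 z) (V2 z))) =
   fun y => g y (D y (A y) V1) (V2 y) + g y (V1 y) (D y (A y) V2).
  by move=> vA v1 v2; apply/funext => y; exact: (D_metric S (vf_tangent y vA) v1 v2).
have E A B : is_vfield A -> is_vfield B ->
    A x (fun y => B y (fun z => g z (Z z) (W z))) =
    g x (D x (A x) (fun y => D y (B y) Z)) (W x) + g x (D x (B x) Z) (D x (A x) W)
    + (g x (D x (A x) Z) (D x (B x) W) + g x (Z x) (D x (A x) (fun y => D y (B y) W))).
  move=> vA vB; have tA := vf_tangent x vA.
  have vBZ := D_vf S vB vZ; have vBW := D_vf S vB vW.
  have s1 := g_smooth S vBZ vW; have s2 := g_smooth S vZ vBW.
  by rewrite m // (tvD tA s1 s2) (D_metric S tA vBZ vW) (D_metric S tA vZ vBW).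
have eb : bracket X Y x (fun z => g z (Z z) (W z)) =
    X x (fun y => Y y (fun z => g z (Z z) (W z))) -
    Y x (fun y => X y (fun z => g z (Z z) (W z))) by [].
rewrite (D_metric S tb) // !E // in eb.
have vf A B : is_vfield A -> is_vfield B -> tangent x (D x (A x) B).
  by move=> vA vB; exact: (vf_tangent x (D_vf S vA vB)).
have tZ := vf_tangent x vZ; have tW := vf_tangent x vW.
have vXZ := D_vf S vX vZ; have vYZ := D_vf S vY vZ.
have vXW := D_vf S vX vW; have vYW := D_vf S vY vW.
have t1 := vf _ _ vX vYZ; have t2 := vf _ _ vY vXZ; have t3 := vf _ _ vb vZ.
have t4 := vf _ _ vX vYW; have t5 := vf _ _ vY vXW; have t6 := vf _ _ vb vW.
rewrite /curvature_field (gBl S (tangentB t1 t2) t3 tW) (gBl S t1 t2 tW).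
rewrite (gBr S tZ (tangentB t4 t5) t6) (gBr S tZ t4 t5).
move: eb; rewrite [g x (D x (Y x) Z) _]addrC; lra.
Qed.

Lemma curvf_J X Y Z x : is_vfield X -> is_vfield Y -> is_vfield Z ->
  curvature_field X Y (fun y => JJ y (Z y)) x = JJ x (curvature_field X Y Z x).
Proof.
move=> vX vY vZ; have vb := vfield_bracket vX vY.
have e A : is_vfield A -> (fun y => D y (A y) (fun z => JJ z (Z z))) =
    fun y => JJ y (D y (A y) Z).
  by move=> vA; apply/funext => y; exact: (D_J S (vf_tangent y vA) vZ).
have vXZ := D_vf S vX vZ; have vYZ := D_vf S vY vZ.
have tX := vf_tangent x vX; have tY := vf_tangent x vY; have tb := vf_tangent x vb.
rewrite /curvature_field !e // !(D_J S) //.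
have t1 := D_tangent S tX vYZ; have t2 := D_tangent S tY vXZ; have t3 := D_tangent S tb vZ.
have JB a b : tangent x a -> tangent x b -> JJ x (a - b) = JJ x a - JJ x b.
  move=> ta tb'; have := J_lin S (-1) tb' ta; rewrite !scaleN1r [- b + a]addrC => ->.
  by rewrite addrC.
by rewrite !JB //; exact: tangentB.
Qed.

(** First Bianchi identity with torsion. Testing against a horizontal w discards all multiples of T,
    so only the tau terms created by the vertical parts of brackets remain. *)
Lemma bianchi X Y Z x w : is_vfield X -> is_vfield Y -> is_vfield Z ->
  (forall y, levi_distr y (X y)) -> (forall y, levi_distr y (Y y)) ->
  (forall y, levi_distr y (Z y)) -> levi_distr x w ->
  g x (curvature_field X Y Z x) w + g x (curvature_field Y Z X x) w + g x (curvature_field Z X Y x) w =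
  2 * (dth x (X x) (Y x) * g x (tor x (T x) (Z x)) w
     + dth x (Y x) (Z x) * g x (tor x (T x) (X x)) w
     + dth x (Z x) (X x) * g x (tor x (T x) (Y x)) w).
Proof.
move=> vX vY vZ hX hY hZ hw; have tw := levi_tangent hw.
have tT := tangentT S x; have vT := vfieldT S.
(* Vertical torsion means that the antisymmetrized derivative is the horizontal part of the
   bracket. *)
have comm A B y : is_vfield A -> is_vfield B ->
    (forall z, levi_distr z (A z)) -> (forall z, levi_distr z (B z)) ->
    D y (A y) B - D y (B y) A =
    bracket A B y - theta y (bracket A B y) *: T y.
  move=> vA vB hA hB; have := torsionE S y vA vB.
  rewrite (torsion_levi S (hA y) (hB y)) (dth_levi S y vA vB hA hB) => e.
  apply/eqP; rewrite -subr_eq0; apply/eqP.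
  transitivity (D y (A y) B - D y (B y) A - bracket A B y - 2 * dth y (A y) (B y) *: T y).
    tvec_ring.
  by rewrite -e subrr.
(* The multiple a of T is left unspecified, since w is horizontal; the double brackets will cancel
   by Jacobi. *)
have key A B C : is_vfield A -> is_vfield B -> is_vfield C ->
    (forall z, levi_distr z (A z)) -> (forall z, levi_distr z (B z)) ->
    (forall z, levi_distr z (C z)) ->
    exists a : R, D x (A x) (fun y => D y (B y) C) - D x (A x) (fun y => D y (C y) B)
      - D x (bracket B C x) A = bracket A (bracket B C) x + a *: T x
        + (2 * dth x (B x) (C x)) *: tor x (T x) (A x).
  move=> vA vB vC hA hB hC; have tA := vf_tangent x vA.
  have vb := vfield_bracket vB vC; have tb := vf_tangent x vb.
  have st := theta_smooth S vb; have vsT := vfieldM st vT.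
  rewrite -(DBr tA (D_vf S vB vC) (D_vf S vC vB)).
  rewrite (_ : (fun y => _) = fun y => bracket B C y - theta y (bracket B C y) *: T y);
    last by apply/funext => y; exact: comm.
  rewrite (DBr tA vb vsT) (DM S tA st vT) (DT S tA) scaler0 addr0.
  have := torsionE S x vA vb.
  rewrite (projE theta T x (bracket B C x)).
  have hP := proj_levi S tb.
  have -> : tor x (A x) (P x (bracket B C x) + theta x (bracket B C x) *: T x) =
     (2 * dth x (A x) (P x (bracket B C x))) *: T x
     + theta x (bracket B C x) *: tor x (A x) (T x).
    rewrite (tor_anti S tA); last by apply: tangentD; [exact: levi_tangent|exact: tangentZ].
    rewrite addrC (tor_linl S) //; last exact: levi_tangent.
    rewrite opprD -(tor_anti S tA (levi_tangent hP)) (torsion_levi S (hA x) hP).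
    by rewrite -scalerN -(tor_anti S tA tT) addrC.
  rewrite -(projE theta T x (bracket B C x)) (dth_levi S x vB vC hB hC) (tor_anti S tA tT).
  set b := A x _; set d := 2 * dth x (A x) _ => e.
  exists (d - b).
  have -> : D x (A x) (bracket B C) = D x (bracket B C x) A + bracket A (bracket B C) x
     + (d *: T x + - 2 * dth x (B x) (C x) *: - tor x (T x) (A x)) by rewrite e; tvec_ring.
  tvec_ring.
have [a1 e1] := key X Y Z vX vY vZ hX hY hZ.
have [a2 e2] := key Y Z X vY vZ vX hY hZ hX.
have [a3 e3] := key Z X Y vZ vX vY hZ hX hY.
have vf A B : is_vfield A -> is_vfield B -> is_vfield (fun y => D y (A y) B) by exact: (D_vf S).
have tc A B C : is_vfield A -> is_vfield B -> is_vfield C -> tangent x (curvature_field A B C x).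
  by move=> vA vB vC; exact: (vf_tangent x (curvf_vf vA vB vC)).
have th A : (forall y, levi_distr y (A y)) -> tangent x (tor x (T x) (A x)).
  by move=> hA; apply: levi_tangent; apply: (tau_levi S); exact: levi_tangent.
rewrite -!(gDl S) //; try exact: tc; try by apply: tangentD; exact: tc.
have -> : curvature_field X Y Z x + curvature_field Y Z X x + curvature_field Z X Y x =
   (a1 + a2 + a3) *: T x
   + ((2 * dth x (X x) (Y x)) *: tor x (T x) (Z x)
   + (2 * dth x (Y x) (Z x)) *: tor x (T x) (X x)
   + (2 * dth x (Z x) (X x)) *: tor x (T x) (Y x)).
  have jac := jacobi x vX vY vZ.
  transitivity ((D x (X x) (fun y => D y (Y y) Z) - D x (X x) (fun y => D y (Z y) Y)
      - D x (bracket Y Z x) X)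
    + (D x (Y x) (fun y => D y (Z y) X) - D x (Y x) (fun y => D y (X y) Z)
      - D x (bracket Z X x) Y)
    + (D x (Z x) (fun y => D y (X y) Y) - D x (Z x) (fun y => D y (Y y) X)
      - D x (bracket X Y x) Z)).
    rewrite /curvature_field; tvec_ring.
  rewrite e1 e2 e3 -[RHS]add0r -jac; tvec_ring.
rewrite (gDl S); try exact: tangentZ; last first.
- exact: tw.
- by do 2?apply: tangentD; apply: tangentZ; exact: th.
rewrite (gZl S) // (gT S tw) (theta0 S hw) mulr0 add0r.
have tz (a : R) A : (forall y, levi_distr y (A y)) -> tangent x (a *: tor x (T x) (A x)).
  by move=> hA; apply: tangentZ; exact: th.
rewrite !(gDl S); try exact: tz; try by apply: tangentD; exact: tz.
- rewrite !(gZl S) //; try exact: th; ring.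
all: exact: tw.
Qed.

End Curvature.

(** * Ricci curvature and derivatives of traces *)

Section Ricci.
Variables (R : realType) (n : nat) (M : cr_manifold R n).
Variables (theta : M -> ((M -> R) -> R) -> R) (T : M -> (M -> R) -> R).
Variable D : connection M.
Hypothesis S : tw_structure theta T D.
Local Notation tvec := ((M -> R) -> R).
Local Notation vfield := (M -> tvec).
Implicit Types (f h : M -> R) (x y : M) (u v w : tvec) (X Y Z : vfield).
Local Notation dth := (ext_deriv theta).
Local Notation G := (levi_form theta).
Local Notation g := (webster theta T).
Local Notation JJ := (J theta T).
Local Notation tor := (torsion D).
Local Notation orthon := (levi_orthonormal theta T).
Local Notation hgrad := (hgrad theta T).
Local Notation Lap := (Lap theta T D).
Local Notation curvf := (curvature_field D).

Lemma curvf_linl x (a : R) X X' Y Z : is_vfield X -> is_vfield X' -> is_vfield Y ->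
  is_vfield Z ->
  curvf (fun y => a *: X y + X' y) Y Z x = a *: curvf X Y Z x + curvf X' Y Z x.
Proof.
move=> vX vX' vY vZ; have vaX := vfieldZ a vX; rewrite /curvature_field bracketDl //.
rewrite (bracketMl x (@smooth_cst _ _ M a) vX vY) (tv_cst (vf_tangent x vY)) scale0r subr0.
have tb := vf_tangent x (vfield_bracket vX vY).
have tb' := vf_tangent x (vfield_bracket vX' vY).
have vDX := D_vf S vX vZ; have vDX' := D_vf S vX' vZ; have tY := vf_tangent x vY.
have -> : (fun y => D y (a *: X y + X' y) Z) = fun y => a *: D y (X y) Z + D y (X' y) Z.
  by apply/funext => y; apply: (D_lin S) => //; exact: vf_tangent.
rewrite (DD S tY (vfieldZ a vDX) vDX') (DM S tY (@smooth_cst _ _ M a) vDX).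
rewrite (tv_cst tY) scale0r add0r !(D_lin S) //; try exact: vf_tangent; last exact: (D_vf S).
tvec_ring.
Qed.

Lemma ricci_orth x e (E : 'I_(n.*2) -> vfield) V : orthon x e ->
  (forall i, is_vfield (E i)) -> (forall i, E i x = e i) ->
  is_vfield V -> (forall y, levi_distr y (V y)) ->
  ricci D x (V x) (V x) = \sum_i g x (curvf (E i) V V x) (e i).
Proof.
move=> oe vE Ee vV hV; rewrite /ricci (trace_orth S oe).
- have vT := vfieldT S; rewrite (curvatureE S x vT vV vV) (theta0 S); last exact: (curvf_levi S).
  by rewrite addr0; apply: eq_bigr => i _; rewrite -Ee (curvatureE S).
- move=> a u v /(vf_ext S)[X [vX <-]] /(vf_ext S)[X' [vX' <-]].
  have vs := vfieldD (vfieldZ a vX) vX'.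
  by have := curvatureE S x vs vV vV; rewrite /= => ->; rewrite curvf_linl // !(curvatureE S).
- move=> u /(vf_ext S)[X [vX <-]]; rewrite (curvatureE S) //.
  exact: (vf_tangent x (curvf_vf S vX vV vV)).
Qed.

Lemma tau_expand x e v w : orthon x e -> levi_distr x v -> tangent x w ->
  \sum_i g x v (e i) * g x (tor x (T x) (e i)) w = g x (tor x (T x) v) w.
Proof.
move=> oe hv tw; have tT := tangentT S x; have te := orth_tangent oe.
have ttau u : tangent x u -> tangent x (tor x (T x) u) by exact: (tor_tangent S).
have tsum (a : 'I_(n.*2) -> R) (r : seq 'I_(n.*2)) :
    g x (tor x (T x) (\sum_(i <- r) a i *: e i)) w =
    \sum_(i <- r) a i * g x (tor x (T x) (e i)) w.
  elim: r => [|i r IH].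
    rewrite !big_nil; have := torZr S 0 tT (tangent0 x); rewrite !scale0r => ->.
    exact: (g0l S).
  have ts : tangent x (\sum_(j <- r) a j *: e j) by apply: tangent_sum => j _; exact: tangentZ.
  rewrite !big_cons -IH (tor_anti S tT); last by apply: tangentD => //; exact: tangentZ.
  rewrite (tor_linl S (a i) (te i) ts tT) opprD -scalerN -!(tor_anti S tT) //.
  by rewrite (g_lin S) //; exact: ttau.
by rewrite [in RHS](orth_expand_levi S oe hv) tsum.
Qed.

(** Bianchi for (E i, J E i, V) is summed over i: two of the three curvature sums are each the Ricci
    term, and the third is the one displayed. *)
Lemma curvature_trace x e (E : 'I_(n.*2) -> vfield) V : orthon x e ->
  (forall i, is_vfield (E i)) -> (forall i, E i x = e i) ->
  (forall i y, levi_distr y (E i y)) -> is_vfield V -> (forall y, levi_distr y (V y)) ->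
  \sum_i g x (curvf (E i) (fun y => JJ y (E i y)) V x) (JJ x (V x)) =
  - 2 * ricci D x (V x) (V x) + 4 * (n%:R - 1) * g x (tor x (T x) (V x)) (JJ x (V x)).
Proof.
move=> oe vE Ee hE vV hV.
have vJE i := vfieldJ S (vE i).
have hJE i y : levi_distr y (JJ y (E i y)) by apply: (J_levi S); exact: vf_tangent.
have vJV := vfieldJ S vV.
have hJV y : levi_distr y (JJ y (V y)) by apply: (J_levi S); exact: vf_tangent.
have oJ := orthJ S oe.
have tV := vf_tangent x vV; have tJV := levi_tangent (hJV x).
(* J commutes with the curvature and preserves g; skewness in each pair of slots does the rest. *)
have r1 : ricci D x (V x) (V x) =
    \sum_i g x (curvf V (E i) (fun y => JJ y (E i y)) x) (JJ x (V x)).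
  rewrite (ricci_orth oe vE Ee vV hV); apply: eq_bigr => i _.
  have hc := curvf_levi S x vV (vE i) (vE i) (hE i).
  have hc' := curvf_levi S x (vE i) vV (vE i) (hE i).
  rewrite (curvf_J S x vV (vE i) (vE i)) (gJJ S hc (hV x)).
  rewrite (curvf_anti S x vV (vE i) (vE i)) (gNl S (levi_tangent hc') tV).
  rewrite (curvf_skew S x (vE i) vV (vE i) vV) opprK -Ee.
  by apply: (g_sym S); apply: levi_tangent; [exact: (curvf_levi S)|rewrite Ee; exact: orth_levi oe i].
(* Here the Ricci trace is taken in the orthonormal basis formed by the J e_i. *)
have r2 : ricci D x (V x) (V x) =
    \sum_i g x (curvf (fun y => JJ y (E i y)) V (E i) x) (JJ x (V x)).
  have JEe i : JJ x (E i x) = JJ x (e i) by rewrite Ee.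
  rewrite (ricci_orth oJ vJE JEe vV hV); apply: eq_bigr => i _.
  have hc := curvf_levi S x (vJE i) vV (vE i) (hE i).
  have hc' := curvf_levi S x (vJE i) vV (vJE i) (hJE i).
  rewrite -(gJJ S hc (hJV x)) (JJE S (hV x)) -(curvf_J S x (vJE i) vV (vE i)).
  rewrite (gNr S (levi_tangent hc') tV) (curvf_skew S x (vJE i) vV (vJE i) vV) opprK -Ee.
  apply: (g_sym S); apply: levi_tangent; first exact: (curvf_levi S).
  exact: hJE.
have B i := bianchi S (vE i) (vJE i) vV (hE i) (hJE i) hV (hJV x).
have he i := orth_levi oe i.
have dE i : dth x (E i x) (JJ x (E i x)) = 1.
  rewrite (dthG S (hE i x) (hJE i x)) (JJE S (hE i x)).
  rewrite (gNr S (levi_tangent (hE i x)) (levi_tangent (hE i x))) opprK Ee.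
  by case: oe => _ ->; rewrite eqxx.
(* On the right the first term is repeated 2 n times, while each of the other two sums to one copy
   of it: 2 (2 n - 2) = 4 (n - 1). *)
have Bs : \sum_i (g x (curvf (E i) (fun y => JJ y (E i y)) V x) (JJ x (V x)) +
      g x (curvf (fun y => JJ y (E i y)) V (E i) x) (JJ x (V x)) +
      g x (curvf V (E i) (fun y => JJ y (E i y)) x) (JJ x (V x))) =
    \sum_i (2 * (g x (tor x (T x) (V x)) (JJ x (V x))
      - g x (V x) (e i) * g x (tor x (T x) (e i)) (JJ x (V x))
      - g x (V x) (JJ x (e i)) * g x (tor x (T x) (JJ x (e i))) (JJ x (V x)))).
  apply: eq_bigr => i _; rewrite B dE mul1r (dthG S (hJE i x) (hV x)).
  rewrite (gJJ S (hE i x) (hV x)) (dthG S (hV x) (hE i x)) !Ee.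
  by rewrite (g_sym S (levi_tangent (he i)) tV) !mulNr.
move: Bs; rewrite -mulr_sumr 2!sumrB 2!big_split.
rewrite (tau_expand oe (hV x) tJV) (tau_expand oJ (hV x) tJV) sumr_const card_ord.
move: r1 r2 => /= <- <-; have -> a : a *+ n.*2 = 2 * n%:R * a :> R.
  by rewrite -[LHS]mulr_natl -muln2 natrM mulrC (mulrC n%:R) mulrC.
move=> /=; lra.
Qed.

(** In [curvature_trace] the left side is unchanged when V becomes JV, while the torsion term
    changes sign because tau anticommutes with J. Comparing the two gives the defect. *)
Lemma ricci_J x v : levi_distr x v ->
  ricci D x (JJ x v) (JJ x v) =
  ricci D x v v - 4 * (n%:R - 1) * g x (tor x (T x) v) (JJ x v).
Proof.
move=> /(levi_ext S)[V [vV <- hV]].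
have [e oe] := orthonormal_exists S x; have [E [vE Ee hE]] := orth_fields S oe.
have vJV := vfieldJ S vV.
have hJV y : levi_distr y (JJ y (V y)) by apply: (J_levi S); exact: vf_tangent.
have e1 := curvature_trace oe vE Ee hE vV hV.
have e2 := curvature_trace oe vE Ee hE vJV hJV.
have tV := vf_tangent x vV; have tJV := levi_tangent (hJV x).
have httau := tau_levi S tV.
have e3 : g x (tor x (T x) (JJ x (V x))) (JJ x (JJ x (V x))) =
    - g x (tor x (T x) (V x)) (JJ x (V x)).
  rewrite (tau_J S tV) (JJE S (hV x)).
  have tJ := levi_tangent (J_levi S (levi_tangent httau)).
  by rewrite (gNl S tJ (tangentN tV)) (gNr S tJ tV) opprK (gJ S httau (hV x)).
have e4 : \sum_i g x (curvf (E i) (fun y => JJ y (E i y)) (fun y => JJ y (V y)) x)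
      (JJ x (JJ x (V x))) =
    \sum_i g x (curvf (E i) (fun y => JJ y (E i y)) V x) (JJ x (V x)).
  apply: eq_bigr => i _; have vJE := vfieldJ S (vE i).
  have hc := curvf_levi S x (vE i) vJE vJV hJV.
  rewrite (JJE S (hV x)) (gNr S (levi_tangent hc) tV).
  rewrite (curvf_skew S x (vE i) vJE vJV vV) opprK; apply: (g_sym S) => //.
  exact/levi_tangent/(curvf_levi S).
move: e2; rewrite e4 e1 e3; lra.
Qed.

Lemma ricci_torsion_ge (k : R) : (0 < n)%N ->
  (forall x v, levi_distr x v ->
     k * G x v v <= ricci D x v v + 2 * ph_torsion theta T D x v (JJ x v)) ->
  forall x v, levi_distr x v ->
    k * g x v v <= ricci D x v v - 2 * g x (tor x (T x) v) (JJ x v).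
Proof.
(* [(n - 1) / n] times the hypothesis at [v] plus [1 / n] times the hypothesis at [J v]. *)
move=> n0 hk x v hv; have hJv := J_levi S (levi_tangent hv).
have tv := levi_tangent hv; have httau := tau_levi S tv.
have h1 := hk x v hv; have h2 := hk x _ hJv.
rewrite /ph_torsion /tau in h1 h2.
have e3 : g x (tor x (T x) (JJ x v)) (JJ x (JJ x v)) = - g x (tor x (T x) v) (JJ x v).
  rewrite (tau_J S tv) (JJE S hv).
  have tJ := levi_tangent (J_levi S (levi_tangent httau)).
  by rewrite (gNl S tJ (tangentN tv)) (gNr S tJ tv) opprK (gJ S httau hv).
move: h1 h2; rewrite -!(g_levi S) // (gJJ S hv hv) ricci_J // e3.
have n1 : 1 <= n%:R :> R by rewrite ler1n.
move: (g x v v) (ricci D x v v) (g x (tor x (T x) v) _) (n%:R : R) n1 => q r A N n1 h1 h2.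
rewrite -subr_ge0 -(pmulr_rge0 _ (lt_le_trans ltr01 n1)).
have -> : N * (r - 2 * A - k * q) = (N - 1) * (r + 2 * A - k * q)
   + (r - 4 * (N - 1) * A + 2 * - A - k * q) by ring.
by rewrite addr_ge0 ?mulr_ge0 ?subr_ge0.
Qed.

(** [trace_at] is picked pointwise; a frame gives near x one formula with smooth ingredients, which
    can then be differentiated. *)
Lemma trace_frame x V E (Y : 'I_(n.*2.+1) -> M -> R) (B : 'I_(n.*2.+1) -> 'I_(n.*2.+1) -> M -> R) :
  is_vfield V -> (forall i, is_vfield (E i)) ->
  (\forall y \near x, forall v, tangent y v ->
        v = \sum_i (\sum_j v (Y j) * B j i y) *: E i y) ->
  (\forall y \near x, forall i k, \sum_j E k y (Y j) * B j i y = (i == k)%:R) ->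
  \forall y \near x, trace_at y (fun v => D y v V) =
    \sum_i \sum_j D y (E i y) V (Y j) * B j i y.
Proof.
move=> vV vE; apply: filterS2 => y sp dual.
have tE i := vf_tangent y (vE i).
rewrite (trace_atE (e := fun i => E i y)
  (A := \matrix_(i, k) \sum_j D y (E k y) V (Y j) * B j i y)).
- by rewrite /mxtrace; apply: eq_bigr => i _; rewrite mxE.
- by move=> a u v tu tv; exact: (D_lin S).
- split=> //.
    by move=> v /sp e; exists (fun i => \sum_j v (Y j) * B j i y).
  move=> a e i; have := congr1 (fun u : tvec => \sum_j u (Y j) * B j i y) e.
  rewrite [X in _ = X]big1; last by move=> j _; rewrite tvecE mul0r.
  under eq_bigr do rewrite sum_tvec mulr_suml.
  rewrite exchange_big /= => <-; transitivity (\sum_k a k * (i == k)%:R).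
    rewrite (bigD1 i) //= eqxx mulr1 big1 ?addr0 // => k; rewrite eq_sym => /negbTE ->.
    by rewrite mulr0.
  apply: eq_bigr => k _; rewrite -dual mulr_sumr; apply: eq_bigr => j _.
  by rewrite tvecE mulrA.
- move=> k; rewrite {1}(sp _ (D_tangent S (tE k) vV)).
  by apply: eq_bigr => i _; rewrite mxE.
Qed.

Lemma Lap_smooth h : smooth h -> smooth (Lap h).
Proof.
move=> sh; apply: smooth_near => x; have vh := hgrad_vf S sh.
have [E fE] := frames S x; have [vE _] := fE.
have [Y [sY had _ _]] := coordinates x.
have [B [sB sp dual _]] := frame_coef fE sY had.
exists (fun y => \sum_i \sum_j D y (E i y) (hgrad h) (Y j) * B j i y); split.
  apply: smooth_sum => i _; apply: smooth_sum => j _; apply: smoothM => //.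
  by apply: (vf_smooth (X := fun y => D y (E i y) (hgrad h))) => //; exact: (D_vf S).
exact: (trace_frame vh vE sp dual).
Qed.

(** The trace commutes with covariant differentiation. The fields are orthonormal at x only, so the
    derivatives of the frame enter and must be shown to cancel. *)
Lemma trace_derivative x e (E0 : 'I_(n.*2) -> vfield) V Z : orthon x e ->
  (forall i, is_vfield (E0 i)) -> (forall i, E0 i x = e i) ->
  is_vfield V -> (forall y, levi_distr y (V y)) -> is_vfield Z ->
  Z x (fun y => trace_at y (fun v => D y v V)) =
  \sum_i g x (D x (Z x) (fun y => D y (E0 i y) V) - D x (D x (Z x) (E0 i)) V) (e i).
Proof.
move=> oe vE0 Ee vV hV vZ.
pose E : 'I_(n.*2.+1) -> vfield := extend_basis E0 T.
have vT := vfieldT S.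
have vE i : is_vfield (E i) by rewrite /E /extend_basis; case: unlift.
have fE : is_frame x E.
  split=> //; have := orth_basis S oe; congr is_basis; apply/funext => i.
  by rewrite /E /extend_basis; case: unlift => [j|] //; rewrite Ee.
have [Y [sY had _ _]] := coordinates x.
have [B [sB sp dual _]] := frame_coef fE sY had.
have tZ := vf_tangent x vZ; have tE i := vf_tangent x (vE i).
pose W k : vfield := fun y => D y (E k y) V.
have vW k : is_vfield (W k) by exact: (D_vf S).
pose a i k y := \sum_j W k y (Y j) * B j i y.
have sa i k : smooth (a i k).
  by apply: smooth_sum => j _; apply: smoothM => //; exact: vf_smooth.
have WE k : \forall y \near x, W k y = \sum_i a i k y *: E i y.
  by apply: filterS sp => y sp; exact: (sp _ (vf_tangent y (vW k))).
pose Gam i k := \sum_j D x (Z x) (E k) (Y j) * B j i x.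
have GamE k : D x (Z x) (E k) = \sum_i Gam i k *: E i x.
  exact: (nbhs_singleton sp _ (D_tangent S tZ (vE k))).
rewrite (tv_near tZ _ _ (trace_frame vV vE sp dual)); first last.
- by apply: smooth_sum => i _; exact: sa.
- apply: smooth_near => y; have [E' fE'] := frames S y; have [vE' _] := fE'.
  have [Y' [sY' had' _ _]] := coordinates y.
  have [B' [sB' sp' dual' _]] := frame_coef fE' sY' had'.
  exists (fun z => \sum_i \sum_j D z (E' i z) V (Y' j) * B' j i z); split.
    apply: smooth_sum => i _; apply: smooth_sum => j _; apply: smoothM => //.
    by apply: (vf_smooth (X := fun y => D y (E' i y) V)) => //; exact: (D_vf S).
  exact: (trace_frame vV vE' sp' dual').
have -> : Z x (fun y => \sum_i \sum_j D y (E i y) V (Y j) * B j i y) = \sum_i Z x (a i i).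
  by apply: (@tv_sum _ _ _ _ _ tZ _ _ _ (fun i => a i i)) => i _; exact: sa.
(* The coframe dual to E at x. *)
pose l := extend_basis (fun i v => g x v (e i)) (theta x).
have llin i (c : R) u v : tangent x u -> tangent x v -> l i (c *: u + v) = c * l i u + l i v.
  move=> tu tv; rewrite /l /extend_basis; case: unlift => [j|]; last exact: (theta_lin S).
  by apply: (g_lin S) => //; exact: orth_tangent oe j.
have l0 i : l i 0 = 0.
  by have := llin i (-1) _ _ (tangent0 x) (tangent0 x); rewrite scaler0 addr0 => h; lra.
have lsum i (c : 'I_(n.*2.+1) -> R) (d : 'I_(n.*2.+1) -> tvec) (r : seq 'I_(n.*2.+1)) :
    (forall j, tangent x (d j)) ->
    l i (\sum_(j <- r) c j *: d j) = \sum_(j <- r) c j * l i (d j).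
  move=> td; elim: r => [|j r IH]; first by rewrite !big_nil l0.
  by rewrite !big_cons llin ?IH //; apply: tangent_sum => k _; exact: tangentZ.
have lE i k : l i (E k x) = (i == k)%:R.
  have he := orth_levi oe; have te := orth_tangent oe.
  have [i' ->|->] := unliftP ord_max i; have [k' ->|->] := unliftP ord_max k;
    rewrite /l /E ?extend_basis_lift ?extend_basis_max.
  - by rewrite Ee (inj_eq lift_inj) eq_sym; case: oe => _ ->.
  - rewrite (gT S) // (theta0 S) // (_ : (_ == _) = false) //.
    by apply/negbTE; rewrite eq_sym neq_lift.
  - rewrite Ee (theta0 S) // (_ : (_ == _) = false) //.
    by apply/negbTE; rewrite neq_lift.
  - by rewrite (thetaT S) eqxx.
have DWE k : D x (Z x) (W k) = \sum_i Z x (a i k) *: E i x + \sum_i a i k x *: D x (Z x) (E i).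
  have vs : is_vfield (fun y => \sum_i a i k y *: E i y).
    by apply: vfield_sum => i _; exact: vfieldM.
  rewrite (D_near S tZ (vW k) vs (WE k)).
  have aux (r : seq 'I_(n.*2.+1)) : D x (Z x) (fun y => \sum_(i <- r) a i k y *: E i y) =
      \sum_(i <- r) Z x (a i k) *: E i x + \sum_(i <- r) a i k x *: D x (Z x) (E i).
    elim: r => [|i r IH].
      rewrite !big_nil addr0; under eq_fun do rewrite big_nil.
      have := DM S tZ (@smooth_cst _ _ M 0) (vfield0 M).
      rewrite (tv_cst tZ) !scale0r addr0.
      by [].
    under eq_fun do rewrite big_cons.
    rewrite (DD S tZ) ?IH ?(DM S tZ) //.
    - by rewrite !big_cons addrACA.
    - exact: vfieldM.
    - by apply: vfield_sum => j _; exact: vfieldM.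
  exact: aux.
have DGE k : D x (D x (Z x) (E k)) V = \sum_i Gam i k *: W i x.
  rewrite GamE; have aux (r : seq 'I_(n.*2.+1)) :
      D x (\sum_(i <- r) Gam i k *: E i x) V = \sum_(i <- r) Gam i k *: W i x.
    elim: r => [|i r IH]; first by rewrite !big_nil (D0l S).
    rewrite !big_cons (D_lin S) ?IH //; apply: tangent_sum => j _; exact: tangentZ.
  exact: aux.
pose del k := D x (Z x) (W k) - D x (D x (Z x) (E k)) V.
have tW k := vf_tangent x (vW k).
have tDE k := D_tangent S tZ (vE k).
have lW i k : l i (W k x) = a i k x.
  rewrite (nbhs_singleton (WE k)) lsum // (bigD1 i) //= lE eqxx mulr1 big1 ?addr0 // => j ji.
  by rewrite lE eq_sym (negbTE ji) mulr0.
have lDE i k : l i (D x (Z x) (E k)) = Gam i k.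
  rewrite GamE lsum // (bigD1 i) //= lE eqxx mulr1 big1 ?addr0 // => j ji.
  by rewrite lE eq_sym (negbTE ji) mulr0.
have ldel k : l k (del k) = Z x (a k k) + \sum_i a i k x * Gam k i - \sum_i Gam i k * a k i x.
  have t1 : tangent x (\sum_i Z x (a i k) *: E i x).
    by apply: tangent_sum => i _; exact: tangentZ.
  have t2 : tangent x (\sum_i a i k x *: D x (Z x) (E i)).
    by apply: tangent_sum => i _; exact: tangentZ.
  have t3 : tangent x (\sum_i Gam i k *: W i x).
    by apply: tangent_sum => i _; exact: tangentZ.
  rewrite /del DWE DGE -scaleN1r addrC llin //; last exact: tangentD.
  rewrite -[X in X + \sum_i a i k x *: _]scale1r llin // mul1r mulN1r addrC.
  rewrite !lsum //; congr (_ + _ - _).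
  - rewrite (bigD1 k) //= lE eqxx mulr1 big1 ?addr0 // => j jk.
    by rewrite lE eq_sym (negbTE jk) mulr0.
  - by apply: eq_bigr => i _; rewrite lDE.
  - by apply: eq_bigr => i _; rewrite lW.
transitivity (\sum_k l k (del k)).
  (* The terms containing [Gam] form the trace of a commutator of matrices and cancel. *)
  under [RHS]eq_bigr do rewrite ldel.
  rewrite sumrB big_split /= -addrA; apply/esym.
  rewrite [X in _ + (X - _)]exchange_big /= -sumrB.
  rewrite [X in _ + X]big1 ?addr0 // => i _.
  by rewrite -sumrB big1 // => k _; rewrite mulrC subrr.
(* The T component drops out: every derivative of the horizontal V is horizontal. *)
rewrite sum_ord_max {2}/l extend_basis_max /del.
have hW k y : levi_distr y (W k y) by apply: (D_levi S) => //; exact: vf_tangent.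
rewrite [X in _ + X](theta0 S) ?addr0; last first.
  by apply: leviB; apply: (D_levi S) => //; exact: hW.
by apply: eq_bigr => i _; rewrite /l /W /E !extend_basis_lift.
Qed.

End Ricci.

(** * The Bochner formula *)

Section Bochner.
Variables (R : realType) (n : nat) (M : cr_manifold R n).
Variables (theta : M -> ((M -> R) -> R) -> R) (T : M -> (M -> R) -> R).
Variable D : connection M.
Hypothesis S : tw_structure theta T D.
Local Notation tvec := ((M -> R) -> R).
Local Notation vfield := (M -> tvec).
Implicit Types (f h : M -> R) (x y : M) (u v w : tvec) (X Y Z : vfield).
Local Notation dth := (ext_deriv theta).
Local Notation g := (webster theta T).
Local Notation JJ := (J theta T).
Local Notation tor := (torsion D).
Local Notation orthon := (levi_orthonormal theta T).
Local Notation hgrad := (hgrad theta T).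
Local Notation Lap := (Lap theta T D).
Local Notation curvf := (curvature_field D).

Variable f : M -> R.
Hypothesis sf : smooth f.
Hypothesis Tf : forall x, T x f = 0.
Local Notation Z := (hgrad f).

Let vZ : is_vfield Z. Proof. exact: (hgrad_vf S). Qed.
Let hZ x : levi_distr x (Z x). Proof. exact: (hgrad_levi S). Qed.
Let tZ x : tangent x (Z x). Proof. exact: vf_tangent. Qed.

(** Because T f = 0, the horizontal gradient is the full gradient. *)
Lemma hgrad_ker x u : tangent x u -> g x (Z x) u = u f.
Proof.
move=> tu; rewrite (g_levi_proj S (hZ x) tu) (hgradE S sf (proj_levi S tu)).
by rewrite [in RHS](projE theta T x u) !tvecE Tf mulr0 addr0.
Qed.

Lemma hess_fields x U W : is_vfield U -> is_vfield W ->
  g x (D x (U x) Z) (W x) = U x (fun y => W y f) - D x (U x) W f.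
Proof.
move=> vU vW; have tU := vf_tangent x vU.
have := D_metric S tU vZ vW.
rewrite (hgrad_ker (D_tangent S tU vW)) => e.
have -> : (fun y => W y f) = fun y => g y (Z y) (W y).
  by apply/funext => y; rewrite hgrad_ker //; exact: vf_tangent.
by rewrite e addrK.
Qed.

(** The defect of symmetry is the torsion applied to f, a multiple of T f. *)
Lemma hess_sym x u w : levi_distr x u -> levi_distr x w ->
  g x (D x u Z) w = g x (D x w Z) u.
Proof.
move=> /(levi_ext S)[U [vU <- hU]] /(levi_ext S)[W [vW <- hW]].
rewrite !hess_fields //.
have := congr1 (fun u : tvec => u f) (torsionE S x vU vW).
rewrite (torsion_levi S (hU x) (hW x)) !tvecE Tf mulr0 /bracket; lra.
Qed.

(** As T is parallel and W (T f) = 0, the vertical second derivative reduces to - tau(W) f. This is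
    where torsion enters the Bochner formula. *)
Lemma hess_T x w : levi_distr x w -> g x (D x (T x) Z) w = - g x (tor x (T x) w) (Z x).
Proof.
move=> /(levi_ext S)[W [vW <- hW]]; have vT := vfieldT S.
have tW := vf_tangent x vW.
have tt := levi_tangent (tau_levi S tW).
rewrite (g_sym S tt (tZ x)) hgrad_ker // hess_fields //.
rewrite (torsionE S x vT vW) !tvecE (DT S tW) tvecE /bracket.
have -> : (fun y => T y f) = fun=> 0 by apply/funext.
rewrite (tv_cst tW); lra.
Qed.

Variable c : R.
Local Notation psi := (fun y => 2^-1 * (g y (Z y) (Z y) + c * (f y * f y))).

Lemma smooth_energy : smooth psi.
Proof.
apply: smoothZ; apply: smoothD; first exact: (g_smooth S).
by apply: smoothZ; exact: smoothM.
Qed.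

Lemma energy_derivative x u : tangent x u ->
  u psi = g x (D x u Z) (Z x) + c * f x * u f.
Proof.
move=> tu; have sZ := g_smooth S vZ vZ; have sff := smoothM sf sf.
rewrite (tvZ tu) //; last by apply: smoothD => //; exact: smoothZ.
rewrite (tvD tu sZ (smoothZ c sff)) (tvZ tu) // (tvM tu) // (D_metric S tu vZ vZ).
have tD := D_tangent S tu vZ; rewrite (g_sym S (tZ x) tD); lra.
Qed.

Lemma hgrad_energy : hgrad psi = fun y => D y (Z y) Z + (c * f y) *: Z y.
Proof.
apply/funext => x; have hD : levi_distr x (D x (Z x) Z) by exact: (D_levi S).
have tD := levi_tangent hD.
have hcZ := leviZ (c * f x) (hZ x).
apply: (g_levi_inj S); first exact: (hgrad_levi S) smooth_energy.
  exact: leviD.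
move=> w hw; have tw := levi_tangent hw.
rewrite (hgradE S smooth_energy hw) (energy_derivative tw) (hess_sym hw (hZ x)).
by rewrite (gDl S tD (levi_tangent hcZ) tw) (gZl S _ (tZ x) tw) hgrad_ker.
Qed.

(** The gradient of psi is D_Z Z + c f Z. Commuting its derivative along e_i with Z produces
    curvature, the derivative of the Laplacian of f, the square of the Hessian, and a derivative
    along T from the bracket. *)
Lemma bochner x e (lambda : R) : orthon x e -> lambda = - (2 * n%:R * c) ->
  (forall y, Lap f y = lambda * f y) ->
  Lap psi x =
    \sum_i \sum_j (g x (D x (e i) Z) (e j) + c * f x * (i == j)%:R) ^+ 2
    + (ricci D x (Z x) (Z x) - 2 * g x (tor x (T x) (Z x)) (JJ x (Z x))
       + (lambda + c) * g x (Z x) (Z x)).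
Proof.
move=> oe lE Lf; have [E [vE Ee hE]] := orth_fields S oe.
have he := orth_levi oe; have te := orth_tangent oe.
have hS u : tangent x u -> levi_distr x (D x u Z) by move=> tu; exact: (D_levi S).
have vDZZ : is_vfield (fun y => D y (Z y) Z) by exact: (D_vf S).
have scf : smooth (fun y => c * f y) by exact: smoothZ.
have vcZ := vfieldM scf vZ.
have tT := tangentT S x.
have term i : g x (D x (e i) (hgrad psi)) (e i) =
    g x (curvf (E i) Z Z x) (e i)
    + g x (D x (Z x) (fun y => D y (E i y) Z) - D x (D x (Z x) (E i)) Z) (e i)
    + \sum_j g x (D x (e i) Z) (e j) ^+ 2
    - 2 * (g x (JJ x (Z x)) (e i) * g x (tor x (T x) (e i)) (Z x))
    + c * (g x (Z x) (e i) * g x (Z x) (e i)) + c * f x * g x (D x (e i) Z) (e i).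
  have vEi := vE i; have tEi := vf_tangent x vEi.
  have vDEZ := D_vf S vEi vZ.
  have tb := vf_tangent x (vfield_bracket vEi vZ).
  have t1 := vf_tangent x (curvf_vf S vEi vZ vZ).
  have t2 : tangent x (D x (Z x) (fun y => D y (E i y) Z)) by exact: (D_tangent S).
  have tDZE : tangent x (D x (Z x) (E i)) by exact: (D_tangent S).
  have t3 : tangent x (D x (D x (Z x) (E i)) Z) by exact: (D_tangent S).
  have tSe : tangent x (D x (e i) Z) by exact: (D_tangent S).
  have t4 : tangent x (D x (D x (e i) Z) Z) by exact: (D_tangent S).
  have t5 : tangent x (D x (T x) Z) by exact: (D_tangent S).
  (* The bracket is expressed through the torsion; its T component is what brings in [hess_T] and
     hence tau. *)
  have eb : bracket (E i) Z x =
      D x (e i) Z - D x (Z x) (E i) - (2 * dth x (e i) (Z x)) *: T x.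
    rewrite -(torsion_levi S (he i) (hZ x)) -Ee (torsionE S x vEi vZ); tvec_ring.
  have eD : D x (E i x) (fun y => D y (Z y) Z) =
      curvf (E i) Z Z x + (D x (Z x) (fun y => D y (E i y) Z) - D x (D x (Z x) (E i)) Z)
      + D x (D x (e i) Z) Z - (2 * dth x (e i) (Z x)) *: D x (T x) Z.
    rewrite /curvature_field eb.
    have t6 := tangentZ (2 * dth x (e i) (Z x)) tT.
    rewrite (DBl S (tangentB tSe tDZE) t6 vZ) (DBl S tSe tDZE vZ) (DZl S _ tT vZ); tvec_ring.
  rewrite hgrad_energy (DD S (te i) vDZZ vcZ) (DM S (te i) scf vZ) (tvZ (te i) c sf).
  rewrite -{1}Ee eD.
  have t7 := tangentB t2 t3.
  have t8 := tangentZ (2 * dth x (e i) (Z x)) t5.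
  have tei := te i.
  have t9 := tangentD (tangentD t1 t7) t4.
  have t10 := tangentZ (c * e i f) (tZ x).
  have t11 := tangentZ (c * f x) tSe.
  rewrite (gDl S (tangentB t9 t8) (tangentD t10 t11) tei) (gBl S t9 t8 tei).
  rewrite (gDl S (tangentD t1 t7) t4 tei) (gDl S t1 t7 tei).
  rewrite (gZl S _ t5 tei) (gDl S t10 t11 tei) (gZl S _ (tZ x) tei) (gZl S _ tSe tei).
  rewrite (hess_T (he i)) (hess_sym (hS _ tei) (he i)) (orth_parseval S oe (hS _ tei) (hS _ tei)).
  rewrite (dthG S (he i) (hZ x)) (g_sym S tei (levi_tangent (J_levi S (tZ x)))).
  rewrite -(hgrad_ker tei) -!mulrA.
  under eq_bigr do rewrite -expr2.
  ring.
rewrite (Lap_orth S smooth_energy oe).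
under eq_bigr do rewrite term.
(* The six sums become the Ricci term, Z applied to [Lap f = lambda f], the norm of the Hessian, a
   tau term, c |Z|^2 and c f [Lap f]. *)
rewrite 5!big_split /= sumrN -!mulr_sumr.
move: (ricci_orth S oe vE Ee vZ hZ) (trace_derivative S oe vE Ee vZ hZ vZ) => /= <- <-.
have hJZ := J_levi S (tZ x).
rewrite (tau_expand S oe hJZ (tZ x)) -(Lap_orth S sf oe).
rewrite -(orth_parseval S oe (hZ x) (hZ x)).
have -> : (fun y => trace_at y (fun v => D y v Z)) = fun y => lambda * f y.
  by apply/funext => y; exact: Lf.
rewrite (tvZ (tZ x) lambda sf) -(hgrad_ker (tZ x)) Lf.
have httau := tau_levi S (tZ x).
rewrite (tau_J S (tZ x)) (gNl S (levi_tangent (J_levi S (levi_tangent httau))) (tZ x)).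
rewrite (gJ S httau (hZ x)).
(* Completing the square costs 2 c f [Lap f] + 2 n c^2 f^2. With [Lap f] = - 2 n c f this equals the
   available c f [Lap f]. *)
have -> : \sum_i \sum_j (g x (D x (e i) Z) (e j) + c * f x * (i == j)%:R) ^+ 2 =
    \sum_i \sum_j g x (D x (e i) Z) (e j) ^+ 2 + 2 * (c * f x) * Lap f x
    + 2 * n%:R * (c * f x) ^+ 2.
  have -> : 2 * n%:R * (c * f x) ^+ 2 = \sum_(i < n.*2) (c * f x) ^+ 2.
    by rewrite sumr_const card_ord -[RHS]mulr_natl -muln2 natrM mulrC (mulrC n%:R) mulrC.
  rewrite (Lap_orth S sf oe) mulr_sumr -big_split -big_split.
  apply: eq_bigr => i _; rewrite /= (bigD1 i) //= [in RHS](bigD1 i) //= eqxx.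
  rewrite [X in _ + X = _](eq_bigr (fun j => g x (D x (e i) Z) (e j) ^+ 2)).
    by rewrite mulr1; set A := \sum_(_ | _) _; set a := g x _ _; ring.
  by move=> j ji; rewrite eq_sym (negbTE ji) mulr0 addr0.
rewrite Lf lE; ring.
Qed.

Section Rigidity.
Variables (k lambda : R).
(** The two equations determine both constants: the first completes the square, the second matches
    the curvature bound; together they give c = k / (2 n - 1). *)
Hypothesis lE : lambda = - (2 * n%:R * c).
Hypothesis kE : lambda + c = - k.
Hypothesis Lf : forall y, Lap f y = lambda * f y.
Hypothesis hk : forall x v, levi_distr x v ->
    k * g x v v <= ricci D x v v - 2 * g x (tor x (T x) v) (JJ x v).

Lemma energy_subharmonic x : 0 <= Lap psi x.
Proof.
have [e oe] := orthonormal_exists S x; rewrite (bochner oe lE Lf) addr_ge0 //.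
  by apply: sumr_ge0 => i _; apply: sumr_ge0 => j _; exact: sqr_ge0.
by rewrite kE mulNr subr_ge0; exact: hk.
Qed.

Lemma energy_rigidity x : Lap psi x = 0 ->
  forall u, levi_distr x u -> D x u Z = - (c * f x) *: u.
Proof.
have [e oe] := orthonormal_exists S x; rewrite (bochner oe lE Lf) kE mulNr.
have := hk (hZ x); rewrite -subr_ge0; set q := (_ - _ - _) => q0.
have nn i j : 0 <= (g x (D x (e i) Z) (e j) + c * f x * (i == j)%:R) ^+ 2 by exact: sqr_ge0.
move=> /eqP; rewrite paddr_eq0 //; last first.
  by apply: sumr_ge0 => i _; exact: sumr_ge0.
move=> /andP[+ _]; rewrite psumr_eq0; last by move=> i _; exact: sumr_ge0.
move=> /allP z.
have zij i j : g x (D x (e i) Z) (e j) = - (c * f x) * (i == j)%:R.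
  have := z i (mem_index_enum _); rewrite /= psumr_eq0 // => /allP/(_ j (mem_index_enum _)).
  by rewrite /= sqrf_eq0 addr_eq0 mulNr => /eqP.
have he := orth_levi oe; have te := orth_tangent oe.
have De i : D x (e i) Z = - (c * f x) *: e i.
  rewrite (orth_expand_levi S oe (D_levi S (te i) vZ hZ)).
  rewrite (bigD1 i) //= zij eqxx mulr1 big1 ?addr0 // => j ji.
  by rewrite zij eq_sym (negbTE ji) mulr0 scale0r.
move=> u hu; rewrite (orth_expand_levi S oe hu).
have aux (r : seq 'I_(n.*2)) (a : 'I_(n.*2) -> R) : D x (\sum_(i <- r) a i *: e i) Z =
    - (c * f x) *: \sum_(i <- r) a i *: e i.
  elim: r => [|i r IH]; first by rewrite !big_nil (D0l S) // scaler0.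
  rewrite !big_cons (D_lin S (a i)) ?IH ?De //.
    by rewrite scalerDr !scalerA [_ * a i]mulrC.
  by apply: tangent_sum => j _; exact: tangentZ.
exact: aux.
Qed.

End Rigidity.
End Bochner.

(** * The strong maximum principle *)

Section CompactManifold.
Variables (R : realType) (m : nat) (M : oriented_manifold R m).
Hypothesis Mc : compact [set: M].
Implicit Types (h : M -> R) (x y z : M) (A : set M).

Lemma closed_min A h : closed A -> A !=set0 -> continuous h ->
  exists2 x, A x & forall y, A y -> h x <= h y.
Proof.
move=> cA A0 ch; have cpA : compact A by exact: (subclosed_compact cA Mc).
have [x xA hx] := compact_EVT_min A0 cpA (continuous_subspaceT ch).
by exists x => [|y Ay]; [exact: set_mem|apply: hx; exact: mem_set].
Qed.

Lemma continuous_bounded h : continuous h -> exists2 K, 0 <= K & forall y, `|h y| <= K.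
Proof.
move=> ch; have [[x0 _]|e0] := pselect ([set: M] !=set0); last first.
  by exists 0 => // y; case: e0; exists y.
have cn : continuous (fun y => - `|h y|).
  by move=> y; apply: cvgN; apply: cvg_norm; exact: ch.
have [x _ hx] := closed_min closedT (ex_intro _ x0 I) cn.
by exists `|h x| => // y; have := hx y I; rewrite lerN2.
Qed.

Lemma closed_le_level h (a : R) : continuous h -> closed [set y | h y <= a].
Proof. by move=> ch; apply: (@closed_comp _ _ h [set u | u <= a]) => // y _; exact: ch. Qed.

Lemma closed_ge_level h (a : R) : continuous h -> closed [set y | a <= h y].
Proof. by move=> ch; apply: (@closed_comp _ _ h [set u | a <= u]) => // y _; exact: ch. Qed.

Lemma closed_eq_level h (a : R) : continuous h -> closed [set y | h y = a].
Proof. by move=> ch; apply: (@closed_comp _ _ h [set a]) => // y _; exact: ch. Qed.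

(** On the compact complement of a neighbourhood h has a positive minimum. Sublevel sets of such
    functions play the part of small closed balls. *)
Lemma sublevel_near h x (U : set M) : continuous h -> (forall y, 0 <= h y) ->
  (forall y, h y = 0 -> y = x) -> nbhs x U ->
  exists2 r, 0 < r & forall y, h y <= r -> U y.
Proof.
move=> ch h0 hx /near_open[V [oV Vx VU]].
have [V0|V0] := pselect (~` V !=set0); last first.
  by exists 1 => // y _; apply: VU; apply: contrapT => Vy; case: V0; exists y.
have [z Vz hz] := closed_min (open_closedC oV) V0 ch.
have hz0 : 0 < h z.
  by rewrite lt_neqAle h0 andbT; apply/eqP => e; apply: Vz; rewrite (hx z).
exists (h z / 2); first by rewrite divr_gt0.
move=> y hy; apply: VU; apply: contrapT => Vy; have := hz y Vy; lra.
Qed.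

(** A global substitute for the squared distance to z: coordinate distance, plus a penalty away from
    the neighbourhood where the coordinates are injective. *)
Definition separator (Y : 'I_m -> M -> R) (chi : M -> R) z y : R :=
  \sum_j (Y j y - Y j z) ^+ 2 + (1 - chi y).

Section Separator.
Variables (Y : 'I_m -> M -> R) (chi : M -> R).
Hypothesis sY : forall j, smooth (Y j).
Hypothesis sc : smooth chi.
Hypothesis c01 : forall y, 0 <= chi y <= 1.

Lemma separator_smooth z : smooth (separator Y chi z).
Proof.
apply: smoothD; last by apply: smoothB => //; exact: smooth_cst.
apply: smooth_sum => j _; have : smooth (fun y => Y j y - Y j z).
  by apply: smoothB => //; exact: smooth_cst.
by move=> s; apply: smoothM.
Qed.

Lemma separator_ge0 z y : 0 <= separator Y chi z y.
Proof.
apply: addr_ge0; first by apply: sumr_ge0 => j _; exact: sqr_ge0.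
by rewrite subr_ge0; case/andP: (c01 y).
Qed.

Lemma separator_le z p q : separator Y chi p q <=
  2 * separator Y chi z q + 2 * \sum_j (Y j p - Y j z) ^+ 2.
Proof.
have c : 0 <= 1 - chi q by rewrite subr_ge0; case/andP: (c01 q).
suff s : \sum_j (Y j q - Y j p) ^+ 2 <=
    2 * \sum_j (Y j q - Y j z) ^+ 2 + 2 * \sum_j (Y j p - Y j z) ^+ 2.
  by move: s; rewrite /separator; lra.
rewrite !mulr_sumr -big_split; apply: ler_sum => j _ /=; rewrite -subr_ge0.
have -> : 2 * (Y j q - Y j z) ^+ 2 + 2 * (Y j p - Y j z) ^+ 2 - (Y j q - Y j p) ^+ 2 =
  (Y j q + Y j p - 2 * Y j z) ^+ 2 by ring.
exact: sqr_ge0.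
Qed.

Variables (N : set M) (x : M).
Hypothesis Ninj : forall y z, N y -> N z -> (forall j, Y j y = Y j z) -> y = z.
Hypothesis Nx : N x.
Hypothesis cN : forall y, ~ N y -> chi y = 0.

Lemma separator_eq0 y : separator Y chi x y = 0 -> y = x.
Proof.
move=> /eqP; rewrite paddr_eq0 ?subr_ge0; first last.
- by case/andP: (c01 y).
- by apply: sumr_ge0 => j _; exact: sqr_ge0.
rewrite psumr_eq0; last by move=> j _; exact: sqr_ge0.
move=> /andP[/allP s /eqP e]; apply: Ninj => //.
  by apply: contrapT => /cN e'; move: e; rewrite e'; lra.
move=> j; have := s j (mem_index_enum _); rewrite /= sqrf_eq0 subr_eq0 => /eqP //.
Qed.

End Separator.

Lemma separator_exists x : exists rho : M -> R,
  [/\ smooth rho, forall y, 0 <= rho y, rho x = 0 & forall y, rho y = 0 -> y = x].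
Proof.
have [Y [sY _ _ [N xN Ninj]]] := coordinates x.
have [chi [sc c01 c1 c0]] := smooth_bump xN.
exists (separator Y chi x); split.
- exact: separator_smooth.
- exact: separator_ge0.
- rewrite /separator (nbhs_singleton c1) subrr addr0 big1 // => j _.
  by rewrite subrr expr0n.
- by apply: (separator_eq0 c01 Ninj (nbhs_singleton xN)) => y Ny; exact: c0.
Qed.

(** Polynomials in s with smooth coefficients, in Horner form. Vector fields preserve the class, and
    compactness bounds its members uniformly for s in [0, 1]. *)
Inductive poly_family : (R -> M -> R) -> Prop :=
| PolyCst a : smooth a -> poly_family (fun _ => a)
| PolyAdd p q : poly_family p -> poly_family q -> poly_family (fun s y => p s y + q s y)
| PolyShift p : poly_family p -> poly_family (fun s y => s * p s y).

Lemma poly_smooth p s : poly_family p -> smooth (p s).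
Proof. by elim=> // *; [exact: smoothD|exact: smoothZ]. Qed.

Lemma poly_bounded p : poly_family p ->
  exists2 K, 0 <= K & forall s y, 0 <= s <= 1 -> `|p s y| <= K.
Proof.
elim=> [a sa|p1 p2 _ [K K0 hK] _ [L L0 hL]|p1 _ [K K0 hK]].
- have [K K0 hK] := continuous_bounded (smooth_continuous sa).
  by exists K.
- exists (K + L) => [|s y hs]; first exact: addr_ge0.
  by apply: (le_trans (ler_normD _ _)); apply: lerD; [exact: hK|exact: hL].
- exists K => // s y hs; have := hK s y hs; rewrite normrM; case/andP: hs => s0 s1 h.
  by rewrite (ger0_norm s0) (le_trans _ h) // ler_piMl.
Qed.

Lemma poly_derive p X : is_vfield X -> poly_family p ->
  poly_family (fun s y => X y (p s)).
Proof.
move=> vX; elim=> [a sa|p1 p2 pf1 h1 pf2 h2|p1 pf1 h1].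
- by apply: PolyCst; exact: vf_smooth.
- rewrite (_ : (fun s y => _) = fun s y => X y (p1 s) + X y (p2 s)); first exact: PolyAdd.
  apply/funext => s; apply/funext => y.
  by rewrite (tvD (vf_tangent y vX)) //; exact: poly_smooth.
- rewrite (_ : (fun s y => _) = fun s y => s * X y (p1 s)); first exact: PolyShift.
  apply/funext => s; apply/funext => y.
  by rewrite (tvZ (vf_tangent y vX)) //; exact: poly_smooth.
Qed.

Lemma polyZ p (a : R) : poly_family p -> poly_family (fun s y => a * p s y).
Proof.
elim=> [b sb|p1 p2 pf1 h1 pf2 h2|p1 pf1 h1].
- by apply: PolyCst; exact: smoothZ.
- rewrite (_ : (fun s y => _) = fun s y => a * p1 s y + a * p2 s y); first exact: PolyAdd.
  by apply/funext => s; apply/funext => y; rewrite mulrDr.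
- rewrite (_ : (fun s y => _) = fun s y => s * (a * p1 s y)); first exact: PolyShift.
  by apply/funext => s; apply/funext => y; rewrite mulrCA.
Qed.

(* The second order Taylor polynomial, in [s], of the flow of [X] at time [s]. *)
Definition taylor2 (X : M -> (M -> R) -> R) (s : R) h y : R :=
  h y + s * X y h + s ^+ 2 / 2 * X y (fun z => X z h).

(** Second order expansion at s = 0, the rest being s^3 times a bounded family; brackets of flows
    already show at order s^2. *)
Definition jet (p : R -> M -> R) (a0 a1 a2 : M -> R) : Prop :=
  [/\ smooth a0, smooth a1, smooth a2 & exists2 r, poly_family r &
    p = fun s y => a0 y + s * (a1 y + s * (a2 y + s * r s y))].

Lemma jet_poly p a0 a1 a2 : jet p a0 a1 a2 -> poly_family p.
Proof.
move=> [s0 s1 s2 [r pr ->]]; apply: PolyAdd; first exact: PolyCst.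
apply: PolyShift; apply: PolyAdd; first exact: PolyCst.
apply: PolyShift; apply: PolyAdd; first exact: PolyCst.
exact: PolyShift.
Qed.

Lemma jet_cst a : smooth a -> jet (fun=> a) a (fun=> 0) (fun=> 0).
Proof.
move=> sa; split=> //; try exact: smooth_cst.
exists (fun _ _ => 0); first by apply: PolyCst; exact: smooth_cst.
by apply/funext => s; apply/funext => y; ring.
Qed.

Lemma jet_taylor2 X p a0 a1 a2 : is_vfield X -> jet p a0 a1 a2 ->
  jet (fun s => taylor2 X s (p s)) a0 (fun y => a1 y + X y a0)
    (fun y => a2 y + X y a1 + 2^-1 * X y (fun z => X z a0)).
Proof.
move=> vX [s0 s1 s2 [r pr ->]]; have sX h : smooth h -> smooth (fun y => X y h).
  exact: vf_smooth.
have expand b0 b1 b2 q s y : smooth b0 -> smooth b1 -> smooth b2 -> poly_family q ->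
    X y (fun z => b0 z + s * (b1 z + s * (b2 z + s * q s z))) =
    X y b0 + s * (X y b1 + s * (X y b2 + s * X y (q s))).
  move=> u0 u1 u2 /(poly_smooth s) uq; have tX := vf_tangent y vX.
  have v2 := smoothD u2 (smoothZ s uq); have v1 := smoothD u1 (smoothZ s v2).
  rewrite (tvD tX u0 (smoothZ s v1)) (tvZ tX s v1) (tvD tX u1 (smoothZ s v2)) (tvZ tX s v2).
  by rewrite (tvD tX u2 (smoothZ s uq)) (tvZ tX s uq).
have pX := poly_derive vX pr; have pXX := poly_derive vX pX.
have sXX h (sh : smooth h) := sX _ (sX _ sh).
split=> //.
- exact: smoothD s1 (sX _ s0).
- by apply: smoothD; [exact: smoothD s2 (sX _ s1)|apply: smoothZ; exact: sXX].
exists (fun s y => r s y + (X y a2 + s * X y (r s)) + 2^-1 * (X y (fun z => X z a1)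
    + s * (X y (fun z => X z a2) + s * X y (fun z => X z (r s))))).
  apply: PolyAdd.
    apply: PolyAdd => //; apply: PolyAdd; last exact: PolyShift.
    by apply: PolyCst; exact: sX.
  apply: polyZ; apply: PolyAdd; first by apply: PolyCst; exact: sXX.
  apply: PolyShift; apply: PolyAdd; first by apply: PolyCst; exact: sXX.
  exact: PolyShift.
apply/funext => s; apply/funext => y; rewrite /taylor2 expand //.
have -> : (fun z => X z (fun z => a0 z + s * (a1 z + s * (a2 z + s * r s z)))) =
    fun z => X z a0 + s * (X z a1 + s * (X z a2 + s * X z (r s))).
  by apply/funext => z; rewrite expand.
rewrite (expand _ _ _ (fun s z => X z (r s))); try exact: sX; last exact: pX.
by field.
Qed.

End CompactManifold.

(** * Hopf's barrier *)

Section MaximumPrinciple.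
Variables (R : realType) (n : nat) (M : cr_manifold R n).
Variables (theta : M -> ((M -> R) -> R) -> R) (T : M -> (M -> R) -> R).
Variable D : connection M.
Hypothesis S : tw_structure theta T D.
Local Notation tvec := ((M -> R) -> R).
Local Notation vfield := (M -> tvec).
Implicit Types (f h : M -> R) (x y : M) (u v w : tvec) (X Y Z : vfield).
Local Notation Lap := (Lap theta T D).
Hypothesis Mc : compact [set: M].
Variables (C : set M) (phi : M -> R) (m : R).
Hypothesis oC : open C.
Hypothesis cC : closed C.
Hypothesis sphi : smooth phi.
Hypothesis Lphi : forall x, 0 <= Lap phi x.
Hypothesis phim : forall x, C x -> phi x <= m.
Let F : set M := [set x | C x /\ phi x = m].

Let cF : closed F.
Proof.
apply: closedI => //; exact: (closed_eq_level (smooth_continuous sphi)).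
Qed.

Lemma smooth_near_lt h x (a : R) : smooth h -> h x < a -> \forall y \near x, h y < a.
Proof. move=> sh hx; exact: (@cvgr_lt _ _ _ (nbhs_filter x) h (h x) (smooth_continuous sh (x:=x)) a hx). Qed.

(* Barrier argument: [phi + eps w] with [w = - h + K h ^ 2 - rho] would have an interior
   maximum near [y] at which [Lap w > 0]. *)
Lemma hopf_levi h y v : smooth h -> F y -> (forall z, F z -> h y <= h z) ->
  levi_distr y v -> v h = 0.
Proof.
move=> sh [Cy phiy] hmin hv; have tv := levi_tangent hv.
pose k z := h z - h y; have sk : smooth k by apply: smoothB => //; exact: smooth_cst.
have k0 : k y = 0 by rewrite /k subrr.
have kF z : F z -> 0 <= k z by move=> /hmin; rewrite /k subr_ge0.
have -> : v h = v k by rewrite (tvB tv sh (@smooth_cst _ _ M (h y))) (tv_cst tv) subr0.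
apply: contrapT => vk; have [e oe] := orthonormal_exists S y.
(* The squared horizontal gradient at y; it is positive as soon as one horizontal derivative is
   nonzero. *)
pose q := \sum_i (e i k) ^+ 2.
have q0 : 0 < q.
  rewrite lt_neqAle sumr_ge0 ?andbT; last by move=> i _; exact: sqr_ge0.
  apply/eqP => /esym/eqP; rewrite psumr_eq0; last by move=> i _; exact: sqr_ge0.
  move=> /allP z; apply: vk; rewrite (orth_expand_levi S oe hv) sum_tvec big1 // => i _.
  have := z i (mem_index_enum _); rewrite /= sqrf_eq0 => /eqP ek.
  by rewrite tvecE ek mulr0.
have [rho [srho rho0 rhoy rhoE]] := separator_exists y.
(* As k vanishes at y, the Laplacian of k^2 there is 2 q; this K makes [Lap w y] at least 1. *)
pose K : R := (`|Lap k y + Lap rho y| + 1) / (2 * q).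
pose w z : R := (-1) * k z + (K * (k z * k z) + (-1) * rho z).
have skk := smoothM sk sk.
have sKR := smoothD (smoothZ K skk) (smoothZ (-1) srho).
have sw : smooth w by apply: smoothD => //; exact: smoothZ.
have Lw : 0 < Lap w y.
  rewrite (LapD S y (smoothZ (-1) sk) sKR) (LapZ S (-1) y sk).
  rewrite (LapD S y (smoothZ K skk) (smoothZ (-1) srho)) (LapZ S K y skk) (LapZ S (-1) y srho).
  rewrite (Lap_sqr S sk oe) k0 mulr0 mul0r add0r -/q.
  have -> : K * (2 * q) = `|Lap k y + Lap rho y| + 1 by rewrite /K divfK ?mulf_neq0 ?gt_eqF.
  have := ler_norm (Lap k y + Lap rho y); lra.
have K0 : 0 <= K by rewrite /K divr_ge0 ?addr_ge0 ?mulr_ge0 // ltW.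
have crho := smooth_continuous srho; have cw := smooth_continuous sw.
have near_good : \forall z \near y, [/\ 0 < Lap w z, K * k z < 1 & C z].
  have n1 : \forall z \near y, -1 * Lap w z < 0.
    by apply: smooth_near_lt; [apply: smoothZ; exact: (Lap_smooth S)|rewrite mulN1r oppr_lt0].
  have n2 : \forall z \near y, K * k z < 1.
    by apply: smooth_near_lt; [exact: smoothZ|rewrite k0 mulr0].
  have n3 : \forall z \near y, C z by exact: (open_nbhs_nbhs (conj oC Cy)).
  apply: filterS3 n1 n2 n3 => z a b c; split=> //; move: a; lra.
have [r r0 good] := sublevel_near Mc crho rho0 rhoE near_good.
(* On F one has k >= 0, and K k < 1 near y, so - k + K k^2 is nonpositive. *)
have wF z : F z -> rho z <= r -> w z <= - rho z.
  move=> Fz /good[_ Kk _]; have := kF z Fz => kz; rewrite /w.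
  have := mulr_ge0 kz (_ : 0 <= 1 - K * k z); rewrite subr_ge0 ltW // => /(_ isT); lra.
(* On the boundary, phi + eps w can reach m only where w >= 0. That part is compact and avoids F, so
   phi < m there with a margin that a small eps respects. *)
pose L : set M := [set z | rho z = r] `&` [set z | 0 <= w z].
have cL : closed L.
  by apply: closedI; [exact: closed_eq_level|exact: closed_ge_level].
have Lm z : L z -> phi z < m.
  move=> [/= rz wz]; have zr : rho z <= r by rewrite rz.
  have [_ _ Cz] := good z zr.
  rewrite lt_neqAle phim // andbT; apply/eqP => pz.
  have := wF z (conj Cz pz) zr; rewrite rz; lra.
have cphi := smooth_continuous sphi.
have [eps eps0 heps] : exists2 eps : R, 0 < eps & forall z, L z -> phi z + eps * w z < m.
  have [L0|L0] := pselect (L !=set0); last first.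
    by exists 1 => // z Lz; case: L0; exists z.
  have [z1 L1 h1] := closed_min Mc cL L0 (smooth_continuous (smoothN sphi)).
  have [z2 L2 h2] := closed_min Mc cL L0 (smooth_continuous (smoothN sw)).
  have W0 : 0 <= w z2 by case: L2.
  have d0 := Lm z1 L1.
  have W1 : 0 < w z2 + 1 by lra.
  have e0 : 0 < (m - phi z1) / (w z2 + 1) by rewrite divr_gt0 // subr_gt0.
  exists ((m - phi z1) / (w z2 + 1)) => // z Lz; set eps := _ / _ in e0 *.
  have eW : eps * (w z2 + 1) = m - phi z1 by rewrite /eps divfK // gt_eqF.
  have := h1 z Lz; rewrite lerN2 => p1.
  have := h2 z Lz; rewrite lerN2 -(ler_pM2l e0) => p2.
  move: eW p1 p2 e0; rewrite mulrDr mulr1; lra.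
pose u z : R := phi z + eps * w z.
have su : smooth u by apply: smoothD => //; exact: smoothZ.
have nonempty : [set z | rho z <= r] !=set0 by exists y; rewrite /= rhoy ltW.
have [z /= zr hz] := closed_min Mc (closed_le_level (a := r) crho) nonempty
  (smooth_continuous (smoothN su)).
have [Lwz _ Cz] := good z zr.
have uz : m <= u z.
  have := hz y; rewrite /= rhoy ltW // lerN2 => /(_ isT) h1.
  by apply: le_trans h1; rewrite /u /w phiy k0 rhoy !mulr0 !addr0 mulr0 addr0.
move: zr; rewrite le_eqVlt => /orP[/eqP rz|rz].
  have [wz|wz] := leP 0 (w z); first by have := heps z (conj rz wz); rewrite -/(u z) ltNge uz.
  have := phim Cz; move: uz; rewrite /u; have := eps0; move: wz; move=> a b c d; nra.
have lmax : \forall z' \near z, u z' <= u z.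
  have n1 : \forall z' \near z, rho z' < r by exact: smooth_near_lt.
  by apply: filterS n1 => z' h'; have := hz z' (ltW h'); rewrite lerN2.
have := Lap_local_max S su lmax.
rewrite (LapD S z sphi (smoothZ eps sw)) (LapZ S eps z sw).
have := Lphi z; have := mulr_gt0 eps0 Lwz; lra.
Qed.

End MaximumPrinciple.

(** * From horizontal directions to brackets *)

Section TangentMinimum.
Variables (R : realType) (n : nat) (M : cr_manifold R n).
Variables (theta : M -> ((M -> R) -> R) -> R) (T : M -> (M -> R) -> R).
Variable D : connection M.
Hypothesis S : tw_structure theta T D.
Local Notation tvec := ((M -> R) -> R).
Local Notation vfield := (M -> tvec).
Implicit Types (f h : M -> R) (x y : M) (u v w : tvec) (X Y Z : vfield).
Local Notation JJ := (J theta T).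
Hypothesis Mc : compact [set: M].
Variable F : set M.
Hypothesis cF : closed F.
Hypothesis hopf : forall h y v, smooth h -> F y -> (forall z, F z -> h y <= h z) ->
  levi_distr y v -> v h = 0.

Definition bounded_below (h : M -> R) (b : R) := forall z, F z -> b <= h z.

(** An approximate form of invariance of F under the flow of X. The time s is cut into short steps;
    at the minimizer on F after each step the X-derivative vanishes, so the minimum drops only by
    the truncation error. *)
Lemma transport_step X h s K : is_vfield X -> (forall y, levi_distr y (X y)) ->
  smooth h -> 0 < s -> 0 <= K ->
  (forall y, `|X y (fun z => X z h)| <= K) ->
  (forall y, `|X y (fun z => X z (fun z => X z h))| <= K) ->
  forall b, bounded_below h b -> bounded_below (taylor2 X s h) (b - 2 * K * s ^+ 3).
Proof.
move=> vX hX sh s0 K0 k2 k3 b hb z0 Fz0.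
have s1 : smooth (fun z => X z h) by exact: vf_smooth.
have s2 : smooth (fun z => X z (fun z => X z h)) by exact: vf_smooth.
have sT t : smooth (taylor2 X t h).
  by apply: smoothD; [apply: smoothD => //; exact: smoothZ|exact: smoothZ].
have step t d c : 0 <= t -> 0 <= d -> t + d <= s ->
    bounded_below (taylor2 X t h) c ->
    bounded_below (taylor2 X (t + d) h) (c - d * (s ^+ 2 * K + d * K)).
  move=> t0 d0 tds hc.
  have [z Fz zmin] := closed_min Mc cF (ex_intro _ z0 Fz0) (smooth_continuous (sT (t + d))).
  have e : X z (taylor2 X (t + d) h) = 0.
    exact: (hopf (sT (t + d)) Fz zmin (hX z)).
  move=> z' Fz'; apply: le_trans (zmin z' Fz'); have := hc z Fz.
  have tX := vf_tangent z vX; move: e.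
  rewrite /taylor2 (tvD tX (smoothD sh (smoothZ (t + d) s1)) (smoothZ _ s2)).
  rewrite (tvD tX sh (smoothZ _ s1)) (tvZ tX _ s1) (tvZ tX _ s2).
  have := k2 z; have := k3 z; rewrite !ler_norml => /andP[a1 a2] /andP[b1 b2].
  move: (X z h) (h z) (X z (fun z => X z h)) (X z (fun z => X z (fun z => X z h))) a1 a2 b1 b2.
  move=> x1 x0 x2 x3 a1 a2 b1 b2 e hcz.
  (* Vanishing of the X-derivative at time t + d eliminates x1; what remains is third order in s or
     second order in the step d. *)
  have E : x0 + (t + d) * x1 + (t + d) ^+ 2 / 2 * x2 =
      (x0 + t * x1 + t ^+ 2 / 2 * x2) - d * ((t + d) ^+ 2 / 2 * x3) - d ^+ 2 / 2 * x2.
    have -> : x1 = - ((t + d) * x2 + (t + d) ^+ 2 / 2 * x3) by lra.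
    by field.
  rewrite E.
  have td : (t + d) ^+ 2 <= s ^+ 2 by rewrite lerXn2r ?nnegrE ?addr_ge0 // ltW.
  have c1 : (t + d) ^+ 2 / 2 * x3 <= s ^+ 2 * K.
    have q0 : 0 <= (t + d) ^+ 2 by exact: sqr_ge0.
    apply: (@le_trans _ _ ((t + d) ^+ 2 * K)); last exact: ler_wpM2r.
    by rewrite -mulrA ler_wpM2l //; lra.
  have c2 := ler_wpM2l d0 c1.
  have c3 : d ^+ 2 / 2 * x2 <= d * (d * K).
    have q0 : 0 <= d ^+ 2 by exact: sqr_ge0.
    by rewrite mulrA -expr2 -mulrA ler_wpM2l //; lra.
  lra.
(* With N > 1 / s the step d = s / N is at most s^2, so the d^2 errors also accumulate to at most K
   s^3. *)
have [N hN] : exists N : nat, s^-1 < N%:R by exists (Num.truncn s^-1).+1; exact: truncnS_gt.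
have N0 : 0 < N%:R :> R by rewrite (lt_trans _ hN) // invr_gt0.
pose d := s / N%:R.
have d0 : 0 <= d by rewrite divr_ge0 // ltW.
have iter_step i : (i <= N)%N -> bounded_below (taylor2 X (i%:R * d) h)
    (b - i%:R * (d * (s ^+ 2 * K + d * K))).
  elim: i => [|i IH] iN.
    rewrite !mul0r subr0 => z Fz; rewrite /taylor2 mul0r expr0n /= mul0r addr0 mul0r addr0.
    exact: hb.
  have i1 : i.+1%:R * d = i%:R * d + d by rewrite -natr1 mulrDl mul1r.
  rewrite i1 -[i.+1%:R]natr1 mulrDl mul1r opprD addrA; apply: step => //.
  - by rewrite mulr_ge0.
  - by rewrite -i1 /d mulrA ler_pdivrMr // mulrC ler_wpM2l ?ler_nat // ltW.
  - exact: IH (ltnW iN).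
have Nd : N%:R * d = s by rewrite /d mulrC divfK // gt_eqF.
have := iter_step N (leqnn N); rewrite mulrA Nd => /(_ z0 Fz0); apply: le_trans.
have ds : d <= s ^+ 2.
  rewrite /d ler_pdivrMr // expr2 -mulrA ler_pMr //.
  by rewrite -ler_pdivrMl // mulr1 ltW.
have h1 : s * (d * K) <= s * (s ^+ 2 * K) by rewrite ler_wpM2l ?ler_wpM2r // ltW.
by rewrite exprS; lra.
Qed.

(** A form of [transport_step] that can be iterated: the function may depend on s, and the error
    constant is uniform in s. *)
Lemma transport X p a0 a1 a2 : is_vfield X -> (forall y, levi_distr y (X y)) ->
  jet p a0 a1 a2 -> exists p', jet p' a0 (fun y => a1 y + X y a0)
    (fun y => a2 y + X y a1 + 2^-1 * X y (fun z => X z a0)) /\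
  exists2 K, 0 <= K & forall s b, 0 < s <= 1 -> bounded_below (p s) b ->
    bounded_below (p' s) (b - K * s ^+ 3).
Proof.
move=> vX hX jp; exists (fun s => taylor2 X s (p s)); split; first exact: jet_taylor2.
have pp := jet_poly jp; have p2 := poly_derive vX (poly_derive vX pp).
have p3 := poly_derive vX p2.
have [K2 K20 hK2] := poly_bounded Mc p2; have [K3 K30 hK3] := poly_bounded Mc p3.
have K0 : 0 <= K2 + K3 by exact: addr_ge0.
exists (2 * (K2 + K3)) => [|s b /andP[s0 s1] hb]; first exact: mulr_ge0.
have s01 : 0 <= s <= 1 by rewrite s1 ltW.
apply: transport_step => //; first exact: poly_smooth.
- by move=> y; apply: le_trans (hK2 s y s01) _; rewrite lerDl.
- by move=> y; apply: le_trans (hK3 s y s01) _; rewrite lerDr.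
Qed.

(* Transport along [X], [Y], [- X], [- Y] in turn changes [h] by [s ^ 2] times the bracket,
   up to [O (s ^ 3)]. *)
Lemma bracket_min_ge0 X Y h q : is_vfield X -> is_vfield Y ->
  (forall y, levi_distr y (X y)) -> (forall y, levi_distr y (Y y)) ->
  smooth h -> F q -> (forall z, F z -> h q <= h z) -> 0 <= bracket Y X q h.
Proof.
move=> vX vY hX hY sh Fq hmin.
have vNX := vfieldN vX; have vNY := vfieldN vY.
have hNX y : levi_distr y (- X y) by exact: leviN.
have hNY y : levi_distr y (- Y y) by exact: leviN.
have sX k : smooth k -> smooth (fun y => X y k) by exact: vf_smooth.
have sY k : smooth k -> smooth (fun y => Y y k) by exact: vf_smooth.
have [p1 [j1 [K1 K10 t1]]] := transport vX hX (jet_cst sh).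
have e1 : (fun y => 0 + X y h) = fun y => X y h by apply/funext => y; rewrite add0r.
rewrite e1 in j1.
have [p2 [j2 [K2 K20 t2]]] := transport vY hY j1.
have [p3 [j3 [K3 K30 t3]]] := transport vNX hNX j2.
have e3 : (fun y => X y h + Y y h + (- X y) h) = fun y => Y y h.
  by apply/funext => y; rewrite !tvecE; ring.
rewrite e3 in j3.
have [p4 [j4 [K4 K40 t4]]] := transport vNY hNY j3.
have [_ _ _ [r pr e4]] := j4.
have [L L0 hL] := poly_bounded Mc pr.
have tX := vf_tangent q vX; have tY := vf_tangent q vY.
pose K := K1 + K2 + K3 + K4 + L.
(* After the four transports the first order coefficient cancels; dividing the inequality at q by
   s^2 leaves the bracket up to K s. *)
have main s : 0 < s <= 1 -> - K * s <= bracket Y X q h.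
  move=> hs; have /andP[s0 s1] := hs; have s01 : 0 <= s <= 1 by rewrite s1 ltW.
  have b0 : bounded_below (fun=> h q) (h q) by [].
  have := t4 s _ hs (t3 s _ hs (t2 s _ hs (t1 s (h q) hs hmin))) q Fq.
  rewrite e4 !tvecE.
  have -> : (fun z => (- X z) h) = fun z => - X z h by [].
  have -> : (fun z => (- Y z) h) = fun z => - Y z h by [].
  rewrite (tvN tX (sX _ sh)) (tvN tY (sY _ sh)) (tvD tX (sX _ sh) (sY _ sh)) (tv_cst tX).
  have := hL s q s01; rewrite ler_norml => /andP[_ h1]; have s3 : 0 < s ^+ 3 by rewrite exprn_gt0.
  have h2 := ler_wpM2l (ltW s3) h1.
  rewrite /bracket /K => h3; rewrite -(ler_pM2l (exprn_gt0 2 s0)).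
  move: h2 h3; rewrite !exprS expr0 mulr1; lra.
apply: contrapT => /negP; rewrite -ltNge => neg.
have K0 : 0 <= K by rewrite /K !addr_ge0.
set b := bracket Y X q h in main neg *.
pose s := Num.min 1 (- b / (2 * (K + 1))).
have K1' : 0 < 2 * (K + 1) by lra.
have s0 : 0 < s by rewrite /s lt_min ltr01 divr_gt0 // oppr_gt0.
have sb : s * (2 * (K + 1)) <= - b by rewrite -ler_pdivlMr // /s ge_min lexx orbT.
have := main s; rewrite s0 /s ge_min lexx /= -/s => /(_ isT); have := mulr_ge0 K0 (ltW s0).
move: sb; lra.
Qed.

Lemma bracket_min X Y h q : is_vfield X -> is_vfield Y ->
  (forall y, levi_distr y (X y)) -> (forall y, levi_distr y (Y y)) ->
  smooth h -> F q -> (forall z, F z -> h q <= h z) -> bracket X Y q h = 0.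
Proof.
move=> vX vY hX hY sh Fq hmin; apply/eqP; rewrite eq_le (bracket_min_ge0 vY vX) // andbT.
by rewrite bracketN tvecE oppr_le0 (bracket_min_ge0 vX vY).
Qed.

(** For a unit horizontal X, theta([X, JX]) = - 2; hence the bracket has a nonzero T component and T
    h = 0 follows from [bracket_min]. *)
Lemma critical_min h q v : (0 < n)%N -> smooth h -> F q ->
  (forall z, F z -> h q <= h z) -> tangent q v -> v h = 0.
Proof.
move=> n0 sh Fq hmin tv; have hH u : levi_distr q u -> u h = 0 by exact: hopf.
suff Th : T q h = 0.
  by rewrite (projE theta T q v) !tvecE Th mulr0 addr0; exact: hH (proj_levi S tv).
have [e oe] := orthonormal_exists S q.
have n2 : (0 < n.*2)%N by rewrite double_gt0.
have [X [vX Xe hX]] := levi_ext S (orth_levi oe (Ordinal n2)).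
have vJX := vfieldJ S vX.
have hJX y : levi_distr y (JJ y (X y)) by apply: (J_levi S); exact: vf_tangent.
have := bracket_min vX vJX hX hJX sh Fq hmin.
have tb := vf_tangent q (vfield_bracket vX vJX).
rewrite (projE theta T q (bracket X _ q)) !tvecE (hH _ (proj_levi S tb)) add0r.
rewrite (dth_levi S q vX vJX hX hJX) (dthG S (hX q) (hJX q)) (JJE S (hX q)).
rewrite (gNr S (vf_tangent q vX) (vf_tangent q vX)) opprK Xe; case: (oe) => _ ->.
by rewrite eqxx mulr1 => /eqP; rewrite mulf_eq0 => /orP[|/eqP //]; rewrite oppr_eq0 pnatr_eq0.
Qed.

(** For z near p in F let q be a point of F nearest to z. It is a critical point on M of the squared
    coordinate distance to z, whose only critical point nearby is z itself; hence z = q belongs to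
    F. *)
Lemma min_set_open : (0 < n)%N -> open F.
Proof.
move=> n0; rewrite openE => p Fp; rewrite /interior.
have [E fE] := frames S p; have [Y [sY had _ [N pN Ninj]]] := coordinates p.
have [B [_ _ _ nondeg]] := frame_coef fE sY had.
have [chi [sc c01 c1 c0]] := smooth_bump pN.
have good : \forall y \near p, [/\ N y, (forall b : 'I_(n.*2.+1) -> R,
        (forall i, \sum_j b j * E i y (Y j) = 0) -> forall j, b j = 0) &
        \forall z \near y, chi z = 1].
  by apply: filterS3 pN nondeg (near_near c1) => y *; split.
have [r r0 hr] := sublevel_near Mc (smooth_continuous (separator_smooth sY sc p))
  (separator_ge0 Y c01 p) (separator_eq0 c01 Ninj (nbhs_singleton pN) c0) good.
have sd : smooth (fun z => \sum_j (Y j p - Y j z) ^+ 2).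
  apply: smooth_sum => j _; have s : smooth (fun z => Y j p - Y j z).
    by apply: smoothB => //; exact: smooth_cst.
  exact: smoothM.
(* By [separator_le] the quarter keeps q within level r of p, where the coordinates are injective
   and nondegenerate. *)
have small : \forall z \near p, \sum_j (Y j p - Y j z) ^+ 2 < r / 4.
  apply: smooth_near_lt => //; rewrite big1 ?divr_gt0 // => j _.
  by rewrite subrr expr0n.
apply: filterS2 small pN => z hz Nz.
have ss := separator_smooth sY sc z.
have [q Fq qmin] := closed_min Mc cF (ex_intro _ p Fp) (smooth_continuous ss).
have pq : separator Y chi z q <= \sum_j (Y j p - Y j z) ^+ 2.
  apply: le_trans (qmin p Fp) _; rewrite /separator (nbhs_singleton c1) subrr addr0 //.
have [|Nq ndq cq] := hr q; first by have := separator_le Y c01 z p q; move: pq hz; lra.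
suff -> : z = q by [].
apply: Ninj => // j; apply/eqP; rewrite -subr_eq0 -oppr_eq0 opprB; apply/eqP; move: j.
apply: ndq => i; have ti : tangent q (E i q) by case: fE => vE _; exact: vf_tangent.
have := critical_min n0 ss Fq qmin ti.
have sj j : smooth (fun y => (Y j y - Y j z) ^+ 2).
  have s : smooth (fun y => Y j y - Y j z) by apply: smoothB => //; exact: smooth_cst.
  exact: smoothM.
have sS := @smooth_sum _ _ _ _ (index_enum _) xpredT _ (fun j _ => sj j).
rewrite (tv_near ti ss sS); last by apply: filterS cq => y cy; rewrite /separator cy subrr addr0.
rewrite (@tv_sum _ _ _ _ _ ti _ (index_enum _) xpredT _ (fun j _ => sj j)) => e.
apply: (@mulfI _ 2); first by rewrite pnatr_eq0.
rewrite mulr0; apply: etrans e; rewrite mulr_sumr; apply: eq_bigr => j _.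
have s : smooth (fun y => Y j y - Y j z) by apply: smoothB => //; exact: smooth_cst.
have -> : E i q (fun y => (Y j y - Y j z) ^+ 2) = E i q (fun y => (Y j y - Y j z) * (Y j y - Y j z)) by [].
by rewrite (tvM ti s s) (tvB ti (sY j) (@smooth_cst _ _ M _)) (tv_cst ti) subr0; ring.
Qed.

End TangentMinimum.

Lemma strong_maximum (R : realType) (n : nat) (M : cr_manifold R n)
    (theta : M -> ((M -> R) -> R) -> R) (T : M -> (M -> R) -> R) (D : connection M)
    (S : tw_structure theta T D) (Mc : compact [set: M]) (C : set M) (phi : M -> R) :
  (0 < n)%N -> open C -> closed C -> connected C -> smooth phi ->
  (forall x, 0 <= Lap theta T D phi x) ->
  forall x y, C x -> C y -> phi x = phi y.
Proof.
move=> n0 oC cC kC sphi Lphi x y Cx Cy.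
have [z Cz hz] := closed_min Mc cC (ex_intro _ x Cx) (smooth_continuous (smoothN sphi)).
have phim w : C w -> phi w <= phi z by move=> /hz; rewrite lerN2.
pose F : set M := [set w | C w /\ phi w = phi z].
have cF : closed F by apply: closedI => //; exact: (closed_eq_level (smooth_continuous sphi)).
have oF : open F.
  apply: (min_set_open S Mc cF) => // h w v sh Fw hmin hv.
  exact: (hopf_levi S Mc oC sphi Lphi phim sh Fw hmin hv).
have FC : F = C.
  apply: kC; first by exists z.
  - by exists F => //; apply/seteqP; split=> [w [? ?]|w []].
  - by exists F => //; apply/seteqP; split=> [w [? ?]|w []].
have [[_ ->] [_ ->]] : F x /\ F y by rewrite FC.
by [].
Qed.

(** * Covariant differentiation along curves *)

Section RealFunctions.
Variable R : realType.
Implicit Types (u v : R -> R) (t : R) (I : set R).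

Lemma is_derive_addf u v t a b : is_derive t (1 : R) u a -> is_derive t (1 : R) v b ->
  is_derive t (1 : R) (fun s => u s + v s) (a + b).
Proof. by move=> du dv; exact: (is_deriveD du dv). Qed.

Lemma is_derive_mulf u v t a b : is_derive t (1 : R) u a -> is_derive t (1 : R) v b ->
  is_derive t (1 : R) (fun s => u s * v s) (a * v t + u t * b).
Proof.
move=> du dv; apply: (is_derive_eq (is_deriveM du dv)).
by rewrite /GRing.scale /= addrC mulrC.
Qed.

Lemma is_derive_sumf J (r : seq J) (F : J -> R -> R) (d : J -> R) t :
  (forall i, is_derive t (1 : R) (F i) (d i)) ->
  is_derive t (1 : R) (fun s => \sum_(i <- r) F i s) (\sum_(i <- r) d i).
Proof.
move=> h; elim: r => [|i r IH].
  rewrite big_nil; under eq_fun do rewrite big_nil; exact: is_derive_cst.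
by rewrite big_cons; under eq_fun do rewrite big_cons; exact: is_derive_addf.
Qed.

Section SmoothOn.
Variable I : set R.
Hypothesis oI : open I.

Lemma smooth_on_is_derive u t : smooth_on I u -> I t -> is_derive t (1 : R) u (derive1 u t).
Proof.
move=> /smooth_on_Cn/(_ 0%N) su It; apply: DeriveDef; last by rewrite derive1E.
by apply: diff_derivable; exact: Cn_diff su It.
Qed.

Lemma smooth_on_derive1 u : smooth_on I u -> smooth_on I (derive1 u).
Proof.
move=> /smooth_on_Cn su; apply/smooth_on_Cn => k.
have := su k.+1; rewrite CnS => -[_ /(_ 1)].
by apply: Cn_eq => // x _; rewrite derive1E.
Qed.

Lemma smooth_on_eq u v : (forall t, I t -> u t = v t) -> smooth_on I u -> smooth_on I v.
Proof.
by move=> uv /smooth_on_Cn su; apply/smooth_on_Cn => k; exact: (Cn_eq oI uv (su k)).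
Qed.

Lemma smooth_on_cst (a : R) : smooth_on I (fun=> a).
Proof. by apply/smooth_on_Cn => k; exact: Cn_cst. Qed.

Lemma smooth_onD u v : smooth_on I u -> smooth_on I v -> smooth_on I (fun t => u t + v t).
Proof.
move=> /smooth_on_Cn su /smooth_on_Cn sv; apply/smooth_on_Cn => k.
exact: (CnD oI (su k) (sv k)).
Qed.

Lemma smooth_onM u v : smooth_on I u -> smooth_on I v -> smooth_on I (fun t => u t * v t).
Proof.
move=> /smooth_on_Cn su /smooth_on_Cn sv; apply/smooth_on_Cn => k.
exact: (CnM oI (su k) (sv k)).
Qed.

Lemma smooth_on_sum J (r : seq J) (F : J -> R -> R) :
  (forall i, smooth_on I (F i)) -> smooth_on I (fun t => \sum_(i <- r) F i t).
Proof.
move=> h; apply/smooth_on_Cn => k.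
by apply: (@Cn_sum _ _ k I J r xpredT F oI) => i _; exact: (smooth_on_Cn _ _).1 (h i) k.
Qed.

End SmoothOn.

Lemma is_derive0_eq I u : (forall s t r, I s -> I t -> s <= r <= t -> I r) ->
  (forall t, I t -> is_derive t (1 : R) u 0) -> forall s t, I s -> I t -> u s = u t.
Proof.
move=> cI du; suff h s t : I s -> I t -> s < t -> u s = u t.
  move=> s t Is It; have [st|ts|->] // := ltgtP s t; first exact: h.
  by apply/esym; exact: h.
move=> Is It st.
have sub r : s <= r <= t -> I r by exact: cI.
have cu : {within `[s, t], continuous u}.
  apply: continuous_in_subspaceT => r; rewrite inE /= in_itv /= => /sub Ir.
  by apply/differentiable_continuous/derivable1_diffP; case: (du r Ir).
have du' r : r \in `]s, t[ -> is_derive r (1 : R) u ((fun=> 0) r).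
  by rewrite in_itv /= => /andP[a b]; apply/du/sub; rewrite !ltW.
have [r _] := MVT st du' cu; rewrite mul0r => /eqP; rewrite subr_eq0 => /eqP //.
Qed.

(* The energy [(u' - v') ^ 2 + w ^ 2 (u - v) ^ 2], with [v] the right-hand side, is constant. *)
Lemma harmonic_unique I u u' (w a : R) : open I ->
  (forall s t r, I s -> I t -> s <= r <= t -> I r) -> I a ->
  (forall t, I t -> is_derive t (1 : R) u (u' t)) ->
  (forall t, I t -> is_derive t (1 : R) u' (- (w ^+ 2 * u t))) -> u' a = 0 ->
  forall t, I t -> u t = u a * cos ((t - a) * w).
Proof.
move=> oI cI Ia du du' u'a t It.
have dlin s : is_derive s (1 : R) (fun r => (r - a) * w) w.
  have := is_derive_mulf (is_derive_addf (is_derive_id s (1 : R)) (is_derive_cst (- a) s 1))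
    (is_derive_cst w s 1).
  by move=> h; apply: (is_derive_eq h); rewrite addr0 mul1r mulr0 addr0.
have dcos s : is_derive s (1 : R) (fun r => cos ((r - a) * w)) (- sin ((s - a) * w) * w).
  exact: (is_derive1_comp (is_derive_cos _) (dlin s)).
have dsin s : is_derive s (1 : R) (fun r => sin ((r - a) * w)) (cos ((s - a) * w) * w).
  exact: (is_derive1_comp (is_derive_sin _) (dlin s)).
pose x s := u s + (- u a) * cos ((s - a) * w).
pose y s := u' s + (u a * w) * sin ((s - a) * w).
have dx s : I s -> is_derive s (1 : R) x (y s).
  move=> Is; have h := is_derive_addf (du s Is) (is_derive_mulf (is_derive_cst (- u a) s 1) (dcos s)).
  by apply: (is_derive_eq h); rewrite /y /cst /=; ring.
have dy s : I s -> is_derive s (1 : R) y (- (w ^+ 2 * x s)).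
  move=> Is; have h := is_derive_addf (du' s Is) (is_derive_mulf (is_derive_cst (u a * w) s 1) (dsin s)).
  by apply: (is_derive_eq h); rewrite /x /cst /=; ring.
(* For w = 0 the energy does not control x; then y is constant, hence zero, and x is constant. *)
have [w0|w0] := eqVneq w 0.
  have y0 s : I s -> y s = 0.
    move=> Is; rewrite -u'a -[u' a](_ : y a = _); last by rewrite /y w0 mulr0 mul0r addr0.
    apply: (is_derive0_eq cI) => // r Ir; apply: (is_derive_eq (dy r Ir)).
    by rewrite w0 expr0n mul0r oppr0.
  have xa : x t = x a.
    by apply: (is_derive0_eq cI) => // r Ir; apply: (is_derive_eq (dx r Ir)); rewrite y0.
  by move: xa; rewrite /x w0 !mulr0 cos0; lra.
pose e s := y s * y s + w ^+ 2 * (x s * x s).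
have e0 : e t = e a.
  apply: (is_derive0_eq cI) => // r Ir.
  have h := is_derive_addf (is_derive_mulf (dy r Ir) (dy r Ir))
    (is_derive_mulf (is_derive_cst (w ^+ 2) r 1) (is_derive_mulf (dx r Ir) (dx r Ir))).
  by apply: (is_derive_eq h); rewrite /cst /=; ring.
have ea : e a = 0 by rewrite /e /x /y subrr mul0r cos0 sin0 u'a; ring.
have /eqP : x t * x t = 0.
  apply/eqP; have := e0; rewrite ea /e => /eqP.
  rewrite -!expr2 paddr_eq0 ?sqr_ge0 //; last by apply: mulr_ge0; exact: sqr_ge0.
  move=> /andP[_].
  by rewrite mulf_eq0 !sqrf_eq0 (negbTE w0).
rewrite mulf_eq0 orbb /x => /eqP; lra.
Qed.

End RealFunctions.

Section FieldsAlong.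
Variables (R : realType) (m : nat) (M : oriented_manifold R m).
Variables (I : set R) (gam : R -> M).
Hypothesis oI : open I.
Hypothesis sg : smooth_curve I gam.
Local Notation tvec := ((M -> R) -> R).
Local Notation vfield := (M -> tvec).
Local Notation vel := (velocity gam).
Implicit Types (f : M -> R) (t : R) (V W : R -> tvec) (Y : vfield).

Lemma velocity_derive f t : smooth f -> I t -> is_derive t (1 : R) (f \o gam) (vel t f).
Proof.
move=> sf It; rewrite /velocity asboolT //.
exact: smooth_on_is_derive (smooth_curve_comp oI sg sf) It.
Qed.

Lemma is_derive1_unique u t (a b : R) : is_derive t (1 : R) u a -> is_derive t (1 : R) u b -> a = b.
Proof. by move=> da db; rewrite -(derive_val (is_derive := da)) (derive_val (is_derive := db)). Qed.

Lemma velocity_tangent t : I t -> tangent (gam t) (vel t).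
Proof.
move=> It; split.
- by move=> f nf; rewrite /velocity asboolF.
- move=> f h sf sh; have d := velocity_derive (smoothD sf sh) It.
  by apply: (is_derive1_unique d); exact: is_derive_addf (velocity_derive sf It) (velocity_derive sh It).
- move=> a f sf; have d := velocity_derive (smoothZ a sf) It.
  apply: (is_derive1_unique d).
  by apply: (is_derive_eq (is_derive_mulf (is_derive_cst a t 1) (velocity_derive sf It))); rewrite mul0r add0r.
- move=> f h sf sh; have d := velocity_derive (smoothM sf sh) It.
  by apply: (is_derive1_unique d); exact: is_derive_mulf (velocity_derive sf It) (velocity_derive sh It).
Qed.

Lemma velocity_field : field_along I gam vel.
Proof.
split=> [t It|f sf]; first exact: velocity_tangent.
apply: (smooth_on_eq oI (u := derive1 (f \o gam))).
  by move=> t It; rewrite /velocity asboolT.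
exact/smooth_on_derive1/(smooth_curve_comp oI sg sf).
Qed.

Lemma field_alongD V W : field_along I gam V -> field_along I gam W ->
  field_along I gam (fun t => V t + W t).
Proof.
move=> [tV sV] [tW sW]; split=> [t It|f sf]; first by apply: tangentD; auto.
by apply: (smooth_onD oI); auto.
Qed.

Lemma field_alongM (h : R -> R) V : smooth_on I h -> field_along I gam V ->
  field_along I gam (fun t => h t *: V t).
Proof.
move=> sh [tV sV]; split=> [t It|f sf]; first by apply: tangentZ; auto.
by apply: (smooth_onM oI) => //; auto.
Qed.

Lemma field_along_eq0 V : (forall t, I t -> V t = 0) -> field_along I gam V.
Proof.
move=> V0; split=> [t It|f sf]; first by rewrite V0 //; exact: tangent0.
by apply: (smooth_on_eq oI _ (@smooth_on_cst _ I 0)) => t It; rewrite V0.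
Qed.

Lemma field_along_sum J (r : seq J) (F : J -> R -> tvec) :
  (forall i, field_along I gam (F i)) -> field_along I gam (fun t => \sum_(i <- r) F i t).
Proof.
move=> h; elim: r => [|i r IH].
  by apply: field_along_eq0 => t _; rewrite big_nil.
by under eq_fun do rewrite big_cons; exact: field_alongD.
Qed.

Lemma field_along_vfield Y : is_vfield Y -> field_along I gam (fun t => Y (gam t)).
Proof.
move=> vY; split=> [t _|f sf]; first exact: vf_tangent.
exact: (smooth_curve_comp oI sg (vf_smooth vY sf)).
Qed.

Variables (D : connection M) (K : (R -> tvec) -> R -> tvec).
Hypothesis HK : is_cov_along D I gam K.

Lemma cov_field V : field_along I gam V -> field_along I gam (K V).
Proof. by case: HK => + _ _ _; apply. Qed.

Lemma covD V W t : field_along I gam V -> field_along I gam W -> I t ->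
  K (fun s => V s + W s) t = K V t + K W t.
Proof. by move=> fV fW It; case: HK => _ + _ _; apply. Qed.

Lemma covM (h : R -> R) V t : smooth_on I h -> field_along I gam V -> I t ->
  K (fun s => h s *: V s) t = derive1 h t *: V t + h t *: K V t.
Proof. by move=> sh fV It; case: HK => _ _ + _; apply. Qed.

Lemma cov_vfield Y t : is_vfield Y -> I t ->
  K (fun s => Y (gam s)) t = D (gam t) (vel t) Y.
Proof. by move=> vY It; case: HK => _ _ _; apply. Qed.

(* [V] is multiplied by the indicator function of the complement of [I]. *)
Lemma cov_eq0 V t : (forall s, I s -> V s = 0) -> I t -> K V t = 0.
Proof.
move=> V0 It; pose h s : R := if `[< I s >] then 0 else 1.
have h0 s : I s -> h s = 0 by move=> Is; rewrite /h asboolT.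
have sh : smooth_on I h.
  by apply: (smooth_on_eq oI _ (@smooth_on_cst _ I 0)) => s Is; rewrite h0.
have -> : V = fun s => h s *: V s.
  apply/funext => s; rewrite /h; case: asboolP => [/V0 ->|_]; first by rewrite scaler0.
  by rewrite scale1r.
by rewrite covM ?V0 // ?h0 // ?scaler0 ?scale0r ?addr0 //; exact: field_along_eq0.
Qed.

(** K acts on functions defined on all of R, so that agreement on I suffices has to be derived from
    its axioms. *)
Lemma cov_ext V W t : field_along I gam V -> field_along I gam W ->
  (forall s, I s -> V s = W s) -> I t -> K V t = K W t.
Proof.
move=> fV fW VW It; have z s : I s -> V s - W s = 0 by move=> Is; rewrite VW // subrr.
have -> : V = fun s => W s + (V s - W s) by apply/funext => s; rewrite addrC subrK.
by rewrite covD // ?(cov_eq0 z It) ?addr0 //; exact: field_along_eq0.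
Qed.

Lemma cov_sum J (r : seq J) (F : J -> R -> tvec) t : I t ->
  (forall i, field_along I gam (F i)) ->
  K (fun s => \sum_(i <- r) F i s) t = \sum_(i <- r) K (F i) t.
Proof.
move=> It h; elim: r => [|i r IH].
  by rewrite big_nil cov_eq0 // => s _; rewrite big_nil.
rewrite big_cons -IH; under eq_fun do rewrite big_cons; apply: covD => //.
exact: field_along_sum.
Qed.

Lemma near_gam (P : M -> Prop) t : I t -> (\forall y \near gam t, P y) ->
  \forall s \near t, P (gam s).
Proof. by move=> It; have [gc _] := sg; exact: (gc t It). Qed.

(** Locality of K by a cutoff pulled back from M: chi along the curve has value 1 and derivative 0
    at t, so multiplying by it does not change K at t. *)
Lemma cov_local (chi : M -> R) V W t : field_along I gam V -> field_along I gam W ->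
  smooth chi -> I t -> (\forall y \near gam t, chi y = 1) ->
  (forall s, I s -> chi (gam s) != 0 -> V s = W s) -> K V t = K W t.
Proof.
move=> fV fW sc It c1 VW; have sh := smooth_curve_comp oI sg sc.
have d0 : derive1 (chi \o gam) t = 0.
  have d := smooth_on_is_derive sh It; apply: (is_derive1_unique d).
  apply: near_eq_is_derive (is_derive_cst (1 : R) t 1).
  by apply: filterS (near_gam It c1) => s e; rewrite /= e.
have cut U : field_along I gam U -> K (fun s => (chi \o gam) s *: U s) t = K U t.
  by move=> fU; rewrite covM // d0 /= (nbhs_singleton c1) scale0r add0r scale1r.
rewrite -(cut V fV) -(cut W fW); apply: cov_ext => //; try exact: field_alongM.
move=> s Is /=; have [->|c0] := eqVneq (chi (gam s)) 0; first by rewrite !scale0r.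
by rewrite VW.
Qed.

End FieldsAlong.

(** * Compatibility of covariant differentiation with the metric *)

Section MetricAlong.
Variables (R : realType) (n : nat) (M : cr_manifold R n).
Variables (theta : M -> ((M -> R) -> R) -> R) (T : M -> (M -> R) -> R).
Variable D : connection M.
Hypothesis S : tw_structure theta T D.
Local Notation tvec := ((M -> R) -> R).
Local Notation vfield := (M -> tvec).
Implicit Types (f h : M -> R) (x y : M) (u v w : tvec) (X Y Z : vfield).
Local Notation g := (webster theta T).
Variables (I : set R) (gam : R -> M).
Hypothesis oI : open I.
Hypothesis sg : smooth_curve I gam.
Variable K : (R -> tvec) -> R -> tvec.
Hypothesis HK : is_cov_along D I gam K.
Local Notation vel := (velocity gam).
Implicit Types (t : R) (V W : R -> tvec).

(** K is given by axioms only; expanding V in fields restricted from M computes it in terms of D. *)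
Lemma cov_expand V t : field_along I gam V -> I t ->
  exists (E : 'I_(n.*2.+1) -> vfield) (a : 'I_(n.*2.+1) -> R -> R),
  [/\ forall i, is_vfield (E i), forall i, smooth_on I (a i),
      \forall s \near t, V s = \sum_i a i s *: E i (gam s) &
      K V t = \sum_i (derive1 (a i) t *: E i (gam t)
                      + a i t *: D (gam t) (vel t) (E i))].
Proof.
move=> fV It; have [tV sV] := fV.
have [E fE] := frames S (gam t); have [vE _] := fE.
have [Y [sY had _ _]] := coordinates (gam t).
have [B [sB sp _ _]] := frame_coef fE sY had.
have [chi [sc _ c1 c0]] := smooth_bump sp.
pose a i s := \sum_j V s (Y j) * B j i (gam s).
have sa i : smooth_on I (a i).
  apply: smooth_on_sum => // j; apply: (smooth_onM oI); first exact: sV.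
  exact: (smooth_curve_comp oI sg (sB j i)).
have fa i : field_along I gam (fun s => a i s *: E i (gam s)).
  by apply: field_alongM => //; exact: field_along_vfield.
exists E, a; split=> //.
  have n1 : \forall s \near t, I s by exact: open_nbhs_nbhs.
  have n2 := near_gam sg It sp.
  by apply: filterS2 n1 n2 => s Is h; exact: (h _ (tV s Is)).
rewrite (cov_local oI sg HK (chi := chi) fV (field_along_sum oI (index_enum _) fa) sc It c1).
  rewrite (cov_sum oI HK) //; apply: eq_bigr => i _.
  by rewrite (covM HK) ?(cov_vfield HK) //; exact: field_along_vfield.
move=> s Is cs; have : ~ ~ (forall v, tangent (gam s) v ->
    v = \sum_i (\sum_j v (Y j) * B j i (gam s)) *: E i (gam s)).
  by move=> /c0 e; move: cs; rewrite e eqxx.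
by move=> /contrapT/(_ _ (tV s Is)).
Qed.

Lemma is_derive_expand (N : nat) (a b : 'I_N -> R -> R) (a' b' : 'I_N -> R) (u : R -> R) t :
  (forall i, is_derive t (1 : R) (a i) (a' i)) ->
  (forall i, is_derive t (1 : R) (b i) (b' i)) ->
  (\forall s \near t, u s = \sum_i a i s * b i s) ->
  is_derive t (1 : R) u (\sum_i (a' i * b i t + a i t * b' i)).
Proof.
move=> da db ue; apply: (near_eq_is_derive (f := fun s => \sum_i a i s * b i s)).
  by apply: filterS ue => s ->.
apply: (@is_derive_sumf _ _ (index_enum _) (fun i s => a i s * b i s)) => i; exact: is_derive_mulf.
Qed.

Lemma cov_metric_field Y V t : is_vfield Y -> field_along I gam V -> I t ->
  is_derive t (1 : R) (fun s => g (gam s) (Y (gam s)) (V s))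
    (g (gam t) (D (gam t) (vel t) Y) (V t) + g (gam t) (Y (gam t)) (K V t)).
Proof.
move=> vY fV It; have tv := velocity_tangent oI sg It.
have [E [a [vE sa nV KV]]] := cov_expand fV It.
have h : is_derive t (1 : R) (fun s => g (gam s) (Y (gam s)) (V s))
    (\sum_i (derive1 (a i) t * g (gam t) (Y (gam t)) (E i (gam t)) +
      a i t * vel t (fun y => g y (Y y) (E i y)))).
  apply: (@is_derive_expand _ a (fun i s => g (gam s) (Y (gam s)) (E i (gam s)))
    (fun i => derive1 (a i) t) (fun i => vel t (fun y => g y (Y y) (E i y)))).
  - by move=> i; exact: (smooth_on_is_derive (sa i) It).
  - by move=> i; exact: (velocity_derive oI sg (g_smooth S vY (vE i)) It).
  - apply: filterS nV => s ->; have tY := vf_tangent (gam s) vY.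
    have tE i := vf_tangent (gam s) (vE i).
    rewrite (g_sumr S) //; last by move=> i; exact: tangentZ.
    by apply: eq_bigr => i _; rewrite (gZr S).
apply: (is_derive_eq h); rewrite KV {1}(nbhs_singleton nV).
have tY := vf_tangent (gam t) vY; have tE i := vf_tangent (gam t) (vE i).
have tDY := D_tangent S tv vY; have tDE i := D_tangent S tv (vE i).
rewrite (g_sumr S) //; last by move=> i; exact: tangentZ.
rewrite (g_sumr S) //; last by move=> i; apply: tangentD; exact: tangentZ.
rewrite -big_split; apply: eq_bigr => i _ /=.
rewrite (gZr S _ tDY (tE i)) (gDr S tY (tangentZ _ (tE i)) (tangentZ _ (tDE i))).
rewrite (gZr S _ tY (tE i)) (gZr S _ tY (tDE i)) (D_metric S tv vY (vE i)); ring.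
Qed.

(** Only one argument is expanded in a frame; [cov_metric_field] then treats each frame field
    against W. *)
Lemma cov_metric V W t : field_along I gam V -> field_along I gam W -> I t ->
  is_derive t (1 : R) (fun s => g (gam s) (V s) (W s))
    (g (gam t) (K V t) (W t) + g (gam t) (V t) (K W t)).
Proof.
move=> fV fW It; have tv := velocity_tangent oI sg It.
have [E [a [vE sa nV KV]]] := cov_expand fV It; have [tW _] := fW.
have [tKW _] := cov_field HK fW.
have h : is_derive t (1 : R) (fun s => g (gam s) (V s) (W s))
    (\sum_i (derive1 (a i) t * g (gam t) (E i (gam t)) (W t) +
      a i t * (g (gam t) (D (gam t) (vel t) (E i)) (W t)
               + g (gam t) (E i (gam t)) (K W t)))).
  apply: (@is_derive_expand _ a (fun i s => g (gam s) (E i (gam s)) (W s))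
    (fun i => derive1 (a i) t) (fun i => g (gam t) (D (gam t) (vel t) (E i)) (W t)
               + g (gam t) (E i (gam t)) (K W t))).
  - by move=> i; exact: (smooth_on_is_derive (sa i) It).
  - by move=> i; exact: cov_metric_field.
  - have n1 : \forall s \near t, I s by exact: open_nbhs_nbhs.
    apply: filterS2 n1 nV => s Is ->; have tE i := vf_tangent (gam s) (vE i).
    rewrite (g_suml S) //; [|by move=> i; exact: tangentZ|exact: tW].
    by apply: eq_bigr => i _; rewrite (gZl S _ (tE i) (tW s Is)).
apply: (is_derive_eq h); rewrite KV (nbhs_singleton nV).
have tE i := vf_tangent (gam t) (vE i); have tDE i := D_tangent S tv (vE i).
have tWt := tW t It; have tKWt := tKW t It.
rewrite (g_suml S _ _ tWt); last by move=> i; apply: tangentD; exact: tangentZ.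
rewrite (g_suml S _ _ tKWt); last by move=> i; exact: tangentZ.
rewrite -big_split; apply: eq_bigr => i _ /=.
rewrite (gDl S (tangentZ _ (tE i)) (tangentZ _ (tDE i)) tWt).
rewrite (gZl S _ (tE i) tWt) (gZl S _ (tDE i) tWt) (gZl S _ (tE i) tKWt); ring.
Qed.

End MetricAlong.

(** * Extremal eigenfunctions *)

Section Components.
Variables (R : realType) (m : nat) (M : oriented_manifold R m).
Local Notation component x := (connected_component [set: M] x).
Implicit Types x y : M.

Lemma component_refl x : component x x. Proof. exact: connected_component_refl. Qed.

Lemma component_near x y : component x y -> \forall z \near y, component x z.
Proof.
move=> xy; have [B [Bn kB _]] : exists B : set M, [/\ nbhs y B, connected B & B `<=` setT].
  by apply: near_connected; exact: (@filterT _ _ (nbhs_filter y)).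
have By := nbhs_singleton Bn; rewrite (same_connected_component xy); apply: filterS Bn.
exact: connected_component_max.
Qed.

Lemma component_open x : open (component x).
Proof. by rewrite openE => y; exact: component_near. Qed.

Lemma component_closedT x : closed (component x).
Proof. exact/component_closed/closedT. Qed.

Lemma critical_local_min f x : smooth f -> (\forall y \near x, f x <= f y) -> critical f x.
Proof.
move=> sf h v tv; have [d _] : (forall v, tangent x v -> v (fun y => - f y) = 0) /\
    forall X, is_vfield X -> X x (fun y => X y (fun y => - f y)) <= 0.
  apply: local_max_derivatives; first exact: smoothN.
  by apply: filterS h => y; rewrite lerN2.
by have := d v tv; rewrite (tvN tv sf) => /eqP; rewrite oppr_eq0 => /eqP.
Qed.

End Components.

Section Extremal.
Variables (R : realType) (n : nat) (M : cr_manifold R n).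
Variables (theta : M -> ((M -> R) -> R) -> R) (T : M -> (M -> R) -> R).
Variable D : connection M.
Hypothesis S : tw_structure theta T D.
Local Notation tvec := ((M -> R) -> R).
Local Notation vfield := (M -> tvec).
Implicit Types (f h : M -> R) (x y : M) (u v w : tvec) (X Y Z : vfield).
Local Notation g := (webster theta T).
Local Notation JJ := (J theta T).
Local Notation tor := (torsion D).
Local Notation component x := (connected_component [set: M] x).
Local Notation Lap := (Lap theta T D).
Hypothesis n0 : (0 < n)%N.
Hypothesis Mc : compact [set: M].
Variables (f : M -> R) (c k lambda : R).
Hypothesis sf : smooth f.
Hypothesis Tf : forall x, T x f = 0.
Hypothesis lE : lambda = - (2 * n%:R * c).
Hypothesis kE : lambda + c = - k.
Hypothesis c0 : 0 < c.
Hypothesis Lf : forall y, Lap f y = lambda * f y.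
Hypothesis hk : forall x v, levi_distr x v ->
    k * g x v v <= ricci D x v v - 2 * g x (tor x (T x) v) (JJ x v).
Local Notation Z := (hgrad theta T f).
Local Notation psi := (fun y => 2^-1 * (g y (Z y) (Z y) + c * (f y * f y))).

Lemma energy_component x y : component x y -> psi y = psi x.
Proof.
move=> xy; have xx := component_refl x.
exact: (strong_maximum S Mc n0 (component_open x) (@component_closedT _ _ M x)
  (@component_connected _ _ x) (smooth_energy S sf c)
  (energy_subharmonic S sf Tf lE kE Lf hk) xy xx).
Qed.

Lemma hess_extremal x u : levi_distr x u -> D x u Z = - (c * f x) *: u.
Proof.
(* psi is locally constant, so every point is a local maximum and [Lap psi] is nonpositive as
   well. *)
apply: (energy_rigidity S sf Tf lE kE Lf hk); apply/eqP; rewrite eq_le.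
rewrite (energy_subharmonic S sf Tf lE kE Lf hk) andbT.
apply: (Lap_local_max S (smooth_energy S sf c)).
by apply: filterS (component_near (component_refl x)) => y /energy_component ->.
Qed.

Lemma critical_hgrad x : critical f x -> g x (Z x) (Z x) = 0.
Proof.
move=> cx; have tZ := vf_tangent x (hgrad_vf S sf).
by rewrite (hgrad_ker S sf Tf tZ); exact: cx.
Qed.

Lemma min_max_component x x1 x2 : component x x1 -> component x x2 ->
  (forall y, component x y -> f y <= f x1) -> (forall y, component x y -> f x2 <= f y) ->
  f x2 = - f x1.
Proof.
move=> C1 C2 max1 min2.
have cr1 : critical f x1.
  have [d _] : (forall v, tangent x1 v -> v f = 0) /\
      forall X, is_vfield X -> X x1 (fun y => X y f) <= 0.
    by apply: local_max_derivatives => //; apply: filterS (component_near C1).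
  exact: d.
have cr2 : critical f x2.
  by apply: critical_local_min => //; apply: filterS (component_near C2).
have := energy_component C1; rewrite -(energy_component C2).
rewrite (critical_hgrad cr1) (critical_hgrad cr2) !add0r => e.
have /eqP : f x1 ^+ 2 = f x2 ^+ 2.
  by apply: (mulfI (lt0r_neq0 c0)); rewrite !expr2; lra.
(* If the two extrema coincide, f is constant on the component; the signs of the Laplacians of f and
   - f then give lambda f = 0, so f = 0 there. *)
rewrite eqf_sqr => /orP[/eqP e12|/eqP ->]; last by rewrite opprK.
have near_eq : \forall y \near x1, f y = f x1.
  apply: filterS (component_near C1) => y Cy; apply/eqP; rewrite eq_le max1 //= e12.
  exact: min2.
have l1 : Lap f x1 <= 0 by apply: (Lap_local_max S sf); apply: filterS near_eq => y ->.
have l2 : Lap (fun y => -1 * f y) x1 <= 0.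
  by apply: (Lap_local_max S (smoothZ (-1) sf)); apply: filterS near_eq => y ->.
have f1 : f x1 = 0.
  move: l1 l2; rewrite (LapZ S (-1) x1 sf) Lf lE => l1 l2.
  have : 2 * n%:R * c * f x1 = 0 by lra.
  move=> /eqP; rewrite mulf_eq0 => /orP[|/eqP //].
  by rewrite !mulf_eq0 !pnatr_eq0 (gtn_eqF n0) (gt_eqF c0).
by rewrite -e12 f1 oppr0.
Qed.

(** Stated on an interval and for an arbitrary constant speed w, since a minimizing geodesic need be
    neither complete nor of unit speed. With u = f along the curve, u' = g(Z, velocity), and the
    geodesic equation leaves u'' = - c w^2 u. *)
Lemma geodesic_cos (I : set R) (gam : R -> M) (a : R) : open I ->
  (forall s t r, I s -> I t -> s <= r <= t -> I r) -> I a ->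
  lengthy_geodesic_on D I gam -> critical f (gam a) ->
  exists w : R, (forall t, I t -> speed theta gam t = w) /\
    forall t, I t -> f (gam t) = f (gam a) * cos ((t - a) * (w * Num.sqrt c)).
Proof.
move=> oI cI Ia [[sg [K [HK geo]]] len] cr.
have hv t : I t -> levi_distr (gam t) (velocity gam t).
  by move=> It; apply: len => // h sh; case: (velocity_derive oI sg sh It).
have tv t : I t -> tangent (gam t) (velocity gam t) by move=> /hv/levi_tangent.
have fv := velocity_field oI sg.
pose q t := g (gam t) (velocity gam t) (velocity gam t).
have qa t : I t -> q t = q a.
  move=> It; apply: (is_derive0_eq cI) => // r Ir.
  apply: (is_derive_eq (cov_metric S oI sg HK fv fv Ir)).
  by rewrite geo // (g_sym S (tv r Ir) (tangent0 _)) (g0l S (tv r Ir)) addr0.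
have spE t : I t -> speed theta gam t = Num.sqrt (q a).
  by move=> It; rewrite -(qa t It) /q (g_levi S (hv t It) (hv t It)).
exists (Num.sqrt (q a)); split=> //.
have q0 : 0 <= q a by exact: (g_ge0 S (tv a Ia)).
have vZ := hgrad_vf S sf.
apply: (harmonic_unique (u := fun t => f (gam t))
  (u' := fun t => g (gam t) (Z (gam t)) (velocity gam t)) oI cI Ia).
- move=> t It; apply: (is_derive_eq (velocity_derive oI sg sf It)).
  by rewrite (hgrad_ker S sf Tf (tv t It)).
- move=> t It; apply: (is_derive_eq (cov_metric_field S oI sg HK vZ fv It)).
  have tZ := vf_tangent (gam t) vZ; have tvt := tv t It.
  rewrite geo // (g_sym S tZ (tangent0 _)) (g0l S tZ) addr0 (hess_extremal (hv t It)).
  have -> : (Num.sqrt (q a) * Num.sqrt c) ^+ 2 = q a * c.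
    by rewrite exprMn sqr_sqrtr // sqr_sqrtr // ltW.
  by rewrite (gZl S _ tvt tvt) -/(q t) qa //; ring.
- by rewrite (hgrad_ker S sf Tf (tv a Ia)); exact: cr (tv a Ia).
Qed.

Lemma critical_degenerate x : critical f x -> degenerate f x.
Proof.
move=> cr; exists (T x); split; first exact: (tangentT S).
  by move=> T0; have := thetaT S x; rewrite T0 (theta0 S (levi0 x)) => /esym/eqP; rewrite oner_eq0.
(* The default value 0 is harmless; for any admissible extensions the value is T (Y f), which is
   [T, Y] f since T f = 0, and vanishes at a critical point. *)
move=> v tv; rewrite /hessian /ext2; case: xgetP => // r _ [X [Y [vX vY XT _ ->]]].
have vT := vfieldT S.
have := cr _ (vf_tangent x (vfield_bracket vT vY)).
rewrite /bracket; have -> : (fun y => T y f) = fun=> 0 by apply/funext.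
by rewrite (tv_cst (vf_tangent x vY)) subr0 XT.
Qed.

End Extremal.

Lemma curve_length_cst (R : realType) (n : nat) (M : cr_manifold R n)
    (theta : M -> ((M -> R) -> R) -> R) (gam : R -> M) (a b v : R) : a <= b ->
  (forall t, a <= t <= b -> speed theta gam t = v) ->
  curve_length theta a b gam = ((b - a) * v)%:E.
Proof.
move=> ab h; rewrite /curve_length (eq_integral (cst v%:E)); last first.
  by move=> t; rewrite inE /= in_itv /= => /h ->.
rewrite integral_cst //= lebesgue_measure_itv /= lte_fin -EFinD.
have [_|ba] := ltP a b; first by rewrite -EFinM mulrC.
have -> : b = a by apply/eqP; rewrite eq_le ab ba.
by rewrite subrr mul0r mule0.
Qed.

Theorem theorem2 (R : realType) (n : nat) (n_gt0 : (0 < n)%N)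
    (M : cr_manifold R n) (M_compact : compact [set: M])
    (theta : M -> ((M -> R) -> R) -> R)
    (theta_ph : is_pseudohermitian theta)
    (theta_pos : levi_positive theta)
    (T : M -> (M -> R) -> R) (T_char : is_characteristic theta T)
    (LC : connection M) (LC_lc : is_levi_civita (webster theta T) LC)
    (nabla : connection M) (nabla_tw : is_tanaka_webster theta T nabla)
    (k : R) (k_gt0 : 0 < k)
    (ricci_ge : forall (x : M) (v : (M -> R) -> R), levi_distr x v ->
       k * levi_form theta x v v <=
         ricci nabla x v v
         + 2 * ph_torsion theta T nabla x v (J theta T x v))
    (lambda : R) (lambdaE : lambda = - (2 * n%:R * k / (2 * n%:R - 1)))
    (lambda_spec : Spec theta T LC lambda)
    (calH : set (M -> R))
    (calHE : calH = Eigen theta T LC lambda `&` Ker_T T)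
    (calH_neq0 : exists h, calH h /\ exists x, h x <> 0)
    (f : M -> R) (f_H : calH f)
    (c : R) (cE : c = k / (2 * n%:R - 1))
    (x0 : M) (alpha : R) (alphaE : alpha = sup (range f))
    (f_x0 : f x0 = alpha) :
  (forall gamma : R -> M,
     lengthy_geodesic nabla gamma -> unit_speed theta gamma -> gamma 0 = x0 ->
     forall s : R, f (gamma s) = alpha * cos (s * Num.sqrt c))
  /\
  (sasakian T nabla ->
     [/\ (forall x y : M, joined_by_minimizing_geodesic theta nabla x y) ->
           forall x : M,
             f x = alpha * cos (fine (d_CC theta x0 x) * Num.sqrt c),
         (forall y0 : M, f y0 = inf (range f) -> f y0 = - alpha) &
         forall x : M,
           geodesic_sphere theta nabla x0 (pi / Num.sqrt c) x ->
           critical f x /\ degenerate f x]).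
Proof.
have S : tw_structure theta T nabla by [].
have n1 : 1 <= n%:R :> R by rewrite ler1n.
have d0 : 0 < 2 * n%:R - 1 :> R by lra.
have c0 : 0 < c by rewrite cE divr_gt0.
have lE : lambda = - (2 * n%:R * c) by rewrite lambdaE cE mulrA.
have kE : lambda + c = - k by rewrite lambdaE cE; field; rewrite gt_eqF.
have [[sf Ef] [_ Tf]] : (Eigen theta T LC lambda `&` Ker_T T) f by rewrite -calHE.
have Lf y : Lap theta T nabla f y = lambda * f y by rewrite -(Lap_LC S y LC_lc sf).
have hk := ricci_torsion_ge S n_gt0 ricci_ge.
have [L L0 fL] := continuous_bounded M_compact (smooth_continuous sf).
have fle y : f y <= f x0.
  rewrite f_x0 alphaE; apply: ub_le_sup; last by exists y.
  by exists L => _ [z _ <-]; rewrite (le_trans (ler_norm _)).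
have cr0 : critical f x0.
  have [d _] : (forall v, tangent x0 v -> v f = 0) /\
      forall X, is_vfield X -> X x0 (fun y => X y f) <= 0.
    by apply: local_max_derivatives => //; exact: nearW.
  exact: d.
have cos_along := geodesic_cos S n_gt0 M_compact sf Tf lE kE c0 Lf hk.
have minmax := min_max_component S n_gt0 M_compact sf Tf lE kE c0 Lf hk.
have min_on x : exists2 z, connected_component [set: M] x z &
    forall y, connected_component [set: M] x y -> f z <= f y.
  apply: (closed_min M_compact (@component_closedT _ _ M x)) (smooth_continuous sf).
  by exists x; exact: component_refl.
(* On the component of y the minimum is minus the maximum, and that maximum is at most alpha. *)
have fge y : - alpha <= f y.
  have [z yz zmin] := min_on y.
  have [w yw wmax] : exists2 w, connected_component [set: M] y w &
      forall x, connected_component [set: M] y x -> - f w <= - f x.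
    apply: (closed_min M_compact (@component_closedT _ _ M y) _ (smooth_continuous (smoothN sf))).
    by exists y; exact: component_refl.
  apply: le_trans (zmin y (component_refl y)).
  rewrite (minmax y w z yw yz _ zmin) ?lerN2 -?f_x0 // => x xw.
  by have := wmax x xw; rewrite lerN2.
have along gamma : lengthy_geodesic nabla gamma -> unit_speed theta gamma -> gamma 0 = x0 ->
    forall s : R, f (gamma s) = alpha * cos (s * Num.sqrt c).
  move=> geo us g0 s; have cr : critical f (gamma 0) by rewrite g0.
  have [w [sw cw]] := cos_along [set: R] gamma 0 openT (fun _ _ _ _ _ _ => I) I geo cr.
  (* The speed w of [geodesic_cos] is identified by evaluating at 0. *)
  have w1 : w = 1 by rewrite -(sw 0 I).
  by rewrite cw // g0 f_x0 w1 mul1r subr0.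
split=> // _; split.
- move=> joined x; have [p [a [b [q [gam [[pa ab bq] [geo gx0 gx len]]]]]]] := joined x0 x.
  have Iab t : a <= t <= b -> `]p, q[%classic t.
    move=> /andP[at' tb]; rewrite /= in_itv /=; apply/andP; split; lra.
  have cI s t r : `]p, q[%classic s -> `]p, q[%classic t -> s <= r <= t -> `]p, q[%classic r.
    by rewrite /= !in_itv /= => /andP[? ?] /andP[? ?] /andP[? ?]; apply/andP; split; lra.
  have Ia : `]p, q[%classic a by apply: Iab; rewrite lexx ltW.
  have cra : critical f (gam a) by rewrite gx0.
  have oI : open `]p, q[%classic by exact: interval_open.
  have [w [sw cw]] := cos_along _ gam a oI cI Ia geo cra.
  have sab t : a <= t <= b -> speed theta gam t = w by move=> /Iab; exact: sw.
  rewrite -len (curve_length_cst (ltW ab) sab).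
  rewrite -{1}gx cw ?gx0 ?f_x0 /= ?mulrA //.
  by apply: Iab; rewrite lexx ltW.
- move=> y0 fy0; apply/eqP; rewrite eq_le fge andbT.
  have [z xz zmin] := min_on x0.
  (* The component of x0 contains a point where f = - alpha, so the global lower bound is
     attained. *)
  rewrite -f_x0 -(minmax x0 x0 z (component_refl x0) xz (fun y _ => fle y) zmin) fy0.
  by apply: ge_inf; [exists (- alpha) => _ [y _ <-]|exists z].
- move=> x [gam [geo us g0 gx]].
  (* At s = pi / sqrt c the cosine is - 1, so x realizes the global lower bound and is therefore
     critical. *)
  have fx : f x = - alpha.
    rewrite -gx (along gam geo us g0) divfK ?cospi ?mulrN1 //.
    by rewrite gt_eqF // sqrtr_gt0.
  have crx : critical f x.
    apply: critical_local_min => //; apply: nearW => y.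
    by rewrite fx.
  by split => //; exact: (critical_degenerate S Tf crx).
Qed.
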